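(* The length structure $L_{\mathcal{W}\mathcal{F}}$ extends $L_{\overline{M}}$ (every piecewise $C^1$ path in sense I is a piecewise $C^1$ path in sense II, with the same length), and the induced distances $d_{\mathcal{W}\mathcal{F}}$ and $d_{\overline{M}}$ coincide on $\mathcal{W}\mathcal{F}(n)$.
   Context: Fix an integer $n\ge1$; $\mathrm{O}(n)$ is the orthogonal group, $\mathrm{Skew}(n)$ the space of real skew-symmetric $n\times n$ matrices. **Flags.** A type is a tuple $I=(p_1,\dots,p_r)$ of positive integers with $p_1+\dots+p_r=n$. $\mathrm{O}(I)\subset\mathrm{O}(n)$ is the subgroup of block-diagonal matrices $\mathrm{diag}(R_1,\dots,R_r)$, $R_i\in\mathrm{O}(p_i)$. $\mathcal{F}_I=\mathrm{O}(n)/\mathrm{O}(I)$ (quotient by right multiplication) carries the quotient topology and the unique smooth structure making the quotient map $\pi_I:\mathrm{O}(n)\to\mathcal{F}_I$ a smooth submersion. $\mathfrak{m}_I\subset\mathrm{Skew}(n)$ is the space of skew-symmetric matrices whose diagonal blocks (of sizes $p_1,\dots,p_r$) vanish; $T_U\pi_I$ restricts to a linear isomorphism $U\mathfrak{m}_I\to T_{\pi_I(U)}\mathcal{F}_I$. **Weighted flags.** $\Delta(n)=\{\mu\in[0,1]^n:\sum_i\mu_i=1\}$. For $\mu\in\Delta(n)$ let $k_1<\dots<k_s$ be the indices $i$ with $\mu_i>0$. The type $\tau(\mu)$ is $(k_1,k_2-k_1,\dots,k_s-k_{s-1})$ if $k_s=n$, and $(k_1,k_2-k_1,\dots,k_s-k_{s-1},n-k_s)$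 if $k_s<n$. On $\Delta(n)\times\mathrm{O}(n)$ put $(\alpha,U)\sim(\beta,V)$ iff $\alpha=\beta$ and $\pi_{\tau(\alpha)}(U)=\pi_{\tau(\alpha)}(V)$. $\mathcal{W}\mathcal{F}(n)=(\Delta(n)\times\mathrm{O}(n))/\!\sim$ has the quotient topology; its elements are written $(\mu,W)$ with $\mu\in\Delta(n)$, $W\in\mathcal{F}_{\tau(\mu)}$. **Cells.** For nonempty $K\subset\{1,\dots,n\}$, $\mathring\Delta(n;K)=\{\mu\in\Delta(n):\mu_j>0\text{ for }j\in K,\ \mu_j=0\text{ for }j\notin K\}$; $\tau(\mu)$ is constant on it, denoted $I(K)$. $M(|K|;K)=\{(\mu,W)\in\mathcal{W}\mathcal{F}(n):\mu\in\mathring\Delta(n;K)\}=\mathring\Delta(n;K)\times\mathcal{F}_{I(K)}$ (product smooth structure), and $M(n)=M(n;\{1,\dots,n\})$. Also $\widetilde{M}(K)=\Delta_K\times\mathcal{F}_{I(K)}$ with $\Delta_K=\{\mu\in\Delta(n):\mu_j=0\text{ for }j\notin K\}$, regarded as a smooth manifold with boundary with its product structure; for $K=\{1,\dots,n\}$ this is $\Delta(n)\times\mathcal{F}_{(1,\dots,1)}$. **The metric $g$.** Fix $f:[0,1]^n\to\mathbb{R}_+$ Lipschitz continuous on $[0,1]^n$, $C^2$ on $[0,1]^n\setminus\{0\}$, with $f(\mu)=0$ iff $\mu=0$. For $i<j$, $\mu_{i\to j}\in[0,1]^n$ has $l$-th entry $\mu_l$ if $i\le l\le j-1$ and $0$ otherwise.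 For $(\mu,W)\in M(|K|;K)$, $I=I(K)$, $W=\pi_I(U)$, and tangent vectors $(\alpha,X),(\beta,Y)$ of $M(|K|;K)$ at $(\mu,W)$, let $B=(b_{ij}),C=(c_{ij})\in\mathfrak{m}_I$ be the unique matrices with $X=T_U\pi_I\cdot UB$, $Y=T_U\pi_I\cdot UC$; then $g_{\mu,W}((\alpha,X),(\beta,Y))=\sum_i\alpha_i\beta_i+\sum_{i<j}f(\mu_{i\to j})^2b_{ij}c_{ij}$. This is a Riemannian metric on each cell. **Paths, sense I.** A continuous $\gamma:[a,b]\to\mathcal{W}\mathcal{F}(n)$ is a piecewise $C^1$ path (I) if there are $a=a_0<\dots<a_N=b$ such that for every $i$, $\gamma(]a_{i-1},a_i[)\subset M(n)$ and $\gamma|_{]a_{i-1},a_i[}$ extends to $[a_{i-1},a_i]$ as a $C^1$ path in $\Delta(n)\times\mathcal{F}_{(1,\dots,1)}$. Its length is $L_{\overline{M}}(\gamma)=\int_a^b\sqrt{g_{\gamma(t)}(\dot\gamma(t),\dot\gamma(t))}\,dt$ (the times $a_i$ being disregarded), and $d_{\overline{M}}(p,q)$ is the infimum of $L_{\overline{M}}(\gamma)$ over such paths from $p$ to $q$. **Paths, sense II.** A continuous $\gamma:[a,b]\to\mathcal{W}\mathcal{F}(n)$ is a piecewise $C^1$ path in $\overline{M(|K|;K)}$ if there are $a=a_0<\dots<a_N=b$ such that for every $i$, $\gamma(]a_{i-1},a_i[)\subset M(|K|;K)$ and $\gamma|_{]a_{i-1},a_i[}$ extends to a $C^1$ path in $\widetilde{M}(K)$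 on $[a_{i-1},a_i]$; then $L_{\overline{M(|K|;K)}}(\gamma)=\sum_{i=1}^N\int_{a_{i-1}}^{a_i}\sqrt{g_{\gamma(t)}(\dot\gamma(t),\dot\gamma(t))}\,dt$. $\gamma$ is a piecewise $C^1$ path (II) if there are $a=a_0<\dots<a_N=b$ and $K_1,\dots,K_N$ such that each $\gamma|_{[a_{i-1},a_i]}$ is a piecewise $C^1$ path in $\overline{M(|K_i|;K_i)}$; its length is $L_{\mathcal{W}\mathcal{F}}(\gamma)=\sum_{i=1}^NL_{\overline{M(|K_i|;K_i)}}(\gamma|_{[a_{i-1},a_i]})$, and $d_{\mathcal{W}\mathcal{F}}(p,q)$ is the infimum of $L_{\mathcal{W}\mathcal{F}}(\gamma)$ over piecewise $C^1$ paths (II) from $p$ to $q$. *)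

(* Defs.v *)
From HB Require Import structures.
From mathcomp Require Import all_boot all_order all_algebra generic_quotient.
From mathcomp Require Import all_classical all_reals all_analysis.

Set Implicit Arguments.
Unset Strict Implicit.
Unset Printing Implicit Defensive.

Import Order.TTheory GRing.Theory Num.Theory.
Import numFieldNormedType.Exports.

Local Open Scope classical_set_scope.
Local Open Scope ring_scope.
Local Open Scope quotient_scope.

(* C^k functions on an open set A (finite-dimensional V and W): differentiable
   on A, with all directional derivatives of class C^(k-1) on A. *)
Fixpoint Ck (R : realType) (V W : normedModType R) (k : nat)
    (A : set V) (h : V -> W) : Prop :=
  if k is k'.+1 then
    (forall x, A x -> differentiable h x) /\ forall v : V, Ck k' A ('D_v h)
  else forall x, A x -> {for x, continuous h}.

Definition smooth (R : realType) (V W : normedModType R)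
    (A : set V) (h : V -> W) : Prop := forall k, Ck k A h.

(* The regularity class P for a function h on a subset D of V that need not be
   open, or on a set D of elements of a submanifold embedded in V by e: around
   each point of D, h is the restriction of a function of class P on an open
   subset of V. *)
Definition extends_locally (R : realType) (V W : normedModType R) (T : Type)
    (e : T -> V) (P : set V -> (V -> W) -> Prop) (D : set T) (h : T -> W) :=
  forall x, D x -> exists (A : set V) (k : V -> W),
    [/\ open A, A (e x), P A k & forall y, D y -> A (e y) -> h y = k (e y)].

Definition orthogonal_mx (R : realType) n : set 'M[R]_n :=
  [set U | U^T *m U = 1%:M].

(* O(n), with the topology induced by the space of matrices. *)
Notation Ogrp R n := (set_type (@orthogonal_mx R n)).

Definition skew_mx (R : realType) n : set 'M[R]_n := [set B | B^T = - B].

(* A type (p_1, ..., p_r) is a sequence of naturals; [reshape_index I i] is the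
   number of the block containing the index i. *)
Definition same_block n (I : seq nat) (i j : 'I_n) : bool :=
  reshape_index I i == reshape_index I j.

Definition block_orthogonal (R : realType) n (I : seq nat) : set 'M[R]_n :=
  [set Q | orthogonal_mx Q /\ forall i j, ~~ same_block I i j -> Q i j = 0].

Definition m_ (R : realType) n (I : seq nat) : set 'M[R]_n :=
  [set B | skew_mx B /\ forall i j, same_block I i j -> B i j = 0].

Definition flag_rel (R : realType) n (I : seq nat) : rel (Ogrp R n) :=
  fun U V => `[< exists2 Q, block_orthogonal I Q & val V = val U *m Q >].

Lemma flag_rel_equiv (R : realType) n I :
  equiv_class_of (@flag_rel R n I).
Proof.
split.
- move=> U; apply/asboolP; exists 1%:M; last by rewrite mulmx1.
  split=> [|i j]; first by rewrite /orthogonal_mx /= trmx1 mulmx1.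
  rewrite mxE; case: (eqVneq i j) => [->|//].
  by rewrite /same_block eqxx.
- suff s U V : @flag_rel R n I U V -> flag_rel I V U.
    by move=> U V; apply/idP/idP; exact: s.
  move=> /asboolP[Q [oQ bQ] VE]; apply/asboolP; exists Q^T.
    split=> [|i j]; first by rewrite /orthogonal_mx /= trmxK mulmx1C.
    by rewrite mxE /same_block eq_sym; exact: bQ.
  by rewrite VE -mulmxA (mulmx1C oQ) mulmx1.
- move=> V U W /asboolP[P [oP bP] VE] /asboolP[Q [oQ bQ] WE].
  apply/asboolP; exists (P *m Q); last by rewrite WE VE mulmxA.
  split=> [|i j].
    rewrite /orthogonal_mx /= trmx_mul mulmxA -(mulmxA _ _ P).
    by rewrite (oP : _ = _) mulmx1.
  move=> ij; rewrite mxE big1 // => k _.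
  have [ik|/bP->] := boolP (same_block I i k); last by rewrite mul0r.
  have [kj|/bQ->] := boolP (same_block I k j); last by rewrite mulr0.
  by move: ij; rewrite /same_block (eqP ik) (eqP kj) eqxx.
Qed.

Canonical flag_equiv (R : realType) n I :=
  EquivRelPack (@flag_rel_equiv R n I).

(* F_I = O(n)/O(I), with the quotient topology. *)
Definition flag (R : realType) n (I : seq nat) : Type :=
  quotient_topology {eq_quot (@flag_equiv R n I)}.
HB.instance Definition _ R n I := Topological.on (@flag R n I).
HB.instance Definition _ R n I := Quotient.on (@flag R n I).

Definition pi_ (R : realType) n (I : seq nat) : Ogrp R n -> flag R n I :=
  \pi_(flag R n I).

Definition simplex (R : realType) n : set 'rV[R]_n :=
  [set mu | (forall i, 0 <= mu 0 i <= 1) /\ \sum_i mu 0 i = 1].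

Definition supp (R : realType) n (mu : 'rV[R]_n) : {set 'I_n} :=
  [set i | 0 < mu 0 i].

(* The type I(K): the elements k_1 < ... < k_s of K are numbered from 1. *)
Definition cell_type n (K : {set 'I_n}) : seq nat :=
  let ks := [seq (val i).+1 | i <- enum K] in
  pairmap (fun k l => (l - k)%N) 0%N ks ++
  (if (last 0 ks < n)%N then [:: (n - last 0 ks)%N] else [::]).

Definition tau (R : realType) n (mu : 'rV[R]_n) : seq nat :=
  cell_type (supp mu).

Definition wf_rel (R : realType) n : rel (set_type (@simplex R n) * Ogrp R n) :=
  fun p q => (p.1 == q.1) &&
    (pi_ (tau (val p.1)) p.2 == pi_ (tau (val p.1)) q.2).

Lemma wf_rel_equiv (R : realType) n : equiv_class_of (@wf_rel R n).
Proof.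
split.
- by move=> p; rewrite /wf_rel !eqxx.
- move=> [a U] [b V]; rewrite /wf_rel /=.
  by have [->|//] := eqVneq a b; rewrite eq_sym.
- move=> [b V] [a U] [c W]; rewrite /wf_rel /=.
  by case/andP=> /eqP-> /eqP->.
Qed.

Canonical wf_equiv (R : realType) n := EquivRelPack (@wf_rel_equiv R n).

(* The space WF(n) of weighted flags, with the quotient topology. *)
Definition wflag (R : realType) n : Type :=
  quotient_topology {eq_quot (@wf_equiv R n)}.
HB.instance Definition _ R n := Topological.on (@wflag R n).
HB.instance Definition _ R n := Quotient.on (@wflag R n).

(* The components of w = (mu, W). The second one is W when I = tau mu; this is
   used on the cell of K, with I = I(K). *)
Definition weight (R : realType) n (w : wflag R n) : 'rV[R]_n :=
  val (repr w).1.

Definition wf_flag (R : realType) n (I : seq nat) (w : wflag R n) : flag R n I :=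
  pi_ I (repr w).2.

Definition open_simplex (R : realType) n (K : {set 'I_n}) : set 'rV[R]_n :=
  [set mu | simplex mu /\
    forall j, (j \in K -> 0 < mu 0 j) /\ (j \notin K -> mu 0 j = 0)].

Definition closed_face (R : realType) n (K : {set 'I_n}) : set 'rV[R]_n :=
  [set mu | simplex mu /\ forall j, j \notin K -> mu 0 j = 0].

(* M(|K|; K) *)
Definition cell (R : realType) n (K : {set 'I_n}) : set (wflag R n) :=
  [set w | open_simplex K (weight w)].

Section SmoothStructure.
Context {R : realType} {n : nat} {I : seq nat}.

(* The differential at U of a map h defined near U on O(n), in the direction Z
   in T_U O(n), is w; it is computed from any smooth extension of h to a
   neighborhood of U in the space of matrices. *)
Definition differential_at (W : normedModType R) (h : Ogrp R n -> W)
    (U : Ogrp R n) (Z : 'M[R]_n) (w : W) : Prop :=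
  exists (A : set 'M[R]_n) (k : 'M[R]_n -> W),
    [/\ open A, A (val U), smooth A k,
        forall U' : Ogrp R n, A (val U') -> h U' = k (val U')
      & 'D_Z k (val U) = w].

(* The charts of the smooth structure of F_I for which pi_I is a smooth
   submersion: the homeomorphisms phi from an open subset V of F_I onto an open
   subset of R^d in which pi_I is smooth with surjective differential. These are
   all the charts of its maximal atlas. Recall T_U O(n) = U Skew(n). *)
Record chart (d : nat) (V : set (flag R n I)) (phi : flag R n I -> 'rV[R]_d)
    : Prop := Chart {
  chart_open : open V ;
  chart_continuous : forall W, V W -> {for W, continuous phi} ;
  chart_inj : set_inj V phi ;
  chart_open_map : forall A, open A -> A `<=` V -> open (phi @` A) ;
  chart_smooth : extends_locally (fun U : Ogrp R n => val U)
    (@smooth R 'M[R]_n 'rV[R]_d) (pi_ I @^-1` V) (phi \o pi_ I) ;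
  chart_submersion : forall U, V (pi_ I U) -> forall w,
    exists2 B, skew_mx B & differential_at (phi \o pi_ I) U (val U *m B) w }.

(* C^1 paths [u, v] -> F_I; at u and v the C^1 extension property amounts to
   one-sided continuous differentiability. *)
Definition C1_flag_path (u v : R) (c : R -> flag R n I) : Prop :=
  {within `[u, v], continuous c} /\
  forall d V (phi : flag R n I -> 'rV[R]_d), chart V phi ->
    extends_locally (@id R) (@Ck R R 'rV[R]_d 1)
      (`[u, v]%classic `&` c @^-1` V) (phi \o c).

(* A tangent vector of F_I at W, given by its coordinate vector in each chart
   around W; the values elsewhere are irrelevant. *)
Definition flag_tangent : Type :=
  forall d : nat, (flag R n I -> 'rV[R]_d) -> 'rV[R]_d.

(* X = T_U pi_I . Z *)
Definition is_push (U : Ogrp R n) (Z : 'M[R]_n) (X : flag_tangent) : Prop :=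
  forall d V (phi : flag R n I -> 'rV[R]_d), chart V phi -> V (pi_ I U) ->
    differential_at (phi \o pi_ I) U Z (X d phi).

Definition flag_velocity (c : R -> flag R n I) (t : R) : flag_tangent :=
  fun d phi => derive1 (phi \o c) t.

(* The unique B in m_I with X = T_U pi_I . UB, where W = pi_I(U) for the chosen
   representative U of W. *)
Definition m_coord (W : flag R n I) (X : flag_tangent) : 'M[R]_n :=
  get [set B | m_ I B /\ is_push (repr W) (val (repr W) *m B) X].

End SmoothStructure.

Arguments flag_tangent R n I : clear implicits.

Section Metric.
Context {R : realType} {n : nat}.
Variable f : 'rV[R]_n -> R.

(* mu_{i -> j} *)
Definition truncate (mu : 'rV[R]_n) (i j : 'I_n) : 'rV[R]_n :=
  \row_(l < n) if (i <= l < j)%N then mu 0 l else 0.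

(* g_{mu, W}((alpha, X), (beta, Y)); its value does not depend on the
   representative of W used in m_coord. *)
Definition metric (I : seq nat) (mu : 'rV[R]_n) (W : flag R n I)
    (aX bY : 'rV[R]_n * flag_tangent R n I) : R :=
  let B := m_coord W aX.2 in let C := m_coord W bY.2 in
  \sum_i aX.1 0 i * bY.1 0 i +
  \sum_(i < n) \sum_(j < n | (i < j)%N) f (truncate mu i j) ^+ 2 * B i j * C i j.

(* The norm of the velocity at time t of a path in M(|K|; K). *)
Definition speed (K : {set 'I_n}) (gam : R -> wflag R n) (t : R) : R :=
  let I := cell_type K in
  let v := (derive1 (@weight R n \o gam) t,
            flag_velocity (@wf_flag R n I \o gam) t) in
  Num.sqrt (metric (weight (gam t)) (wf_flag I (gam t)) v v).

(* The integral of the speed is unaffected by its meaningless values at the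
   finitely many break times. *)
Definition integral_speed (K : {set 'I_n}) (gam : R -> wflag R n) (u v : R)
    : \bar R :=
  (\int[lebesgue_measure]_(t in `[u, v]) (speed K gam t)%:E)%E.

End Metric.

Section Paths.
Context {R : realType} {n : nat}.

(* C^1 paths [u, v] -> Mtilde(K) *)
Definition C1_path_tilde (K : {set 'I_n}) (u v : R)
    (m : R -> 'rV[R]_n) (c : R -> flag R n (cell_type K)) : Prop :=
  [/\ forall t, t \in `[u, v] -> closed_face K (m t),
      extends_locally (@id R) (@Ck R R 'rV[R]_n 1) `[u, v]%classic m
    & C1_flag_path u v c].

Definition C1_piece (K : {set 'I_n}) (u v : R) (gam : R -> wflag R n) : Prop :=
  (forall t, t \in `]u, v[ -> cell K (gam t)) /\
  exists m c, C1_path_tilde u v m c /\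
    forall t, t \in `]u, v[ ->
      m t = weight (gam t) /\ c t = wf_flag (cell_type K) (gam t).

(* gam is a piecewise C^1 path on [a, b] with pieces in M(|K|; K), for the
   partition a < a_1 < ... < a_N = b with s = [:: a_1; ...; a_N]. *)
Definition closure_path (K : {set 'I_n}) (a b : R) (gam : R -> wflag R n)
    (s : seq R) : Prop :=
  [/\ {within `[a, b], continuous gam}, itv_partition a b s
    & forall uv, uv \in zip (a :: s) s -> C1_piece K uv.1 uv.2 gam].

Definition closure_length (f : 'rV[R]_n -> R) (K : {set 'I_n}) (a : R)
    (gam : R -> wflag R n) (s : seq R) : \bar R :=
  (\sum_(uv <- zip (a :: s) s) integral_speed f K gam uv.1 uv.2)%E.

Definition path_I (a b : R) (gam : R -> wflag R n) : Prop :=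
  a < b /\ exists s, closure_path [set: 'I_n]%SET a b gam s.

Definition length_I (f : 'rV[R]_n -> R) (a b : R) (gam : R -> wflag R n)
    : \bar R :=
  integral_speed f [set: 'I_n]%SET gam a b.

(* A decomposition of a path (II): the list of the triples (a_i, K_i, s_i),
   i = 1, ..., N, where s_i is a partition of [a_{i-1}, a_i] for which the path
   is piecewise C^1 in the closure of M(|K_i|; K_i). *)
Definition decomp : Type := seq (R * {set 'I_n} * seq R).

Definition end_times (D : decomp) : seq R := [seq d.1.1 | d <- D].

Definition path_II (a b : R) (gam : R -> wflag R n) (D : decomp) : Prop :=
  [/\ a < b, {within `[a, b], continuous gam}, itv_partition a b (end_times D)
    & forall ud, ud \in zip (a :: end_times D) D ->
        ud.2.1.2 != finset.set0 /\
        closure_path ud.2.1.2 ud.1 ud.2.1.1 gam ud.2.2].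

Definition length_II (f : 'rV[R]_n -> R) (a : R) (gam : R -> wflag R n)
    (D : decomp) : \bar R :=
  (\sum_(ud <- zip (a :: end_times D) D)
     closure_length f ud.2.1.2 ud.1 gam ud.2.2)%E.

Definition dist_I (f : 'rV[R]_n -> R) (p q : wflag R n) : \bar R :=
  ereal_inf [set L | exists a b gam,
    [/\ path_I a b gam, gam a = p, gam b = q & L = length_I f a b gam]].

Definition dist_II (f : 'rV[R]_n -> R) (p q : wflag R n) : \bar R :=
  ereal_inf [set L | exists a b gam D,
    [/\ path_II a b gam D, gam a = p, gam b = q & L = length_II f a gam D]].

End Paths.

Arguments decomp R n : clear implicits.

Definition cube (R : realType) n : set 'rV[R]_n :=
  [set mu | forall i, 0 <= mu 0 i <= 1].

(* Only the values of f on the cube [0,1]^n are used. *)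
Record admissible (R : realType) n (f : 'rV[R]_n -> R) : Prop := Admissible {
  adm_ge0 : forall mu, cube mu -> 0 <= f mu ;
  adm_lipschitz : [lipschitz f mu | mu in @cube R n] ;
  adm_C2 : extends_locally (@id 'rV[R]_n) (@Ck R 'rV[R]_n R 2)
             (@cube R n `\ 0) f ;
  adm_eq0 : forall mu, cube mu -> f mu = 0 <-> mu = 0 }.

(* Main.v *)
From HB Require Import structures.
From mathcomp Require Import all_boot all_order all_algebra generic_quotient.
From mathcomp Require Import all_classical all_reals all_analysis.
From mathcomp Require Import measurable_realfun.
From mathcomp Require Import ring lra zify.
Require Import Defs.

(** Paths in sense I are paths in sense II with the single cell M(n), and every
decomposition of such a path uses that cell only: the cells are disjoint, and
each piece of a decomposition contains a time at which the path is in M(n)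
([path_I_cells]). The speed is continuous on the open pieces, so the integrals
over the pieces add up to the integral over the whole interval, whatever the
decomposition ([length_II_of_I]). Hence d_II <= d_I.

For the other inequality it is enough to replace a path (II) by a path in M(n)
with the same endpoints whose length is larger by at most an arbitrarily small
amount. This is done locally in time ([approx_short]). Near a time t0, a path in
the closure of the cell of K has weights mu(t) and flags represented by
orthogonal matrices U(t). Push the weights towards the barycenter of the
simplex,
   nu(t) = mu(t) + eta (t - x) (y - t) (barycenter - mu(t)),
on a short interval [x, y], and keep the same U. The path (nu, pi U) lies in
M(n) on ]x, y[, has the endpoints of the given path, and its weights and factors
f(nu_(i->j)) differ from the given ones by O(eta), f being Lipschitz. There is
one more contribution to the length: the metric of M(n) charges the velocity
entries of U inside the blocks of the type of K, which the metric of the cell of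
K does not see. It can be made small, because the lift U can be chosen with
no velocity inside the blocks at t0, and the velocity is continuous; taking
[x, y] short suffices, and no lift that is horizontal along an entire piece is
required. A least upper bound argument then covers each compact piece
([approximable_piece]), and the pieces are glued.

Three ingredients make this precise.

- Explicit charts of F_I ([chartP]). In U0 L with L unit lower triangular by
  blocks, the entries of L below the blocks are coordinates of the flag. They
  are computed by a block LU factorization, and the inverse map
  L |-> U0 orthonormalize(L) is given by the Gram-Schmidt process. It is a smooth
  local section of pi_I whose velocity at U0 has no component inside the blocks
  ([sect_horizontal]).

- A formula for the speed in terms of any lift to O(n) ([speedE]). A tangent
  vector is determined by its chart coordinates ([push_inj]), and the metric is
  invariant under the choice of the representative of the flag, because
  f(mu_(i->j)) depends only on the blocks of i and j ([flag_metric_invariant]).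

- Endpoints of paths in WF(n) are limits of the inner points, so it matters that
  limits in WF(n) are unique ([wflag_endpoints]): the continuous functions mu and
  U diag(lambda) U^T separate the points, where lambda lists the partial sums of
  mu, which are constant exactly on the blocks. *)

Set Implicit Arguments.
Unset Strict Implicit.
Unset Printing Implicit Defensive.

Import Order.TTheory GRing.Theory Num.Theory.
Import numFieldNormedType.Exports.

Local Open Scope classical_set_scope.
Local Open Scope ring_scope.
Local Open Scope quotient_scope.

(** * Maps of class C^k *)
Section CkTheory.
Context {R : realType} {V : normedModType R}.

Lemma near_eq_differentiable (W : normedModType R) (f g : V -> W) x :
  {near x, f =1 g} -> differentiable f x -> differentiable g x.
Proof.
move=> fg df; apply/diff_locallyP.
have fgx : f x = g x by exact: nbhs_singleton fg.
have d1 := diff_locally df.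
have E : g \o shift x = cst (g x) + 'd f x +o_ 0 id.
  apply/eqaddoP => e e0.
  move/eqaddoP : d1 => /(_ e e0).
  have fg0 : \forall y \near 0, f (y + x) = g (y + x).
    by move: fg; rewrite (near_shift 0) subr0.
  apply: filterS2 fg0 => y /= E1.
  by rewrite !fctE /= E1 fgx.
have dc := diff_continuous df.
have [_ ->] := conj E (diff_unique dc E).
by split.
Qed.

(** A derivative on an open set depends only on the values there; every closure
    property below reduces to this and to the rule for the first derivative. *)
Lemma Ck_eq (W : normedModType R) k (A : set V) (f g : V -> W) : open A ->
  (forall x, A x -> f x = g x) -> Ck k A f -> Ck k A g.
Proof.
move=> oA; elim: k f g => [|k IH] f g fg /=.
  move=> cf x Ax.
  have nfg : {near x, f =1 g}.
    by near=> y; apply: fg; near: y; exact: open_nbhs_nbhs.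
  rewrite /prop_for /continuous_at -(fg x Ax).
  by apply: cvg_trans (cf x Ax); exact: near_eq_cvg.
move=> [df Df]; split.
  move=> x Ax; apply: near_eq_differentiable (df x Ax).
  near=> y; apply: fg; near: y; exact: open_nbhs_nbhs.
move=> v; apply: IH (Df v) => x Ax; apply: near_eq_derive.
near=> y; apply: fg; near: y; exact: open_nbhs_nbhs.
Unshelve. all: by end_near. Qed.

Lemma Ck_sub (W : normedModType R) k (A B : set V) (f : V -> W) : B `<=` A ->
  Ck k A f -> Ck k B f.
Proof.
move=> BA; elim: k f => [|k IH] f /=; first by move=> + x /BA; exact.
move=> [df Df]; split; first by move=> x /BA; exact: df.
by move=> v; apply: IH.
Qed.

Lemma Ck_pred (W : normedModType R) k (A : set V) (f : V -> W) :
  Ck k.+1 A f -> Ck k A f.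
Proof.
elim: k f => [|k IH] f /=.
  by move=> [df _] x Ax; apply: differentiable_continuous; exact: df.
by move=> [df Df]; split => // v; apply: IH; exact: Df.
Qed.

Lemma Ck_cst (W : normedModType R) k (A : set V) (w : W) : Ck k A (cst w).
Proof.
elim: k w => [|k IH] w /=; first by move=> x _; exact: cvg_cst.
split=> [x _|v]; first exact: differentiable_cst.
rewrite (_ : 'D_v _ = cst 0); first exact: IH.
by apply/funext => x; rewrite derive_cst.
Qed.

Lemma CkD (W : normedModType R) k (A : set V) (f g : V -> W) : open A ->
  Ck k A f -> Ck k A g -> Ck k A (fun x => f x + g x).
Proof.
move=> oA; elim: k f g => [|k IH] f g /=.
  by move=> cf cg x Ax; apply: cvgD; [exact: cf|exact: cg].
move=> [df Df] [dg Dg]; split=> [x Ax|v].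
  by apply: differentiableD; [exact: df|exact: dg].
apply: Ck_eq (IH _ _ (Df v) (Dg v)) => // x Ax; apply/esym.
by apply: deriveD; apply: diff_derivable; [exact: df|exact: dg].
Qed.

Lemma Ck_scalel (W : normedModType R) k (A : set V) (h : V -> R) (w : W) :
  open A -> Ck k A h -> Ck k A (fun x => h x *: w).
Proof.
move=> oA; elim: k h => [|k IH] h /=.
  by move=> ch x Ax; apply: cvgZr_tmp; exact: ch.
move=> [dh Dh]; split=> [x Ax|v].
  by apply: differentiableZl; exact: dh.
apply: Ck_eq (IH _ (Dh v)) => // x Ax; apply/esym.
rewrite deriveE; last by apply: differentiableZl; exact: dh.
by rewrite diffZl ?deriveE//; exact: dh.
Qed.

Lemma CkM k (A : set V) (f g : V -> R) : open A ->
  Ck k A f -> Ck k A g -> Ck k A (fun x => f x * g x).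
Proof.
move=> oA; elim: k f g => [|k IH] f g.
  by move=> cf cg x Ax; apply: cvgM; [exact: cf|exact: cg].
move=> Cf Cg; have [df Df] := Cf; have [dg Dg] := Cg; split=> [x Ax|v].
  by apply: differentiableM; [exact: df|exact: dg].
have C := CkD oA (IH _ _ (Ck_pred Cf) (Dg v)) (IH _ _ (Ck_pred Cg) (Df v)).
apply: Ck_eq C => // x Ax; apply/esym.
by apply: deriveM; apply: diff_derivable; [exact: df|exact: dg].
Qed.

Lemma CkN k (A : set V) (f : V -> R) : open A ->
  Ck k A f -> Ck k A (fun x => - f x).
Proof.
move=> oA Cf.
have := CkM oA (Ck_cst k A (-1 : R)) Cf.
by apply: Ck_eq => // x _; rewrite mulN1r.
Qed.

Lemma CkB k (A : set V) (f g : V -> R) : open A ->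
  Ck k A f -> Ck k A g -> Ck k A (fun x => f x - g x).
Proof. by move=> oA Cf /(CkN oA); exact: CkD. Qed.

Lemma CkV k (A : set V) (f : V -> R) : open A -> (forall x, A x -> f x != 0) ->
  Ck k A f -> Ck k A (fun x => (f x)^-1).
Proof.
move=> oA f0; elim: k => [|k IH].
  by move=> cf x Ax; apply: cvgV; [exact: f0|exact: cf].
move=> Cf; have [df Df] := Cf; split=> [x Ax|v].
  by apply: differentiableV; [exact: df|exact: f0].
have C := IH (Ck_pred Cf).
have C2 := CkN oA (CkM oA (CkM oA C C) (Df v)).
apply: Ck_eq C2 => // x Ax; apply/esym.
rewrite deriveV; [|exact: f0|by apply: diff_derivable; exact: df].
by rewrite /GRing.scale /= -exprVn expr2 mulNr.
Qed.

Lemma Ck_sqrt k (A : set V) (f : V -> R) : open A -> (forall x, A x -> 0 < f x) ->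
  Ck k A f -> Ck k A (fun x => Num.sqrt (f x)).
Proof.
move=> oA f0; elim: k => [|k IH].
  move=> cf x Ax; apply: (continuous_comp (cf x Ax)); exact: sqrt_continuous.
move=> Cf; have [df Df] := Cf.
have ds x : A x -> is_diff x (fun x => Num.sqrt (f x))
    (fun v => (2 * Num.sqrt (f x))^-1 * 'd f x v).
  move=> Ax; have ddf := differentiableP (df x Ax).
  have is1 := is_derive1_sqrt (f0 _ Ax).
  have dsq : differentiable (@Num.sqrt R) (f x).
    by apply/derivable1_diffP; exact: ex_derive.
  apply: DiffDef.
    by apply: (differentiable_comp (df x Ax)).
  have -> : (fun x => Num.sqrt (f x)) = Num.sqrt \o f by [].
  rewrite [LHS](diff_comp (df x Ax) dsq); apply/funext => v /=.
  rewrite diff1E//= derive1E (@derive_val _ _ _ _ _ _ _ is1) /=.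
  by rewrite /GRing.scale /= mulrC.
split=> [x Ax|v].
  by have [] := ds x Ax.
have C := IH (Ck_pred Cf).
have C2 := CkM oA (CkV oA _ (CkM oA (Ck_cst k A (2 : R)) C)) (Df v).
apply: Ck_eq (C2 _) => // x Ax.
  have d := ds x Ax.
  rewrite [RHS]deriveE; last by have [] := d.
  have [_ ->] := d; congr (_ * _); rewrite deriveE//; exact: df.
by rewrite /= mulf_neq0 ?pnatr_eq0// gt_eqF// sqrtr_gt0 f0.
Qed.

Lemma Ck_sum (W : normedModType R) k (A : set V) (I : Type) (r : seq I)
    (P : pred I) (F : I -> V -> W) : open A ->
  (forall i, P i -> Ck k A (F i)) -> Ck k A (fun x => \sum_(i <- r | P i) F i x).
Proof.
move=> oA CF; elim: r => [|i r IH].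
  by apply: Ck_eq (Ck_cst k A (0 : W)) => // x _; rewrite big_nil.
have [Pi|nPi] := boolP (P i).
  by apply: Ck_eq (CkD oA (CF i Pi) IH) => // x _; rewrite big_cons Pi.
by apply: Ck_eq IH => // x _; rewrite big_cons (negbTE nPi).
Qed.

Lemma Ck_prod k (A : set V) (I : Type) (r : seq I)
    (P : pred I) (F : I -> V -> R) : open A ->
  (forall i, P i -> Ck k A (F i)) -> Ck k A (fun x => \prod_(i <- r | P i) F i x).
Proof.
move=> oA CF; elim: r => [|i r IH].
  by apply: Ck_eq (Ck_cst k A (1 : R)) => // x _; rewrite big_nil.
have [Pi|nPi] := boolP (P i).
  by apply: Ck_eq (CkM oA (CF i Pi) IH) => // x _; rewrite big_cons Pi.
by apply: Ck_eq IH => // x _; rewrite big_cons (negbTE nPi).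
Qed.

Lemma derive_coord m n (M : V -> 'M[R]_(m, n)) x v i j :
  differentiable M x -> 'D_v (fun y => M y i j) x = ('D_v M x) i j.
Proof.
by move=> dM; rewrite derive_mx ?mxE//; exact: diff_derivable.
Qed.

Lemma Ck_coord m n k (A : set V) (M : V -> 'M[R]_(m, n)) i j : open A ->
  Ck k A M -> Ck k A (fun x => M x i j).
Proof.
move=> oA; elim: k M => [|k IH] M /=.
  move=> cM x Ax; apply: (@continuous_comp _ _ _ M (fun N => N i j)).
    exact: cM.
  exact: coord_continuous.
move=> [dM DM]; split=> [x Ax|v].
  apply: (@differentiable_comp _ _ _ _ M (fun N => N i j)); first exact: dM.
  exact: differentiable_coord.
by apply: Ck_eq (IH _ (DM v)) => // x Ax; rewrite derive_coord//; exact: dM.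
Qed.

Lemma Ck_mx m n k (A : set V) (M : V -> 'M[R]_(m, n)) : open A ->
  (forall i j, Ck k A (fun x => M x i j)) -> Ck k A M.
Proof.
move=> oA CM.
have : Ck k A (fun x => \sum_i \sum_j M x i j *: delta_mx i j : 'M[R]_(m, n)).
  apply: Ck_sum => // i _; apply: Ck_sum => // j _.
  exact: (Ck_scalel _ oA (CM i j)).
by apply: Ck_eq => // x _; rewrite -matrix_sum_delta.
Qed.

End CkTheory.

Lemma derive_line (R : realType) (W : normedModType R) (x w : W) (t : R) :
  'D_1 (fun s : R => x + s *: w) t = w.
Proof.
have dw : differentiable (fun s : R => s *: w) t by exact: differentiableZl.
have -> : (fun s : R => x + s *: w) = cst x + (fun s => s *: w) by [].
rewrite deriveD; [|exact: derivable_cst|exact: diff_derivable].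
by rewrite derive_cst add0r deriveE// diffZl// diff_val scale1r.
Qed.

Section CkMatrix.
Context {R : realType} {V : normedModType R} (k : nat) (A : set V) (oA : open A).

Lemma Ck_mulmx m n p (M : V -> 'M[R]_(m, n)) (N : V -> 'M[R]_(n, p)) :
  Ck k A M -> Ck k A N -> Ck k A (fun x => M x *m N x).
Proof.
move=> CM CN; apply: Ck_mx => // i j.
have : Ck k A (fun x => \sum_l M x i l * N x l j).
  by apply: Ck_sum => // l _; apply: CkM => //; exact: Ck_coord.
by apply: Ck_eq => // x _; rewrite mxE.
Qed.

Lemma Ck_trmx m n (M : V -> 'M[R]_(m, n)) :
  Ck k A M -> Ck k A (fun x => (M x)^T).
Proof.
move=> CM; apply: Ck_mx => // i j.
by apply: Ck_eq (Ck_coord j i oA CM) => // x _; rewrite mxE.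
Qed.

Lemma Ck_det n (M : V -> 'M[R]_n) : Ck k A M -> Ck k A (fun x => \det (M x)).
Proof.
move=> CM; apply: Ck_sum => // s _; apply: CkM => //; first exact: Ck_cst.
by apply: Ck_prod => // i _; exact: Ck_coord.
Qed.

Lemma Ck_invmx n (M : V -> 'M[R]_n) : (forall x, A x -> M x \in unitmx) ->
  Ck k A M -> Ck k A (fun x => invmx (M x)).
Proof.
move=> uM CM; apply: Ck_mx => // i j.
have : Ck k A (fun x => (\det (M x))^-1 * cofactor (M x) j i).
  apply: CkM => //; first apply: CkV => //.
  - by move=> x Ax; rewrite -unitfE -unitmxE; exact: uM.
  - exact: Ck_det.
  apply: CkM => //; first exact: Ck_cst.
  apply: Ck_det; apply: Ck_mx => // i' j'.
  by apply: Ck_eq (Ck_coord (lift j i') (lift i j') oA CM) => // x _; rewrite !mxE.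
by apply: Ck_eq => // x Ax; rewrite /invmx uM// !mxE.
Qed.

Lemma CkMmxl n m p (C : 'M[R]_(m, n)) (M : V -> 'M[R]_(n, p)) :
  Ck k A M -> Ck k A (fun x => C *m M x).
Proof. by apply: Ck_mulmx; exact: Ck_cst. Qed.

Lemma CkMmxr n m p (C : 'M[R]_(n, p)) (M : V -> 'M[R]_(m, n)) :
  Ck k A M -> Ck k A (fun x => M x *m C).
Proof. by move=> CM; apply: Ck_mulmx => //; exact: Ck_cst. Qed.

End CkMatrix.

(** * Composition with a C^1 map *)
Section Ck1Comp.
Context {R : realType} {V W : normedModType R} {m n : nat}.
Implicit Types (U : V -> 'M[R]_(m, n)) (k : 'M[R]_(m, n) -> W).

Lemma derive_comp_mx U k x v : differentiable U x -> differentiable k (U x) ->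
  'D_v (k \o U) x = 'D_('D_v U x) k (U x).
Proof.
move=> dU dk; rewrite deriveE; last exact: differentiable_comp.
by rewrite diff_comp//= (deriveE ('D_v U x) dk) deriveE.
Qed.

(** Finite dimension of the source reduces all directional derivatives to those
    along the basis, which are continuous functions of the point alone. *)
Lemma derive_mx_sum k M Z : differentiable k M ->
  'D_Z k M = \sum_i \sum_j Z i j *: 'D_(delta_mx i j) k M.
Proof.
move=> dk; rewrite deriveE// {1}(matrix_sum_delta Z) linear_sum.
apply: eq_bigr => i _; rewrite linear_sum; apply: eq_bigr => j _.
by rewrite linearZ /= deriveE.
Qed.

Lemma Ck1_comp (A : set V) (B : set 'M[R]_(m, n)) U k : open A ->
  Ck 1 A U -> Ck 1 B k -> (forall x, A x -> B (U x)) -> Ck 1 A (k \o U).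
Proof.
move=> oA [dU DU] [dk Dk] AB; split=> [x Ax|v].
  by apply: differentiable_comp; [exact: dU|exact/dk/AB].
have : Ck 0 A (fun x => \sum_i \sum_j
    ('D_v U x) i j *: 'D_(delta_mx i j) k (U x)).
  apply: Ck_sum => // i _; apply: Ck_sum => // j _ x Ax.
  apply: cvgZ.
    apply: (@continuous_comp _ _ _ ('D_v U) (fun N => N i j)); first exact: DU.
    exact: coord_continuous.
  apply: (@continuous_comp _ _ _ U ('D_(delta_mx i j) k)).
    by apply: differentiable_continuous; exact: dU.
  by apply: Dk; exact: AB.
apply: Ck_eq => // x Ax; rewrite derive_comp_mx; [|exact: dU|exact/dk/AB].
by rewrite derive_mx_sum//; exact/dk/AB.
Qed.

End Ck1Comp.

(** * Cholesky factorization *)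
Section Cholesky.
Context {R : realType}.

Definition posdef n (M : 'M[R]_n) : Prop :=
  M^T = M /\ forall x : 'rV_n, x != 0 -> 0 < (x *m M *m x^T) 0 0.

Definition schur_complement n (M : 'M[R]_(1 + n)) : 'M[R]_n :=
  drsubmx M - (M 0 0)^-1 *: ((ursubmx M)^T *m ursubmx M).

(** The recursion on the Schur complement, rather than Gram-Schmidt on vectors,
    makes smoothness an induction on the size: only the square roots of the
    positive pivots are not rational. *)
Fixpoint cholesky n : 'M[R]_n -> 'M[R]_n :=
  if n is n'.+1 then fun M : 'M[R]_(1 + n') =>
    block_mx (Num.sqrt (M 0 0))%:M ((Num.sqrt (M 0 0))^-1 *: ursubmx M)
             0 (cholesky (schur_complement M))
  else id.

Lemma posdef_entry00 n (M : 'M[R]_(1 + n)) : posdef M -> 0 < M 0 0.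
Proof.
move=> [_ /(_ (delta_mx 0 0))]; rewrite -rowE trmx_delta -colE !mxE; apply.
by apply/eqP => /matrixP/(_ 0 0)/eqP; rewrite !mxE !eqxx oner_eq0.
Qed.

Lemma posdef_submxE n (M : 'M[R]_(1 + n)) : posdef M ->
  M = block_mx (M 0 0)%:M (ursubmx M) (ursubmx M)^T (drsubmx M).
Proof.
move=> [sM _]; rewrite -[LHS]submxK; congr (block_mx _ _ _ _).
  by apply/matrixP => i j; rewrite !ord1 !mxE eqxx; congr (M _ _); exact/val_inj.
by rewrite -[in LHS]sM trmx_ursub.
Qed.

(** For x in R^n the form of the Schur complement at x is that of M at the
    vector extending x that minimizes it. *)
Lemma posdef_schur n (M : 'M[R]_(1 + n)) :
  posdef M -> posdef (schur_complement M).
Proof.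
move=> pM; have a0 := posdef_entry00 pM; have ME := posdef_submxE pM.
have [sM xM] := pM.
move: ME; rewrite /schur_complement; set a := M 0 0; set b := ursubmx M.
set C := drsubmx M => ME.
split.
  rewrite raddfB /= linearZ /= trmx_mul trmxK; congr (_ - _).
  by rewrite /C trmx_drsub sM.
move=> x x0.
pose s := (x *m b^T) 0 0.
pose y : 'rV_(1 + n) := row_mx (- s / a)%:M x.
have y0 : y != 0.
  apply: contra x0 => /eqP/(congr1 rsubmx); rewrite /y row_mxKr => ->.
  by apply/eqP/matrixP => i j; rewrite !mxE.
have := xM _ y0.
have bx : b *m (x^T : 'M[R]_(n, 1)) = s%:M.
  by rewrite [LHS]mx11_scalar -[b *m x^T]trmxK trmx_mul trmxK mxE.
have xb : x *m b^T = s%:M by rewrite [LHS]mx11_scalar.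
rewrite /y ME mul_row_block tr_row_mx mul_row_col.
rewrite mulmxDl mulmxDl -!mulmxA tr_scalar_mx.
rewrite bx !mulmxA xb -!scalar_mxM.
rewrite mulmxBr mulmxBl -scalemxAr -scalemxAl !mulmxA xb -[s%:M *m b *m _]mulmxA bx -scalar_mxM.
rewrite !mxE !eqxx !mulr1n.
congr (_ < _).
by field; rewrite gt_eqF.
Qed.

Lemma cholesky_trig n (M : 'M[R]_n) (i j : 'I_n) :
  (j < i)%N -> cholesky M i j = 0.
Proof.
elim: n M i j => [|n IH] M i j; first by case: i.
rewrite /= => ji; rewrite !mxE.
case: splitP => [i0|i'] ii; first by move: ji; rewrite ii !ord1.
rewrite !mxE; case: splitP => [j0|j'] jj; first by rewrite mxE.
by apply: IH; move: ji; rewrite ii jj !add1n ltnS.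
Qed.

Lemma choleskyP n (M : 'M[R]_n) : posdef M -> (cholesky M)^T *m cholesky M = M.
Proof.
elim: n M => [|n IH] M pM; first by apply/matrixP => -[].
have a0 := posdef_entry00 pM.
pose T : 'M[R]_(1 + n) := block_mx (Num.sqrt (M 0 0))%:M
  ((Num.sqrt (M 0 0))^-1 *: ursubmx (M : 'M[R]_(1 + n))) 0
  (cholesky (schur_complement M)).
suff : T^T *m T = M :> 'M[R]_(1 + n) by [].
rewrite [RHS](posdef_submxE pM) tr_block_mx mulmx_block.
rewrite !tr_scalar_mx !trmx0 !mulmx0 !mul0mx !addr0.
have r0 : Num.sqrt (M 0 0) != 0 by rewrite gt_eqF// sqrtr_gt0.
have rr : Num.sqrt (M 0 0) * Num.sqrt (M 0 0) = M 0 0.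
  by rewrite -expr2 sqr_sqrtr// ltW.
congr (block_mx _ _ _ _).
- by rewrite -scalar_mxM rr.
- by rewrite mul_scalar_mx scalerA mulfV// scale1r.
- by rewrite linearZ /= mul_mx_scalar scalerA mulfV// scale1r.
- rewrite IH; last exact: posdef_schur.
  have -> : ((Num.sqrt (M 0 0))^-1 *: ursubmx (M : 'M[R]_(1 + n)))^T =
      (Num.sqrt (M 0 0))^-1 *: (ursubmx (M : 'M[R]_(1 + n)))^T.
    by apply/matrixP => i j; rewrite !mxE.
  rewrite -scalemxAl -scalemxAr scalerA -invfM rr.
  by rewrite /schur_complement addrC subrK.
Qed.

Lemma posdef_gram n (L : 'M[R]_n) : L \in unitmx -> posdef (L^T *m L).
Proof.
move=> uL; split=> [|x x0]; first by rewrite trmx_mul trmxK.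
have y0 : x *m L^T != 0.
  apply: contra x0 => /eqP /(congr1 (mulmx^~ (invmx L^T))).
  by rewrite mulmxK ?unitmx_tr// mul0mx => ->.
rewrite mulmxA -mulmxA -[L *m x^T]trmxK trmx_mul trmxK.
move: (x *m L^T) y0 => y y0.
rewrite mxE.
have y2 i : 0 <= y 0 i * y^T i 0 by rewrite mxE -expr2 sqr_ge0.
rewrite lt_def sumr_ge0// andbT; apply: contra y0 => /eqP s0.
apply/eqP/matrixP => i j; rewrite ord1 [RHS]mxE.
have /eqP := s0; rewrite psumr_eq0// => /allP/(_ j).
rewrite mem_index_enum => /(_ isT); rewrite mxE -expr2 sqrf_eq0 => /eqP.
exact.
Qed.

Lemma cholesky_unit n (M : 'M[R]_n) : M \in unitmx -> posdef M ->
  cholesky M \in unitmx.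
Proof.
by move=> uM /choleskyP; move: uM => /[swap] {1}<-; rewrite unitmx_mul => /andP[].
Qed.

Lemma cholesky1 n : cholesky (1%:M : 'M[R]_n) = 1%:M.
Proof.
elim: n => [|n IH]; first by apply/matrixP => -[].
rewrite /= mxE /= sqrtr1.
have E : (1%:M : 'M[R]_(1 + n)) = block_mx 1%:M 0 0 1%:M.
  by rewrite -scalar_mx_block.
rewrite /schur_complement [X in ursubmx X]E [X in drsubmx X]E block_mxKur block_mxKdr.
by rewrite mulmx0 !scaler0 subr0 IH -scalar_mx_block.
Qed.

Context {V : normedModType R}.

Lemma Ck_cholesky k (A : set V) n (M : V -> 'M[R]_n) : open A ->
  (forall x, A x -> posdef (M x)) -> Ck k A M ->
  Ck k A (fun x => cholesky (M x)).
Proof.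
move=> oA; elim: n M => [|n IH] M pM CM; first exact: CM.
have Cr : Ck k A (fun x => Num.sqrt (M x 0 0)).
  apply: Ck_sqrt => //; first by move=> x Ax; exact: posdef_entry00 (pM x Ax).
  exact: Ck_coord.
have r0 x : A x -> Num.sqrt (M x 0 0) != 0.
  by move=> Ax; rewrite gt_eqF// sqrtr_gt0; exact: posdef_entry00 (pM x Ax).
have Cb : Ck k A (fun x => ursubmx (M x : 'M[R]_(1 + n))).
  apply: Ck_mx => // i j.
  apply: Ck_eq (Ck_coord (lshift n i) (rshift 1 j) oA CM) => // x _.
  by rewrite !mxE.
have Cs : Ck k A (fun x => cholesky (schur_complement (M x))).
  apply: IH; first by move=> x Ax; exact/posdef_schur/pM.
  apply: Ck_mx => // i j.
  have : Ck k A (fun x => M x (rshift 1 i) (rshift 1 j) -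
     (M x 0 0)^-1 * ((ursubmx (M x : 'M[R]_(1 + n)))^T *m
                        ursubmx (M x : 'M[R]_(1 + n))) i j).
    apply: CkB => //; first exact: Ck_coord.
    apply: CkM => //; first apply: CkV => //.
    - by move=> x Ax; rewrite gt_eqF//; exact: posdef_entry00 (pM x Ax).
    - exact: Ck_coord.
    apply: Ck_coord => //; apply: Ck_mulmx => //; exact: Ck_trmx.
  apply: Ck_eq => // x _; rewrite /schur_complement.
  by move: (_ *m _) => N; rewrite !mxE.
apply: Ck_mx => // i j.
rewrite /=.
have [i0 ii|i' ii] := splitP (i : 'I_(1 + n)); have [j0 jj|j' jj] := splitP (j : 'I_(1 + n)).
- have -> : i = lshift n i0 by exact/val_inj.
  have -> : j = lshift n j0 by exact/val_inj.
  apply: Ck_eq Cr => // x _.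
  by apply/esym; apply: (etrans (@block_mxEul R 1 n 1 n _ _ _ _ i0 j0)); rewrite !ord1 mxE eqxx mulr1n.
- have -> : i = lshift n i0 by exact/val_inj.
  have -> : j = rshift 1 j' by exact/val_inj.
  apply: Ck_eq (CkM oA (CkV oA r0 Cr) (Ck_coord i0 j' oA Cb)) => // x _.
  by apply/esym; apply: (etrans (@block_mxEur R 1 n 1 n _ _ _ _ i0 j')); rewrite mxE.
- have -> : i = rshift 1 i' by exact/val_inj.
  have -> : j = lshift n j0 by exact/val_inj.
  apply: Ck_eq (Ck_cst k A 0) => // x _; apply/esym.
  by apply: (etrans (@block_mxEdl R 1 n 1 n _ _ _ _ i' j0)); rewrite mxE.
- have -> : i = rshift 1 i' by exact/val_inj.
  have -> : j = rshift 1 j' by exact/val_inj.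
  apply: Ck_eq (Ck_coord i' j' oA Cs) => // x _.
  by apply/esym; apply: (etrans (@block_mxEdr R 1 n 1 n _ _ _ _ i' j')).
Qed.

End Cholesky.

(** * The blocks of the type of a cell *)
Section CellType.

(** In the loop invariant, p is the last breakpoint that has been passed. *)
Lemma reshape_index_pairmap n p (ks : seq nat) i :
  path ltn p ks -> (p <= i < n)%N ->
  reshape_index (pairmap (fun k l => (l - k)%N) p ks ++
    (if (last p ks < n)%N then [:: (n - last p ks)%N] else [::])) (i - p) =
  count (leq^~ i) ks.
Proof.
elim: ks p => [|k ks IH] p /=.
  move=> _ /andP[pi i_n]; rewrite (leq_ltn_trans pi i_n).
  by rewrite /reshape_index /=; case: ifP => // /eqP; lia.
move=> /andP[pk pks] /andP[pi i_n].
rewrite /reshape_index /=; case: ifPn => [|h].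
  rewrite /= subn_eq0 => h.
  have ik : (i < k)%N by lia.
  rewrite leqNgt ik /= add0n; apply/esym/eqP; rewrite eqn0Ngt -has_count.
  apply/hasPn => l lks; rewrite -ltnNge.
  have /allP/(_ l lks) := order_path_min ltn_trans pks.
  exact: ltn_trans.
have ki : (k <= i)%N by move: h; rewrite /= subn_eq0; lia.
rewrite ki /= add1n; congr _.+1.
rewrite -(IH k)//; last by rewrite ki.
rewrite /reshape_index; congr (find _ (scanl _ _ _)); lia.
Qed.

(** Indices start at 0 and the elements of K are numbered from 1, so that each
    k in K closes a block: the indices after k lie in later blocks. *)
Lemma reshape_index_cell_type n (K : {set 'I_n}) (i : 'I_n) :
  reshape_index (cell_type K) i = #|[set k in K | (k < i)%N]%SET|.
Proof.
rewrite /cell_type; set ks := [seq _ | _ <- _].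
have pks : path ltn 0%N ks.
  have -> : ks = map S [seq val k | k <- enum K] by rewrite -map_comp.
  have : sorted ltn [seq val k | k <- enum K].
    rewrite /enum_mem -enumT -[X in sorted _ X]map_id.
    apply: (@subseq_sorted _ ltn ltn_trans _ (map val (enum 'I_n))).
      by rewrite map_id; apply: map_subseq; rewrite enumT; exact: filter_subseq.
    by rewrite val_enum_ord iota_ltn_sorted.
  by case: [seq val k | k <- enum K] => //= a s; rewrite path_map.
have := @reshape_index_pairmap n 0 ks i pks; rewrite subn0 => ->; last by rewrite leq0n ltn_ord.
rewrite count_map cardE -(size_map val) -[LHS]size_filter.
rewrite -[LHS](size_map val); congr size; congr map.
rewrite /enum_mem -filter_predI; apply: eq_filter => k /=.
by rewrite !inE /= andbC.
Qed.

Lemma reshape_index_homo n (K : {set 'I_n}) (i j : 'I_n) : (i <= j)%N ->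
  (reshape_index (cell_type K) i <= reshape_index (cell_type K) j)%N.
Proof.
move=> ij; rewrite !reshape_index_cell_type subset_leq_card//.
by apply/fintype.subsetP => k; rewrite !inE => /andP[-> /leq_trans]; apply.
Qed.

Lemma same_blockP n (K : {set 'I_n}) (i j : 'I_n) :
  reflect (forall k, k \in K -> (k < i)%N = (k < j)%N)
          (same_block (cell_type K) i j).
Proof.
rewrite /same_block !reshape_index_cell_type.
apply: (iffP eqP) => [|H]; last first.
  by congr #|pred_of_set _|; apply/finset.setP => k; rewrite !inE; case: (boolP (k \in K)) => // /H.
wlog ij : i j / (i <= j)%N => [W|] e.
  have [/W|/ltnW/W W2] := leqP i j; first exact.
  by move=> k kK; apply/esym; exact: W2.
have S : [set k in K | (k < i)%N]%SET \subset [set k in K | (k < j)%N]%SET.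
  by apply/fintype.subsetP => k; rewrite !inE => /andP[-> /leq_trans]; apply.
move=> k kK; have : [set k in K | (k < i)%N]%SET == [set k in K | (k < j)%N]%SET.
  by rewrite eqEcard S e leqnn.
by move=> /eqP/finset.setP/(_ k); rewrite !inE kK.
Qed.

Lemma same_block_setT n (i j : 'I_n) :
  same_block (cell_type [set: 'I_n]%SET) i j = (i == j).
Proof.
apply/same_blockP/eqP => [H|->//].
apply/val_inj; have := H j (finset.in_setT _); have := H i (finset.in_setT _).
by rewrite !ltnn; case: ltngtP.
Qed.

End CellType.

(** * Block LU factorization *)
Section BlockLU.
Context {R : realType} {n : nat} (b : 'I_n -> nat).
Hypothesis b_homo : forall i j : 'I_n, (i <= j)%N -> (b i <= b j)%N.
Implicit Types (V S L : 'M[R]_n) (q : nat).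

Definition E_ q : 'M[R]_n := diag_mx (\row_i (b i <= q)%N%:R).
(** The leading corner of V up to block q, completed by an identity so that it
    keeps size n and that the determinant is that of the corner. *)
Definition corner_mx q V : 'M[R]_n := E_ q *m V *m E_ q + (1%:M - E_ q).

Definition block_upper S := forall i j, (b j < b i)%N -> S i j = 0.
Definition block_unilower L := forall i j, (b i <= b j)%N -> L i j = (i == j)%:R.

Definition lu_domain V := forall j, corner_mx (b j) V \in unitmx.
(** Column j of S is solved from the leading corner of V up to its block:
    V S has to agree with the identity in the rows of that corner. *)
Definition lu_upper V : 'M[R]_n :=
  \matrix_(i, j) ((b i <= b j)%N%:R * invmx (corner_mx (b j) V) i j).
Definition lu_lower V := V *m lu_upper V.

Lemma mulE_l q V i j : (E_ q *m V) i j = (b i <= q)%N%:R * V i j.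
Proof. by rewrite mul_diag_mx !mxE. Qed.

Lemma mulE_r q V i j : (V *m E_ q) i j = V i j * (b j <= q)%N%:R.
Proof. by rewrite mul_mx_diag !mxE. Qed.

Lemma E_idem q : E_ q *m E_ q = E_ q.
Proof.
apply/matrixP => i j; rewrite mulE_l !mxE; case: leqP => _; rewrite ?mul1r ?mul0r//.
by rewrite mul0rn.
Qed.

Lemma block_upperE q S : block_upper S -> S *m E_ q = E_ q *m S *m E_ q.
Proof.
move=> uS; apply/matrixP => i j; rewrite !mulE_r mulE_l.
case: (leqP (b j) q) => jq; last by rewrite !mulr0.
case: (leqP (b i) q) => iq; first by rewrite mul1r.
by rewrite uS ?mul0r// (leq_ltn_trans jq).
Qed.

(** A block upper triangular S maps the first blocks to themselves, so leading
    corners multiply. *)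
Lemma corner_mxM q V S : block_upper S ->
  corner_mx q (V *m S) = corner_mx q V *m corner_mx q S.
Proof.
move=> uS; rewrite /corner_mx.
have z : E_ q *m (1%:M - E_ q) = 0 by rewrite mulmxBr mulmx1 E_idem subrr.
have z' : (1%:M - E_ q) *m E_ q = 0 by rewrite mulmxBl mul1mx E_idem subrr.
have ii : (1%:M - E_ q) *m (1%:M - E_ q) = 1%:M - E_ q.
  by rewrite mulmxBl mul1mx z subr0.
move: (1%:M - E_ q) z z' ii => F z z' ii.
rewrite mulmxDl !mulmxDr ii.
rewrite -[E_ q *m V *m E_ q *m F]mulmxA z mulmx0 addr0.
rewrite [F *m _]mulmxA [F *m _]mulmxA z' !mul0mx add0r.
congr (_ + _).
have -> : E_ q *m (V *m S) *m E_ q = E_ q *m V *m (S *m E_ q) by rewrite !mulmxA.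
rewrite (block_upperE q uS) -[RHS]mulmxA; congr (_ *m _).
by rewrite !mulmxA E_idem.
Qed.

Lemma corner_mx1 q : corner_mx q 1%:M = 1%:M.
Proof. by rewrite /corner_mx mulmx1 E_idem addrC subrK. Qed.

Lemma trig1_unit L : (forall i j : 'I_n, (i <= j)%N -> L i j = (i == j)%:R) ->
  L \in unitmx.
Proof.
move=> L1; rewrite unitmxE det_trig; last first.
  by apply/is_trig_mxP => i j ij; rewrite L1 ?(ltnW ij)// -val_eqE ltn_eqF.
by rewrite big1 ?unitr1// => i _; rewrite L1// eqxx.
Qed.

Lemma unilower_unit L : block_unilower L -> L \in unitmx.
Proof. by move=> lL; apply: trig1_unit => i j ij; apply: lL; exact: b_homo. Qed.

Lemma unilower_corner_unit q L : block_unilower L -> corner_mx q L \in unitmx.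
Proof.
move=> lL; apply: trig1_unit => i j ij; rewrite /corner_mx mxE mulE_r mulE_l.
rewrite lL; last exact: b_homo.
rewrite [in X in _ + X]mxE [in X in _ + X]mxE [X in _ + (_ + X)]mxE.
rewrite !mxE; case: (eqVneq i j) => [->|ij'].
  by case: leqP => _; rewrite ?mulr1n ?mul1r ?subrr ?mul0r ?subr0 ?addr0 ?add0r.
by rewrite !mulr0n mulr0 mul0r subrr addr0.
Qed.

Lemma unilower_domain V S : block_upper S -> block_unilower (V *m S) ->
  lu_domain V.
Proof.
move=> uS lL j; have := unilower_corner_unit (b j) lL.
by rewrite corner_mxM// unitmx_mul => /andP[].
Qed.

Lemma lu_upper_upper V : block_upper (lu_upper V).
Proof. by move=> i j ji; rewrite mxE leqNgt ji mul0r. Qed.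

Lemma lu_lower_unilower V : lu_domain V -> block_unilower (lu_lower V).
Proof.
move=> DV i j ij.
have := mulmxV (DV j) => /matrixP/(_ i j).
rewrite {1}/corner_mx mulmxDl mxE -!mulmxA mulE_l ij mul1r.
rewrite mulmxBl mul1mx [X in _ + X]mxE [X in _ + (_ + X)]mxE mulE_l ij mul1r subrr addr0.
rewrite [in RHS]mxE => <-; rewrite !mxE; apply: eq_bigr => k _.
by rewrite mulE_l mxE.
Qed.

(** Column j of S is supported on the leading corner of its block, where the
    equation V S = L says that it is column j of the inverse of that corner. *)
Lemma lu_uniq V S : block_upper S -> block_unilower (V *m S) ->
  lu_upper V = S.
Proof.
move=> uS lL; have DV := unilower_domain uS lL.
apply/matrixP => i j; rewrite mxE.
case: (leqP (b i) (b j)) => ij; last by rewrite mul0r uS.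
rewrite mul1r.
have ES l : (b l <= b j)%N%:R * S l j = S l j.
  by case: leqP => lj; rewrite ?mul1r// mul0r uS.
have CS k : (corner_mx (b j) V *m S) k j = (k == j)%:R.
  rewrite /corner_mx mulmxDl mxE -!mulmxA mulE_l mulmxBl mul1mx.
  rewrite [X in _ + X]mxE [X in _ + (_ + X)]mxE mulE_l ES subrr addr0.
  have -> : (V *m (E_ (b j) *m S)) k j = (V *m S) k j.
    by rewrite !mxE; apply: eq_bigr => l _; rewrite mulE_l ES.
  case: leqP => kj; first by rewrite mul1r lL.
  rewrite mul0r; case: eqVneq => // kj'; by rewrite kj' ltnn in kj.
rewrite -[in RHS](mulKmx (DV j) S) [RHS]mxE (bigD1 j)//= CS eqxx mulr1.
by rewrite big1 ?addr0// => k /negbTE kj; rewrite CS kj mulr0.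
Qed.

Lemma block_upper1 : block_upper 1%:M.
Proof. by move=> i j ji; rewrite mxE; case: eqVneq ji => // ->; rewrite ltnn. Qed.

Lemma block_upperM S S' : block_upper S -> block_upper S' -> block_upper (S *m S').
Proof.
move=> uS uS' i j ji; rewrite mxE big1// => k _.
have [ki|ik] := ltnP (b k) (b i); first by rewrite uS ?mul0r.
by rewrite uS' ?mulr0// (leq_trans ji).
Qed.

Definition block_diagonal (Q : 'M[R]_n) := forall i j, b i != b j -> Q i j = 0.

Lemma block_diagonal_upper Q : block_diagonal Q -> block_upper Q.
Proof. by move=> dQ i j ji; rewrite dQ// gtn_eqF. Qed.

(** Multiplying V by an element of O(I) on the right changes only the upper
    factor: the lower factor is a function on the flag manifold. *)
Lemma lu_domain_mulr V Q : lu_domain V -> block_diagonal Q -> Q^T *m Q = 1%:M ->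
  lu_domain (V *m Q) /\ lu_lower (V *m Q) = lu_lower V.
Proof.
move=> DV dQ QQ.
have dQT : block_diagonal Q^T by move=> i j ij; rewrite mxE dQ// eq_sym.
have E : V *m Q *m (Q^T *m lu_upper V) = lu_lower V.
  by rewrite mulmxA -(mulmxA V) (mulmx1C QQ) mulmx1.
have uQS : block_upper (Q^T *m lu_upper V).
  by apply: block_upperM; [exact: block_diagonal_upper|exact: lu_upper_upper].
have lE : block_unilower (V *m Q *m (Q^T *m lu_upper V)).
  by rewrite E; exact: lu_lower_unilower.
split; first exact: unilower_domain uQS lE.
by rewrite /lu_lower (lu_uniq uQS lE) E.
Qed.

(** V^T V' maps the upper factor of V' to that of V, and the upper factor of V'
    is invertible on each leading corner. *)
Lemma lu_ratio_upper V V' : V^T *m V = 1%:M -> lu_domain V' ->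
  lu_lower V = lu_lower V' -> block_upper (V^T *m V').
Proof.
move=> VV DV' LE; set Q := V^T *m V'.
have QS : Q *m lu_upper V' = lu_upper V.
  by rewrite -mulmxA -[_ *m lu_upper V']/(lu_lower V') -LE /lu_lower mulmxA VV mul1mx.
have uS' := @lu_upper_upper V'.
move=> i j ji.
have uC : corner_mx (b j) (lu_upper V') \in unitmx.
  have := unilower_corner_unit (b j) (lu_lower_unilower DV').
  by rewrite corner_mxM// unitmx_mul => /andP[].
have E0 : (1%:M - E_ (b j)) *m Q *m E_ (b j) *m corner_mx (b j) (lu_upper V') = 0.
  have EC : E_ (b j) *m corner_mx (b j) (lu_upper V') = lu_upper V' *m E_ (b j).
    rewrite /corner_mx mulmxDr mulmxBr mulmx1 E_idem subrr addr0 !mulmxA E_idem.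
    exact/esym/block_upperE.
  rewrite -mulmxA EC mulmxA -(mulmxA _ Q) QS -mulmxA.
  rewrite (block_upperE _ (@lu_upper_upper V)) !mulmxA.
  by rewrite mulmxBl mul1mx E_idem subrr !mul0mx.
have := congr1 (mulmx^~ (invmx (corner_mx (b j) (lu_upper V')))) E0.
rewrite mulmxK// mul0mx => /matrixP/(_ i j).
rewrite mulE_r leqnn mulr1 mulmxBl mul1mx [RHS]mxE => <-.
by rewrite [RHS]mxE [X in _ = _ + X]mxE mulE_l leqNgt ji mul0r subr0.
Qed.

(** By symmetry V^T V' and its transpose are both block upper triangular. *)
Lemma lu_lower_inj V V' : V^T *m V = 1%:M -> V'^T *m V' = 1%:M ->
  lu_domain V -> lu_domain V' -> lu_lower V = lu_lower V' ->
  block_diagonal (V^T *m V').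
Proof.
move=> VV VV' DV DV' LE i j; rewrite neq_ltn => /orP[ij|ji]; last first.
  exact: lu_ratio_upper.
have := lu_ratio_upper VV' DV (esym LE) ij.
by rewrite -[V'^T *m V]trmxK trmx_mul trmxK mxE.
Qed.

(** The Gram-Schmidt orthonormalization of the columns of L. *)
Definition orthonormalize L := L *m invmx (cholesky (L^T *m L)).

Lemma cholesky_gram_unit L : L \in unitmx -> cholesky (L^T *m L) \in unitmx.
Proof.
move=> uL; apply: cholesky_unit; last exact: posdef_gram.
by rewrite unitmx_mul unitmx_tr uL.
Qed.

Lemma orthonormalizeK L : L \in unitmx ->
  orthonormalize L *m cholesky (L^T *m L) = L.
Proof. by move=> uL; rewrite /orthonormalize mulmxKV// cholesky_gram_unit. Qed.

Lemma orthonormalize_orthogonal L : L \in unitmx ->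
  (orthonormalize L)^T *m orthonormalize L = 1%:M.
Proof.
move=> uL; rewrite /orthonormalize trmx_mul mulmxA -(mulmxA _ L^T).
have uT := cholesky_gram_unit uL.
rewrite -[X in _ *m X *m _](choleskyP (posdef_gram uL)) mulmxA.
by rewrite trmx_inv mulVmx ?unitmx_tr// mul1mx mulmxV.
Qed.

Lemma cholesky_upper M : block_upper (cholesky M).
Proof.
move=> i j ji; apply: cholesky_trig; rewrite ltnNge; apply/negP => /b_homo.
by rewrite leqNgt ji.
Qed.

(** Orthonormalization only changes the upper factor, so it is a section of the
    map from flags to lower factors. *)
Lemma orthonormalize_lu L : block_unilower L ->
  lu_domain (orthonormalize L) /\ lu_lower (orthonormalize L) = L.
Proof.
move=> lL; have uL := unilower_unit lL.
have uT := @cholesky_upper (L^T *m L).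
have E := orthonormalizeK uL.
have lE : block_unilower (orthonormalize L *m cholesky (L^T *m L)) by rewrite E.
split; first exact: unilower_domain uT lE.
by rewrite /lu_lower (lu_uniq uT lE).
Qed.

Lemma lu_domain1 : lu_domain 1%:M.
Proof. by move=> j; rewrite corner_mx1 unitmx1. Qed.

Lemma lu_upper1 : lu_upper 1%:M = 1%:M.
Proof.
apply: lu_uniq; first exact: block_upper1.
by move=> i j _; rewrite mulmx1 mxE.
Qed.

Lemma lu_lower1 : lu_lower 1%:M = 1%:M.
Proof. by rewrite /lu_lower lu_upper1 mulmx1. Qed.

Section CkLU.
Context {V0 : normedModType R} (k : nat) (A : set V0).
Hypothesis oA : open A.

Lemma Ck_corner_mx q (M : V0 -> 'M[R]_n) :
  Ck k A M -> Ck k A (fun x => corner_mx q (M x)).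
Proof.
move=> CM; apply: CkD => //; last exact: Ck_cst.
by apply: CkMmxr => //; exact: CkMmxl.
Qed.

Lemma Ck_lu_upper (M : V0 -> 'M[R]_n) : (forall x, A x -> lu_domain (M x)) ->
  Ck k A M -> Ck k A (fun x => lu_upper (M x)).
Proof.
move=> DM CM; apply: Ck_mx => // i j.
have : Ck k A (fun x => (b i <= b j)%N%:R * invmx (corner_mx (b j) (M x)) i j).
  apply: CkM => //; first exact: Ck_cst.
  apply: Ck_coord => //; apply: Ck_invmx => //; last exact: Ck_corner_mx.
  by move=> x Ax; exact: DM.
by apply: Ck_eq => // x _; rewrite [RHS]mxE.
Qed.

Lemma Ck_lu_lower (M : V0 -> 'M[R]_n) : (forall x, A x -> lu_domain (M x)) ->
  Ck k A M -> Ck k A (fun x => lu_lower (M x)).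
Proof. by move=> DM CM; apply: Ck_mulmx => //; exact: Ck_lu_upper. Qed.

Lemma Ck_orthonormalize (M : V0 -> 'M[R]_n) : (forall x, A x -> M x \in unitmx) ->
  Ck k A M -> Ck k A (fun x => orthonormalize (M x)).
Proof.
move=> uM CM; apply: Ck_mulmx => //; apply: Ck_invmx => //.
  by move=> x Ax; apply: cholesky_gram_unit; exact: uM.
apply: Ck_cholesky => //; first by move=> x Ax; exact/posdef_gram/uM.
by apply: Ck_mulmx => //; exact: Ck_trmx.
Qed.

End CkLU.

End BlockLU.

(** * Derivatives of matrix-valued maps *)
Section MatrixCalculus.
Context {R : realType} {V : normedModType R}.

Lemma differentiable_mxcoord m n (M : V -> 'M[R]_(m, n)) x i j :
  differentiable M x -> differentiable (fun y => M y i j) x.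
Proof.
move=> dM; apply: (@differentiable_comp _ _ _ _ M (fun N => N i j)) => //.
exact: differentiable_coord.
Qed.

Lemma differentiable_mx m n (M : V -> 'M[R]_(m, n)) x :
  (forall i j, differentiable (fun y => M y i j) x) -> differentiable M x.
Proof.
move=> dM; rewrite (_ : M = \sum_(i < m) \sum_(j < n)
    (fun y => M y i j *: delta_mx i j)).
  apply: differentiable_sum => i; apply: differentiable_sum => j.
  exact: differentiableZl.
apply/funext => y; rewrite [LHS]matrix_sum_delta fct_sumE.
by apply: eq_bigr => i _; rewrite fct_sumE.
Qed.

Lemma differentiable_mulmx m n p (M : V -> 'M[R]_(m, n)) (N : V -> 'M[R]_(n, p)) x :
  differentiable M x -> differentiable N x ->
  differentiable (fun y => M y *m N y) x.
Proof.
move=> dM dN; apply: differentiable_mx => i j.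
rewrite (_ : (fun _ => _) = \sum_(l < n) (fun y => M y i l * N y l j)).
  apply: differentiable_sum => l.
  by apply: differentiableM; exact: differentiable_mxcoord.
by apply/funext => y; rewrite mxE fct_sumE.
Qed.

Lemma derive_mulmx m n p (M : V -> 'M[R]_(m, n)) (N : V -> 'M[R]_(n, p)) x v :
  differentiable M x -> differentiable N x ->
  'D_v (fun y => M y *m N y) x = 'D_v M x *m N x + M x *m 'D_v N x.
Proof.
move=> dM dN; apply/matrixP => i j.
rewrite -derive_coord; last exact: differentiable_mulmx.
rewrite (_ : (fun _ => _) = \sum_(l < n) (fun y => M y i l * N y l j)); last first.
  by apply/funext => y; rewrite mxE fct_sumE.
have dMi l : differentiable (fun y => M y i l) x by exact: differentiable_mxcoord.
have dNj l : differentiable (fun y => N y l j) x by exact: differentiable_mxcoord.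
rewrite derive_sum; last first.
  by move=> l; apply: diff_derivable; exact: differentiableM.
rewrite !mxE -big_split /=; apply: eq_bigr => l _.
rewrite (deriveM (diff_derivable (dMi l)) (diff_derivable (dNj l))).
by rewrite !derive_coord// /GRing.scale /=; ring.
Qed.

Lemma differentiable_trmx m n (M : V -> 'M[R]_(m, n)) x :
  differentiable M x -> differentiable (fun y => (M y)^T) x.
Proof.
move=> dM; apply: differentiable_mx => i j.
rewrite (_ : (fun _ => _) = fun y => M y j i); first exact: differentiable_mxcoord.
by apply/funext => y; rewrite mxE.
Qed.

Lemma derive_trmx m n (M : V -> 'M[R]_(m, n)) x v : differentiable M x ->
  'D_v (fun y => (M y)^T) x = ('D_v M x)^T.
Proof.
move=> dM; apply/matrixP => i j; rewrite [RHS]mxE -[RHS]derive_coord//.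
rewrite -[LHS]derive_coord; last exact: differentiable_trmx.
have -> : (fun y => (M y)^T i j) = (fun y => M y j i).
  by apply/funext => y; rewrite mxE.
by [].
Qed.

Lemma derive_mulmxl m n p (C : 'M[R]_(m, n)) (N : V -> 'M[R]_(n, p)) x v :
  differentiable N x -> 'D_v (fun y => C *m N y) x = C *m 'D_v N x.
Proof.
move=> dN; rewrite (derive_mulmx v (differentiable_cst C x) dN).
by rewrite derive_cst mul0mx add0r.
Qed.

Lemma derive_mulmxr m n p (C : 'M[R]_(n, p)) (N : V -> 'M[R]_(m, n)) x v :
  differentiable N x -> 'D_v (fun y => N y *m C) x = 'D_v N x *m C.
Proof.
move=> dN; rewrite (derive_mulmx v dN (differentiable_cst C x)).
by rewrite derive_cst mulmx0 addr0.
Qed.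

End MatrixCalculus.

Section SetType.
Context {T : topologicalType}.

Lemma set_type_continuous {X : topologicalType} (A : set X)
    (f : T -> set_type A) (x : T) :
  {for x, continuous (fun y => val (f y) : X)} -> {for x, continuous f}.
Proof.
move=> fl B [C [[D oD <-] Dl CB]].
have FD : nbhs (val (f x) : X) D by exact: open_nbhs_nbhs.
apply: (@filterS _ _ (nbhs_filter x) (fun y => D (val (f y)))) (fl D FD).
by move=> y Dy; exact: CB.
Qed.

Lemma val_continuous {X : topologicalType} (A : set X)
    (f : T -> set_type A) (x : T) :
  {for x, continuous f} -> {for x, continuous (fun y => val (f y) : X)}.
Proof.
by move=> fl; exact: (cvg_comp _ _ fl (@initial_continuous _ _ (@set_val X A) (f x))).
Qed.

End SetType.

Lemma near_eq_D1 (R : realType) (W : normedModType R) (f g : R -> W) (t : R) :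
  {near t, f =1 g} -> 'D_1 f t = 'D_1 g t.
Proof. exact: near_eq_derive. Qed.

(** * Derivative of the orthonormalization *)
Section Orthonormalize.
Context {R : realType} {n : nat}.
Implicit Types (A : set R) (t : R).

(** Write O for the orthonormalization and L = O T with T upper triangular, so
    that O = T = 1 at t. Differentiating O^T O = 1 shows that O' is skew, and
    L' = O' + T' with T' upper triangular. *)
Lemma derive_orthonormalize (L : R -> 'M[R]_n) A t : open A -> A t ->
  Ck 1 A L -> (forall s, A s -> L s \in unitmx) -> L t = 1%:M ->
  let D := 'D_1 (fun s => orthonormalize (L s)) t in
  skew_mx D /\ forall i j : 'I_n, (j < i)%N -> D i j = 'D_1 L t i j.
Proof.
move=> oA At CL uL L1.
have dT : differentiable (fun s => cholesky ((L s)^T *m L s)) t.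
  have pL x : A x -> posdef ((L x)^T *m L x) by move=> Ax; exact/posdef_gram/uL.
  exact: (Ck_cholesky oA pL (Ck_mulmx oA (Ck_trmx oA CL) CL)).1.
have dO : differentiable (fun s => orthonormalize (L s)) t.
  exact: (Ck_orthonormalize oA uL CL).1.
set O := fun s => orthonormalize (L s) in dO *; set T := fun s => cholesky _ in dT.
have T1 : T t = 1%:M by rewrite /T L1 trmx1 mulmx1 cholesky1.
have O1 : O t = 1%:M.
  by rewrite /O /orthonormalize L1 trmx1 mulmx1 cholesky1 invmx1 mulmx1.
move=> D; split.
  have E : {near t, (fun s => (O s)^T *m O s) =1 cst 1%:M}.
    have : nbhs t A by exact: open_nbhs_nbhs.
    by apply: filterS => s As; rewrite /O orthonormalize_orthogonal//; exact: uL.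
  have := near_eq_D1 E; rewrite derive_cst derive_mulmx//; last first.
    exact: differentiable_trmx.
  rewrite derive_trmx// O1 trmx1 mul1mx mulmx1 -/D => /eqP.
  by rewrite addr_eq0 => /eqP.
move=> i j ji.
have E : {near t, L =1 fun s => O s *m T s}.
  have : nbhs t A by exact: open_nbhs_nbhs.
  by apply: filterS => s As; rewrite /O /T orthonormalizeK//; exact: uL.
rewrite (near_eq_D1 E) derive_mulmx// O1 T1 mulmx1 mul1mx -/D mxE.
rewrite -[X in _ + X]derive_coord//.
rewrite (_ : (fun y => _) = cst 0) ?derive_cst ?addr0//.
by apply/funext => s; rewrite /T cholesky_trig.
Qed.

End Orthonormalize.

(** * Charts of the flag manifolds *)
Section FlagCharts.
Context {R : realType} {n : nat} (K : {set 'I_n}).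
Let I := cell_type K.
Let b (i : 'I_n) : nat := reshape_index I i.
Let b_homo (i j : 'I_n) : (i <= j)%N -> (b i <= b j)%N.
Proof. exact: reshape_index_homo. Qed.
Implicit Types (U : Ogrp R n) (W : flag R n I).

Lemma ogrpP U : (val U)^T *m val U = 1%:M.
Proof. by have := set_mem (valP U). Qed.

Lemma ogrpP' U : val U *m (val U)^T = 1%:M.
Proof. exact/mulmx1C/ogrpP. Qed.

Definition ogrp (M : 'M[R]_n) (h : M^T *m M = 1%:M) : Ogrp R n :=
  exist _ M (mem_set (h : orthogonal_mx M)).

Lemma pi_eqP U U' : pi_ I U = pi_ I U' <->
  exists2 Q, block_orthogonal I Q & val U' = val U *m Q.
Proof.
split=> [/eqmodP/asboolP//|H].
by apply/eqmodP/asboolP.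
Qed.

Lemma pi_continuous_flag : continuous (@pi_ R n I).
Proof. exact: pi_continuous. Qed.

Lemma repr_piE U : exists2 Q, block_orthogonal I Q & val (repr (pi_ I U)) = val U *m Q.
Proof. by apply/pi_eqP; rewrite /pi_ reprK. Qed.

Definition below_block := {p : 'I_n * 'I_n | (b p.2 < b p.1)%N}.
Definition flag_dim := #|{: below_block}|.

Definition unilower_of (x : 'rV[R]_flag_dim) : 'M[R]_n :=
  \matrix_(i, j) if insub (i, j) is Some p then x 0 (enum_rank (p : below_block))
                 else (i == j)%:R.

(** The entries of L below its diagonal blocks, the only free ones of a block
    unit lower triangular matrix. *)
Definition lower_coords (L : 'M[R]_n) : 'rV[R]_flag_dim :=
  \row_k L (val (enum_val k)).1 (val (enum_val k)).2.

Lemma unilower_ofP x : block_unilower b (unilower_of x).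
Proof. by move=> i j ij; rewrite mxE insubF//= ltnNge ij. Qed.

Lemma unilower_ofK x : lower_coords (unilower_of x) = x.
Proof.
apply/rowP => k; rewrite !mxE -surjective_pairing valK; congr (x 0 _).
by rewrite enum_valK.
Qed.

Lemma lower_coordsK L : block_unilower b L -> unilower_of (lower_coords L) = L.
Proof.
move=> lL; apply/matrixP => i j; rewrite mxE; case: insubP => [p _ pE|].
  by rewrite mxE enum_rankK pE.
by rewrite /= -leqNgt => /lL.
Qed.

Lemma Ck_unilower_of (V0 : normedModType R) k (A : set V0) (x : V0 -> 'rV_flag_dim) :
  open A -> Ck k A x -> Ck k A (fun y => unilower_of (x y)).
Proof.
move=> oA Cx; apply: Ck_mx => // i j.
have E y : unilower_of (x y) i j = if insub (i, j) is Some p then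
    x y 0 (enum_rank (p : below_block)) else (i == j)%:R by rewrite mxE.
apply: (@Ck_eq _ _ _ k A (fun y => if insub (i, j) is Some p then
    x y 0 (enum_rank (p : below_block)) else (i == j)%:R)) => //.
case: insub => [p|]; last exact: Ck_cst.
exact: Ck_coord.
Qed.

Lemma Ck_lower_coords (V0 : normedModType R) k (A : set V0) (L : V0 -> 'M[R]_n) :
  open A -> Ck k A L -> Ck k A (fun y => lower_coords (L y)).
Proof.
move=> oA CL; apply: Ck_mx => // i j.
apply: Ck_eq (Ck_coord _ _ oA CL) => // y _.
by rewrite mxE.
Qed.

Section Centered.
Variable U0 : Ogrp R n.

Definition chart_dom : set (flag R n I) :=
  [set W | lu_domain b ((val U0)^T *m val (repr W))].

Definition chart_map W : 'rV[R]_flag_dim :=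
  lower_coords (lu_lower b ((val U0)^T *m val (repr W))).

Lemma sect_orthogonal x :
  (val U0 *m orthonormalize (unilower_of x))^T *m
  (val U0 *m orthonormalize (unilower_of x)) = 1%:M.
Proof.
rewrite trmx_mul mulmxA -(mulmxA _ (val U0)^T) ogrpP mulmx1.
apply: orthonormalize_orthogonal; exact: (unilower_unit b_homo (@unilower_ofP x)).
Qed.

(** The local section of pi_I over the chart centered at U0. *)
Definition sect x : Ogrp R n := ogrp (sect_orthogonal x).

Lemma chart_pi U : lu_domain b ((val U0)^T *m val U) ->
  chart_dom (pi_ I U) /\
  chart_map (pi_ I U) = lower_coords (lu_lower b ((val U0)^T *m val U)).
Proof.
move=> DU; rewrite /chart_dom /chart_map /=.
have [Q [oQ bQ] ->] := repr_piE U; rewrite mulmxA.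
by have [? ->] := lu_domain_mulr b_homo DU bQ oQ.
Qed.

Lemma chart_dom_pi U : chart_dom (pi_ I U) <-> lu_domain b ((val U0)^T *m val U).
Proof.
split=> [|/chart_pi[]//]; rewrite /chart_dom /=.
have [Q [oQ bQ] ->] := repr_piE U; rewrite mulmxA => D.
have dQT : block_diagonal b Q^T.
  by move=> i j ij; rewrite mxE bQ// /same_block eq_sym.
have QQ : Q^T^T *m Q^T = 1%:M by rewrite trmxK; exact/mulmx1C.
have [] := lu_domain_mulr b_homo D dQT QQ.
by rewrite -mulmxA (mulmx1C oQ) mulmx1.
Qed.

Lemma sect_mulE x : (val U0)^T *m val (sect x) = orthonormalize (unilower_of x).
Proof. by rewrite /= mulmxA ogrpP mul1mx. Qed.

Lemma chart_sect x : chart_dom (pi_ I (sect x)) /\ chart_map (pi_ I (sect x)) = x.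
Proof.
have [D E] := orthonormalize_lu b_homo (@unilower_ofP x).
rewrite -sect_mulE in D E.
by have [? ->] := chart_pi D; split => //; rewrite E unilower_ofK.
Qed.

(** Equal lower factors give orthogonal matrices that differ by a block diagonal
    orthogonal factor, that is, the same flag. *)
Lemma chart_map_inj : set_inj chart_dom chart_map.
Proof.
move=> W W' /set_mem DW /set_mem DW' E.
rewrite -[W]reprK -[W']reprK; apply/pi_eqP.
have {}E : lu_lower b ((val U0)^T *m val (repr W)) =
    lu_lower b ((val U0)^T *m val (repr W')).
  rewrite -(lower_coordsK (lu_lower_unilower DW)).
  by rewrite -(lower_coordsK (lu_lower_unilower DW')); congr unilower_of.
have o U : ((val U0)^T *m val U)^T *m ((val U0)^T *m val U) = 1%:M.
  by rewrite trmx_mul trmxK mulmxA -(mulmxA _ (val U0)) ogrpP' mulmx1 ogrpP.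
have := lu_lower_inj b_homo (o _) (o _) DW DW' E.
rewrite trmx_mul trmxK mulmxA -(mulmxA _ (val U0)) ogrpP' mulmx1 => dQ.
exists ((val (repr W))^T *m val (repr W')); last first.
  by rewrite mulmxA ogrpP' mul1mx.
split; last by move=> i j ij; exact: dQ.
by rewrite /orthogonal_mx /= trmx_mul trmxK mulmxA -(mulmxA _ (val (repr W))) ogrpP' mulmx1 ogrpP.
Qed.

Lemma sect_chart W : chart_dom W -> pi_ I (sect (chart_map W)) = W.
Proof.
move=> DW; have [D E] := chart_sect (chart_map W).
by apply: chart_map_inj => //; exact: mem_set.
Qed.

Lemma Ck_sect (V0 : normedModType R) k (A : set V0) (x : V0 -> 'rV_flag_dim) :
  open A -> Ck k A x -> Ck k A (fun y => val (sect (x y)) : 'M[R]_n).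
Proof.
move=> oA Cx.
apply: CkMmxl => //; apply: Ck_orthonormalize => //; last exact: Ck_unilower_of.
by move=> y _; exact: (unilower_unit b_homo (@unilower_ofP (x y))).
Qed.

Lemma sect_continuous : continuous sect.
Proof.
move=> x; apply: set_type_continuous.
have Cid : Ck 0 setT (id : 'rV[R]_flag_dim -> _) by move=> y _; exact: cvg_id.
have C := Ck_sect openT Cid. exact: (C x Logic.I).
Qed.

(** The domain of the chart read on all matrices, where the formula for the
    chart extends smoothly. *)
Definition mx_dom : set 'M[R]_n := [set M | lu_domain b ((val U0)^T *m M)].

Lemma Ck_id (V0 : normedModType R) k (A : set V0) : Ck k A (id : V0 -> V0).
Proof.
case: k => [|k]; first by move=> x _; exact: cvg_id.
split=> [x _|v]; first exact: ex_diff.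
rewrite (_ : 'D_v _ = cst v); first exact: Ck_cst.
by apply/funext => x; rewrite derive_id.
Qed.

Lemma open_mx_dom : open mx_dom.
Proof.
rewrite openE => M DM.
apply: (@filter_forall _ _ _ (nbhs M) (nbhs_filter M)) => j.
have Cd : Ck 0 setT (fun M : 'M[R]_n => \det (corner_mx b (b j) ((val U0)^T *m M))).
  have C1 := CkMmxl openT (val U0)^T (Ck_id 0 [set: 'M[R]_n]).
  exact: (Ck_det openT (Ck_corner_mx b openT (b j) C1)).
have M0 : \det (corner_mx b (b j) ((val U0)^T *m M)) != 0.
  by rewrite -unitfE -unitmxE; exact: DM.
have : \forall x \near M, \det (corner_mx b (b j) ((val U0)^T *m x)) != 0.
  refine (Cd M Logic.I [set x | x != 0] (open_nbhs_nbhs (conj (@open_neq R 0) M0))).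
by apply: (@filterS _ _ (nbhs_filter M)) => x; rewrite unitmxE unitfE.
Qed.

Lemma open_chart_dom : open chart_dom.
Proof.
rewrite /open /= /quotient_open.
exists mx_dom; first exact: open_mx_dom.
apply/seteqP; split => U.
  by move=> DU; apply/chart_dom_pi.
by move=> /chart_dom_pi.
Qed.

Lemma Ck_chart_ext k : Ck k mx_dom
  (fun M => lower_coords (lu_lower b ((val U0)^T *m M))).
Proof.
have oD := open_mx_dom.
apply: Ck_lower_coords => //; apply: Ck_lu_lower => //.
by apply: CkMmxl => //; exact: Ck_id.
Qed.

Lemma chart_ext U : mx_dom (val U) -> (chart_map \o pi_ I) U =
  lower_coords (lu_lower b ((val U0)^T *m val U)).
Proof. by move=> DU; have [_ /= ->] := chart_pi DU. Qed.

Lemma chart_continuous W : chart_dom W -> {for W, continuous chart_map}.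
Proof.
move=> DW B; rewrite nbhs_simpl /= nbhsE => -[C [oC CW] CB].
rewrite nbhsE.
exists (chart_dom `&` chart_map @^-1` C); last by move=> W' [_ /CB].
split=> //; rewrite /open /= /quotient_open.
exists (mx_dom `&` (fun M => lower_coords (lu_lower b ((val U0)^T *m M))) @^-1` C).
  rewrite openE => M [DM CM]; apply: (@filterI _ _ (nbhs_filter M)).
    by apply: open_nbhs_nbhs; split => //; exact: open_mx_dom.
  have oCM := open_nbhs_nbhs (conj oC CM).
  exact: (@Ck_chart_ext 0 M DM _ oCM).
apply/seteqP; split => U /=.
  by move=> [DU CU]; have [? ->] := chart_pi DU.
by move=> [/chart_dom_pi DU]; have [_ ->] := chart_pi DU.
Qed.

(** Differentiate U^T U = 1. *)
Lemma skew_velocity (c : R -> Ogrp R n) t :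
  differentiable (fun s => val (c s) : 'M[R]_n) t ->
  skew_mx ((val (c t))^T *m 'D_1 (fun s => val (c s) : 'M[R]_n) t).
Proof.
move=> dc; rewrite /skew_mx /= trmx_mul trmxK.
have E : (fun s => (val (c s))^T *m val (c s)) = cst 1%:M.
  by apply/funext => s; exact: ogrpP.
have /eqP := @derive_mulmx R R _ _ _ _ _ t 1 (differentiable_trmx dc) dc.
rewrite E derive_cst derive_trmx// eq_sym addr_eq0 => /eqP ->.
by rewrite ?opprK.
Qed.

(** Continuity of the section makes the chart open; composing the section with a
    straight line in the coordinates, and correcting it by an element of O(I) to
    start at U, gives surjectivity of the differential at U. *)
Lemma chartP : chart chart_dom chart_map.
Proof.
split.
- exact: open_chart_dom.
- exact: chart_continuous.
- exact: chart_map_inj.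
- move=> A oA AD.
  rewrite (_ : _ @` _ = (pi_ I \o sect) @^-1` A).
    have /continuousP : continuous (pi_ I \o sect).
      move=> x; apply: continuous_comp; first exact: sect_continuous.
      exact: pi_continuous_flag.
    exact.
  apply/seteqP; split => x /=.
    by move=> [W AW <-]; rewrite sect_chart//; exact: AD.
  move=> Ax; exists (pi_ I (sect x)) => //; exact: (chart_sect x).2.
- move=> U /chart_dom_pi DU; exists mx_dom; eexists; split.
  + exact: open_mx_dom.
  + exact: DU.
  + exact: Ck_chart_ext.
  + by move=> U' _; exact: chart_ext.
- move=> U DU w.
  have DU0 : mx_dom (val U) := (chart_dom_pi U).1 DU.
  pose x := chart_map (pi_ I U).
  have [Q [oQ bQ] UE] : exists2 Q, block_orthogonal I Q & val U = val (sect x) *m Q.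
    by apply/pi_eqP; rewrite sect_chart.
  pose c s : Ogrp R n := sect (x + s *: w).
  have Cc : Ck 1 setT (fun s => val (c s) : 'M[R]_n).
    apply: Ck_sect; first exact: openT.
    apply: CkD; [exact: openT|exact: Ck_cst|].
    apply: (@Ck_scalel _ _ _ _ _ id); [exact: openT|exact: Ck_id].
  have dc : differentiable (fun s => val (c s) : 'M[R]_n) 0 by exact: Cc.1.
  have c0 : val (c 0) = val (sect x) by rewrite /c scale0r addr0.
  pose Z := 'D_1 (fun s => val (c s) : 'M[R]_n) 0.
  exists (Q^T *m ((val (c 0))^T *m Z) *m Q).
    have sk : ((val (c 0))^T *m Z)^T = - ((val (c 0))^T *m Z) := skew_velocity dc.
    rewrite /skew_mx /= [LHS]trmx_mul [in LHS]trmx_mul trmxK sk.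
    by rewrite mulNmx mulmxN !mulmxA.
  exists mx_dom; eexists; split.
  + exact: open_mx_dom.
  + exact: DU0.
  + exact: Ck_chart_ext.
  + exact: chart_ext.
  pose k (M : 'M[R]_n) := lower_coords (lu_lower b ((val U0)^T *m M)).
  rewrite -/k.
  have -> : val U *m (Q^T *m ((val (c 0))^T *m Z) *m Q) = Z *m Q.
    rewrite UE c0 !mulmxA -(mulmxA _ Q) (mulmx1C oQ) mulmx1.
    by rewrite ogrpP' mul1mx.
  have dcQ : differentiable (fun s => val (c s) *m Q) 0.
    by apply: differentiable_mulmx => //; exact: differentiable_cst.
  have <- : 'D_1 (fun s => val (c s) *m Q) 0 = Z *m Q by rewrite derive_mulmxr.
  have UE0 : val U = val (c 0) *m Q by rewrite c0.
  have DU' : mx_dom (val (c 0) *m Q) by rewrite -UE0.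
  have dk : differentiable k (val (c 0) *m Q) by exact: (@Ck_chart_ext 1).1.
  rewrite UE0 -(@derive_comp_mx R R _ _ _ _ _ _ 1 dcQ dk).
  have -> : k \o (fun s => val (c s) *m Q) = fun s => x + s *: w.
    apply/funext => s /=; rewrite /k.
    have [D E] := chart_sect (x + s *: w).
    have dQ : block_diagonal b Q by move=> i j; exact: bQ.
    have [_ E2] := lu_domain_mulr b_homo ((chart_dom_pi _).1 D) dQ oQ.
    by rewrite mulmxA E2 -[RHS]E; have [_ ->] := chart_pi ((chart_dom_pi _).1 D).
  exact: derive_line.
Qed.

End Centered.
End FlagCharts.

Lemma open_setI_preimage (R : realType) (V W : normedModType R) (A : set V)
    (B : set W) (h : V -> W) : open A -> open B -> Ck 0 A h ->
  open (A `&` h @^-1` B).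
Proof.
move=> oA oB Ch; rewrite openE => x [Ax Bx]; apply: (@filterI _ _ (nbhs_filter x)).
  exact: open_nbhs_nbhs.
exact: (Ch x Ax _ (open_nbhs_nbhs (conj oB Bx))).
Qed.

(** * Curves in the orthogonal group *)
Section Curves.
Context {R : realType} {n : nat}.
Implicit Types (c : R -> Ogrp R n) (t : R) (A : set R).

Lemma derive_along_curve (W : normedModType R) (h : Ogrp R n -> W)
    (A : set 'M[R]_n) (k : 'M[R]_n -> W) c t :
  open A -> A (val (c t)) -> differentiable k (val (c t)) ->
  (forall U, A (val U) -> h U = k (val U)) ->
  differentiable (fun s => val (c s) : 'M[R]_n) t ->
  'D_1 (h \o c) t = 'D_('D_1 (fun s => val (c s) : 'M[R]_n) t) k (val (c t)).
Proof.
move=> oA Ac dk hk dc.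
have E : {near t, (h \o c) =1 k \o (fun s => val (c s) : 'M[R]_n)}.
  have nA : nbhs (val (c t) : 'M[R]_n) A by exact: open_nbhs_nbhs.
  have cc := differentiable_continuous dc.
  apply: (@filterS _ _ (nbhs_filter t) _ _ _ (cc _ nA)) => s As /=.
  exact: hk.
by rewrite (near_eq_D1 E) (@derive_comp_mx R R _ _ _ _ _ _ 1 dc dk).
Qed.

(** x (1 + B) x^T = |x|^2 for B skew. *)
Lemma skew_unit (B : 'M[R]_n) : skew_mx B -> 1%:M + B \in unitmx.
Proof.
move=> sB; rewrite -row_free_unit; apply: inj_row_free => v.
rewrite mulmxDr mulmx1 => /(congr1 (mulmx^~ v^T)); rewrite mul0mx mulmxDl.
have -> : v *m B *m v^T = 0.
  have E : (v *m B *m v^T)^T = - (v *m B *m v^T).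
    by rewrite !trmx_mul trmxK (sB : B^T = - B) mulNmx mulmxN mulmxA.
  apply/matrixP => i j; rewrite !ord1 [RHS]mxE.
  have := congr1 (fun M : 'M[R]_1 => M 0 0) E.
  rewrite /= [LHS]mxE [RHS]mxE => {}E.
  lra.
rewrite addr0 => /matrixP/(_ 0 0); rewrite !mxE => v0.
apply/rowP => i; rewrite [RHS]mxE; apply/eqP.
have /eqP := v0; rewrite psumr_eq0; last first.
  by move=> j _; rewrite mxE -expr2 sqr_ge0.
move=> /allP/(_ i); rewrite mem_index_enum => /(_ isT).
by rewrite mxE -expr2 sqrf_eq0.
Qed.

Lemma skewZ (B : 'M[R]_n) s : skew_mx B -> skew_mx (s *: B).
Proof.
move=> sB; apply/matrixP => i j.
by have /matrixP/(_ i j) := (sB : B^T = - B); rewrite !mxE => ->; rewrite mulrN.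
Qed.

Lemma skew_lowerP (B C : 'M[R]_n) : skew_mx B -> skew_mx C ->
  (forall i j : 'I_n, (j < i)%N -> B i j = C i j) -> B = C.
Proof.
move=> sB sC BC; apply/matrixP => i j.
have eB k l : B l k = - B k l.
  by have /matrixP/(_ k l) := (sB : B^T = - B); rewrite !mxE.
have eC k l : C l k = - C k l.
  by have /matrixP/(_ k l) := (sC : C^T = - C); rewrite !mxE.
have [ij|ji|/val_inj->] := ltngtP i j.
- by rewrite eB eC BC.
- exact: BC.
- have := eB j j; have := eC j j; lra.
Qed.

(** Orthonormalize the straight line 1 + s B: the velocity is skew with the lower
    triangular entries of B, so it is B itself. This plays the role of the
    exponential. *)
Lemma skew_curve (U : Ogrp R n) (B : 'M[R]_n) : skew_mx B ->
  exists c : R -> Ogrp R n, [/\ c 0 = U, Ck 1 setT (fun s => val (c s) : 'M[R]_n) &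
    'D_1 (fun s => val (c s) : 'M[R]_n) 0 = val U *m B].
Proof.
move=> sB.
have uL s : 1%:M + s *: B \in unitmx by apply: skew_unit; exact: skewZ.
have oc s : (val U *m orthonormalize (1%:M + s *: B))^T *m
    (val U *m orthonormalize (1%:M + s *: B)) = 1%:M.
  rewrite trmx_mul mulmxA -(mulmxA _ (val U)^T) ogrpP mulmx1.
  exact: orthonormalize_orthogonal.
have CL : Ck 1 setT (fun s : R => 1%:M + s *: B).
  apply: (CkD openT); first exact: Ck_cst.
  apply: (@Ck_scalel _ _ _ _ _ id _ openT); exact: Ck_id.
have L0 : 1%:M + (0 : R) *: B = 1%:M by rewrite scale0r addr0.
have CO := Ck_orthonormalize openT (fun s _ => uL s) CL.
have dO : differentiable (fun s : R => orthonormalize (1%:M + s *: B)) 0 by exact: CO.1.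
exists (fun s => ogrp (oc s)); split.
- apply/val_inj; rewrite /= L0 /orthonormalize trmx1 mulmx1 cholesky1 invmx1.
  by rewrite !mulmx1.
- exact: (CkMmxl openT _ CO).
- rewrite /= derive_mulmxl//; congr (_ *m _).
  have [sD DE] := derive_orthonormalize openT Logic.I CL (fun s _ => uL s) L0.
  apply: skew_lowerP => // i j ji; rewrite DE//.
  by rewrite derive_line.
Qed.

End Curves.

(** * Tangent vectors of the flag manifolds *)
Section Pushes.
Context {R : realType} {n : nat} (K : {set 'I_n}).
Let I := cell_type K.
Let b (i : 'I_n) : nat := reshape_index I i.
Let b_homo (i j : 'I_n) : (i <= j)%N -> (b i <= b j)%N.
Proof. exact: reshape_index_homo. Qed.
Implicit Types (U : Ogrp R n) (W : flag R n I) (c : R -> Ogrp R n) (t : R).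

(** Pushing a tangent vector forward and differentiating along a curve that
    carries it are the same operation; a chart is only known to be smooth near the
    points over its domain, so the extension is cut down to that domain. *)
Lemma is_push_curve c t (X : flag_tangent R n I) :
  differentiable (fun s => val (c s) : 'M[R]_n) t ->
  (forall d V (phi : flag R n I -> 'rV[R]_d), chart V phi -> V (pi_ I (c t)) ->
    X d phi = 'D_1 (phi \o pi_ I \o c) t) ->
  is_push (c t) ('D_1 (fun s => val (c s) : 'M[R]_n) t) X.
Proof.
move=> dc XE d V phi cV Vc; rewrite (XE _ _ _ cV Vc).
have [A [k [oA Ac sk kE]]] := chart_smooth cV (Vc : (pi_ I @^-1` V) (c t)).
have := chart_open cV; rewrite /open /= /quotient_open => -[A' oA' A'E].
have A'P U : A' (val U) <-> V (pi_ I U) by move/seteqP: A'E => [h1 h2]; split; [exact: h1|exact: h2].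
have skA : smooth (A' `&` A) k by move=> m; exact: Ck_sub (sk m).
have oAA : open (A' `&` A) by exact: openI.
have AAc : (A' `&` A) (val (c t)) by split => //; exact/A'P.
have kE2 U : (A' `&` A) (val U) -> (phi \o pi_ I) U = k (val U).
  by move=> [/A'P VU AU]; exact: kE.
exists (A' `&` A), k; split => //.
by rewrite (derive_along_curve oAA AAc ((skA 1).1 _ AAc) kE2 dc).
Qed.

Lemma push_curve c t (X : flag_tangent R n I) :
  differentiable (fun s => val (c s) : 'M[R]_n) t ->
  is_push (c t) ('D_1 (fun s => val (c s) : 'M[R]_n) t) X ->
  forall d V (phi : flag R n I -> 'rV[R]_d), chart V phi -> V (pi_ I (c t)) ->
    X d phi = 'D_1 (phi \o pi_ I \o c) t.
Proof.
move=> dc pX d V phi cV Vc; have [A [k [oA Ac sk kE <-]]] := pX _ _ _ cV Vc.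
by rewrite -(derive_along_curve oA Ac ((sk 1).1 _ Ac) kE dc).
Qed.

(** At V = 1 both factors are 1, so V S = L gives L' = V' + S' with S' block
    upper triangular. *)
Lemma derive_lu_lower_center (V : R -> 'M[R]_n) (A : set R) t :
  open A -> A t -> Ck 1 A V -> (forall s, A s -> lu_domain b (V s)) ->
  V t = 1%:M -> forall i j, (b j < b i)%N ->
  'D_1 (fun s => lu_lower b (V s)) t i j = 'D_1 V t i j.
Proof.
move=> oA At CV DV V1 i j ji.
have dV : differentiable V t by exact: CV.1.
have dS : differentiable (fun s => lu_upper b (V s)) t.
  exact: (Ck_lu_upper oA DV CV).1.
rewrite /lu_lower derive_mulmx// V1 lu_upper1// mulmx1 mul1mx mxE.
rewrite -[X in _ + X]derive_coord//.
rewrite (_ : (fun y => _) = cst 0) ?derive_cst ?addr0//.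
by apply/funext => s; rewrite lu_upper_upper.
Qed.

(** Inside a diagonal block the lower factor is constant, so there the skew
    velocity of the section has no lower triangular part, hence vanishes. *)
Lemma sect_horizontal U0 (x : R -> 'rV[R]_(flag_dim K)) (A : set R) t :
  open A -> A t -> Ck 1 A x -> unilower_of (x t) = 1%:M ->
  let D := (val U0)^T *m 'D_1 (fun s => val (sect U0 (x s)) : 'M[R]_n) t in
  m_ I D /\ forall i j, (b j < b i)%N ->
    D i j = 'D_1 (fun s => unilower_of (x s)) t i j.
Proof.
move=> oA At Cx x1.
have CL := Ck_unilower_of oA Cx.
have uL s : A s -> unilower_of (x s) \in unitmx.
  by move=> _; exact: (unilower_unit b_homo (@unilower_ofP R n K (x s))).
have [sD DE] := derive_orthonormalize oA At CL uL x1.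
have dO : differentiable (fun s => orthonormalize (unilower_of (x s))) t.
  exact: (Ck_orthonormalize oA uL CL).1.
move=> D.
have {}D0 : D = 'D_1 (fun s => orthonormalize (unilower_of (x s))) t.
  by rewrite /D /= derive_mulmxl// mulmxA ogrpP mul1mx.
have dL : differentiable (fun s => unilower_of (x s)) t by exact: CL.1.
rewrite D0; split; last first.
  move=> i j ji; rewrite DE// ltnNge; apply/negP => /b_homo.
  by rewrite leqNgt ji.
split=> // i j.
have z (i' j' : 'I_n) : (j' < i')%N -> same_block I i' j' ->
    'D_1 (fun s => orthonormalize (unilower_of (x s))) t i' j' = 0.
  move=> ji; rewrite /same_block -/(b i') -/(b j') => /eqP bb; rewrite DE//.
  rewrite -derive_coord//.
  rewrite (_ : (fun y => _) = cst (i' == j')%:R) ?derive_cst//.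
  have le : (b i' <= b j')%N by rewrite bb.
  by apply/funext => s; exact: (unilower_ofP _ le).
have sD' k l : 'D_1 (fun s => orthonormalize (unilower_of (x s))) t l k =
    - 'D_1 (fun s => orthonormalize (unilower_of (x s))) t k l.
  by move: sD; rewrite /skew_mx /= => /matrixP/(_ k l); rewrite [LHS]mxE [RHS]mxE.
move=> bb; have [ij|ji|/val_inj e] := ltngtP i j.
- by rewrite sD' z ?oppr0// /same_block eq_sym.
- exact: z.
- by rewrite e; have := sD' j j; lra.
Qed.

Lemma unilower_of1 : unilower_of (lower_coords K (1%:M : 'M[R]_n)) = 1%:M.
Proof.
by apply: (@lower_coordsK R n K); move=> i j _; rewrite mxE.
Qed.

Lemma mx_dom_center U : mx_dom K U (val U).
Proof. by rewrite /mx_dom /= ogrpP; exact: lu_domain1. Qed.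

Lemma chart_map_center U : chart_map U (pi_ I U) = lower_coords K 1%:M.
Proof.
have D := mx_dom_center U; have [_ ->] := chart_pi D.
by rewrite ogrpP lu_lower1.
Qed.

Lemma skew_block_lowerP (B C : 'M[R]_n) : m_ I B -> m_ I C ->
  (forall i j, (b j < b i)%N -> B i j = C i j) -> B = C.
Proof.
move=> [sB zB] [sC zC] BC; apply: skew_lowerP => // i j ji.
have [bb|nb] := boolP (same_block I i j); first by rewrite zB// zC.
apply: BC; rewrite ltn_neqAle eq_sym [X in X && _]nb /=.
by apply: b_homo; exact: ltnW.
Qed.

(** The entries of B below the blocks are the coordinates of the tangent vector
    in the chart centered at U, and they determine a matrix of m_I. *)
Lemma push_inj U B C (X : flag_tangent R n I) : m_ I B -> m_ I C ->
  is_push U (val U *m B) X -> is_push U (val U *m C) X -> B = C.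
Proof.
suff main B0 i j : m_ I B0 -> is_push U (val U *m B0) X -> (b j < b i)%N ->
    B0 i j = unilower_of (X _ (chart_map U)) i j.
  move=> mB mC pB pC; apply: skew_block_lowerP => // i j ji.
  by rewrite (main B)// (main C).
move=> mB pB ji.
have [c [c0 Cc Dc]] := skew_curve U mB.1.
have dc : differentiable (fun s => val (c s) : 'M[R]_n) 0 by exact: Cc.1.
have pX : is_push (c 0) ('D_1 (fun s => val (c s) : 'M[R]_n) 0) X by rewrite c0 Dc.
have Vc : chart_dom U (pi_ I (c 0)).
  by rewrite c0; apply/chart_dom_pi; exact: mx_dom_center.
have := push_curve dc pX (chartP K U) Vc.
pose A : set R := setT `&` (fun s => val (c s) : 'M[R]_n) @^-1` mx_dom K U.
have oA : open A.
  apply: open_setI_preimage; [exact: openT|exact: open_mx_dom|exact: Ck_pred Cc].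
have A0 : A 0 by split => //; rewrite /preimage /= c0; exact: mx_dom_center.
pose V s := (val U)^T *m val (c s).
have CV : Ck 1 A V by apply: CkMmxl => //; exact: Ck_sub Cc.
have DV s : A s -> lu_domain b (V s) by move=> [].
have V1 : V 0 = 1%:M by rewrite /V c0 ogrpP.
have CL : Ck 1 A (fun s => lu_lower b (V s)) by exact: Ck_lu_lower.
have dL : differentiable (fun s => lu_lower b (V s)) 0 by exact: CL.1.
have dV : differentiable V 0 by exact: CV.1.
have E : {near 0, chart_map U \o pi_ I \o c =1
    fun s => lower_coords K (lu_lower b (V s))}.
  have : nbhs 0 A by exact: open_nbhs_nbhs.
  by apply: (@filterS _ _ (nbhs_filter 0)) => s [_ /= Ds]; have [_ ->] := chart_pi Ds.
rewrite (near_eq_D1 E) => XE.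
have : 'D_1 V 0 = B0.
  rewrite /V derive_mulmxl//.
  by rewrite Dc mulmxA ogrpP mul1mx.
move=> <-; rewrite -(derive_lu_lower_center oA A0 CV DV V1 ji).
have dLC : differentiable (fun s => lower_coords K (lu_lower b (V s))) 0.
  by have [+ _] := Ck_lower_coords K oA CL; apply.
rewrite [RHS]mxE insubT XE -[RHS]derive_coord// -[LHS]derive_coord//.
have -> : (fun s => lower_coords K (lu_lower b (V s)) 0 (enum_rank
    (Sub (i, j) ji : below_block K))) = fun s => lu_lower b (V s) i j.
  by apply/funext => s; rewrite mxE enum_rankK.
by [].
Qed.

End Pushes.

(** * The velocity of a path of flags *)
Section Velocity.
Context {R : realType} {n : nat} (K : {set 'I_n}).
Let I := cell_type K.
Let b (i : 'I_n) : nat := reshape_index I i.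
Let b_homo (i j : 'I_n) : (i <= j)%N -> (b i <= b j)%N.
Proof. exact: reshape_index_homo. Qed.
Implicit Types (U : Ogrp R n) (W : flag R n I) (t : R).

(** The projection of the skew matrices onto m_I. *)
Definition off_block (Z : 'M[R]_n) : 'M[R]_n :=
  \matrix_(i, j) if same_block I i j then 0 else Z i j.

Lemma off_block_m_ Z : skew_mx Z -> m_ I (off_block Z).
Proof.
move=> sZ; split; last by move=> i j ij; rewrite mxE ij.
apply/matrixP => i j; rewrite !mxE /same_block eq_sym.
have /matrixP/(_ i j) := (sZ : Z^T = - Z); rewrite !mxE => ->.
by case: ifP => _; rewrite ?oppr0.
Qed.

(** Take the section over the chart centered at c(t) of the path of flags: its
    velocity at t lies in m_I and has the same entries below the blocks. *)
Lemma horizontal_curve (c : R -> Ogrp R n) (A : set R) t :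
  open A -> A t -> Ck 1 A (fun s => val (c s) : 'M[R]_n) ->
  exists w : R -> Ogrp R n,
    [/\ w t = c t, differentiable (fun s => val (w s) : 'M[R]_n) t,
        {near t, (fun s => pi_ I (w s)) =1 (fun s => pi_ I (c s))} &
        (val (c t))^T *m 'D_1 (fun s => val (w s) : 'M[R]_n) t =
        off_block ((val (c t))^T *m 'D_1 (fun s => val (c s) : 'M[R]_n) t)].
Proof.
move=> oA At Cc; pose U := c t.
pose A' : set R := A `&` (fun s => val (c s) : 'M[R]_n) @^-1` mx_dom K U.
have oA' : open A'.
  by apply: open_setI_preimage; [|exact: open_mx_dom|exact: Ck_pred Cc].
have A't : A' t by split => //; exact: mx_dom_center.
pose V s := (val U)^T *m val (c s).
have CV : Ck 1 A' V.
  by apply: CkMmxl => //; apply: Ck_sub Cc => s [].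
have DV s : A' s -> lu_domain b (V s) by move=> [].
have V1 : V t = 1%:M by rewrite /V ogrpP.
pose x s : 'rV[R]_(flag_dim K) := lower_coords K (lu_lower b (V s)).
have Cx : Ck 1 A' x.
  have CLu : Ck 1 A' (fun s => lu_lower b (V s)) by exact: Ck_lu_lower.
  exact: (Ck_lower_coords K oA' CLu).
have x1 : unilower_of (x t) = 1%:M by rewrite /x V1 lu_lower1// unilower_of1.
have [mD DE] := sect_horizontal U oA' A't Cx x1.
have nA' : nbhs t A' by exact: open_nbhs_nbhs.
have Cw : Ck 1 A' (fun s => val (sect U (x s)) : 'M[R]_n) by exact: Ck_sect.
exists (fun s => sect U (x s)); split.
- apply/val_inj; rewrite /= x1 /orthonormalize trmx1 mulmx1 cholesky1 invmx1.
  by rewrite !mulmx1.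
- exact: Cw.1.
- apply: (@filterS _ _ (nbhs_filter t) _ _ _ nA') => s [As Ds].
  by rewrite /x /V; have [D <-] := chart_pi Ds; rewrite sect_chart.
- have dc : differentiable (fun s => val (c s) : 'M[R]_n) t by exact: Cc.1.
  apply: (@skew_block_lowerP R n K) => //.
    by apply: off_block_m_; exact: skew_velocity.
  move=> i j ji; rewrite DE//.
  have E : {near t, (fun s => unilower_of (x s)) =1 (fun s => lu_lower b (V s))}.
    apply: (@filterS _ _ (nbhs_filter t) _ _ _ nA') => s [As Ds].
    by rewrite /x lower_coordsK//; exact: lu_lower_unilower.
  rewrite (near_eq_D1 E) (derive_lu_lower_center oA' A't CV DV V1 ji).
  rewrite /V derive_mulmxl// [RHS]mxE ifF//.
  by apply/negbTE; rewrite /same_block -/(b i) -/(b j) gtn_eqF.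
Qed.

(** The value is conjugated by the element of O(I) that relates the lift to the
    chosen representative of the flag. The matrix obtained from the horizontal
    lift is admissible, and it is the only one by injectivity. *)
Lemma m_coord_path (c : R -> Ogrp R n) (w : R -> flag R n I) (A : set R) t :
  open A -> A t -> Ck 1 A (fun s => val (c s) : 'M[R]_n) ->
  {near t, w =1 (fun s => pi_ I (c s))} ->
  exists2 Q, block_orthogonal I Q & m_coord (w t) (flag_velocity w t) =
    Q^T *m off_block ((val (c t))^T *m 'D_1 (fun s => val (c s) : 'M[R]_n) t) *m Q.
Proof.
move=> oA At Cc wE.
have [h [hc dh hE Dh]] := horizontal_curve oA At Cc.
have wt : w t = pi_ I (c t) by exact: nbhs_singleton wE.
have [Q [oQ bQ] VE] := @repr_piE R n K (c t).
exists Q => //.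
have dc : differentiable (fun s => val (c s) : 'M[R]_n) t by exact: Cc.1.
set Z := off_block _ in Dh *.
have mZ : m_ I Z by apply: off_block_m_; exact: skew_velocity.
have mB : m_ I (Q^T *m Z *m Q).
  split.
    rewrite /skew_mx /= [LHS]trmx_mul [in LHS]trmx_mul trmxK (mZ.1 : Z^T = - Z).
    by rewrite mulNmx mulmxN mulmxA.
  move=> i j /eqP ij; rewrite mxE big1// => k _; rewrite mxE big_distrl big1//= => l _.
  rewrite mxE.
  have [il|nil] := boolP (same_block I l i); last by rewrite bQ// !mul0r.
  have [kj|nkj] := boolP (same_block I k j); last by rewrite (bQ k j)// mulr0.
  rewrite mZ.2 ?mulr0 ?mul0r//.
  by rewrite /same_block (eqP il) (eqP kj) ij.
have oQc s : (val (h s) *m Q)^T *m (val (h s) *m Q) = 1%:M.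
  by rewrite trmx_mul mulmxA -(mulmxA Q^T) ogrpP mulmx1.
pose e s : Ogrp R n := ogrp (oQc s).
have de : differentiable (fun s => val (e s) : 'M[R]_n) t.
  by apply: differentiable_mulmx => //; exact: differentiable_cst.
have et : e t = repr (w t) by apply/val_inj; rewrite /= hc wt VE.
have De : 'D_1 (fun s => val (e s) : 'M[R]_n) t = val (repr (w t)) *m (Q^T *m Z *m Q).
  rewrite /= derive_mulmxr// wt VE !mulmxA -(mulmxA _ Q) (mulmx1C oQ) mulmx1.
  by rewrite -Dh mulmxA ogrpP' mul1mx.
have eE : {near t, (fun s => pi_ I (e s)) =1 w}.
  near=> s.
  have -> : w s = pi_ I (c s) by near: s.
  have <- : pi_ I (h s) = pi_ I (c s) by near: s.
  by apply/esym/pi_eqP; exists Q.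
have pushB : is_push (repr (w t)) (val (repr (w t)) *m (Q^T *m Z *m Q)) (flag_velocity w t).
  rewrite -De -et; apply: is_push_curve => // d V phi cV Vc.
  rewrite /flag_velocity derive1E; apply: near_eq_D1.
  by near=> s => /=; congr phi; apply/esym; near: s.
rewrite /m_coord; case: xgetP => [B _ [mB' pB']|/(_ (Q^T *m Z *m Q))].
  exact: push_inj pB' pushB.
by case; split.
Unshelve. all: by end_near. Qed.

End Velocity.

(** * The metric in terms of lifts *)
Section MetricInvariance.
Context {R : realType} {n : nat} (K : {set 'I_n}).
Variable f : 'rV[R]_n -> R.
Let I := cell_type K.
Let b (i : 'I_n) : nat := reshape_index I i.
Let b_homo (i j : 'I_n) : (i <= j)%N -> (b i <= b j)%N.
Proof. exact: reshape_index_homo. Qed.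

(** Between two indices of one block mu has no positive entry, so moving i or j
    inside its block adds or removes zeros only. *)
Lemma truncate_block (mu : 'rV[R]_n) (i j i' j' : 'I_n) :
  open_simplex K mu -> same_block I i i' -> same_block I j j' ->
  truncate mu i j = truncate mu i' j'.
Proof.
move=> [_ muK] /same_blockP ii /same_blockP jj; apply/rowP => l; rewrite !mxE.
have [lK|nlK] := boolP (l \in K); last by rewrite (muK l).2// !if_same.
by rewrite ![(_ <= l)%N]leqNgt ii// jj.
Qed.

Lemma sum_sqr_orthogonal (M Q : 'M[R]_n) : Q^T *m Q = 1%:M ->
  \sum_i \sum_j (Q^T *m M *m Q) i j ^+ 2 = \sum_i \sum_j M i j ^+ 2.
Proof.
move=> QQ.
have trE (N : 'M[R]_n) : \sum_i \sum_j N i j ^+ 2 = \tr (N^T *m N).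
  rewrite exchange_big /=; apply: eq_bigr => j _; rewrite mxE.
  by apply: eq_bigr => i _; rewrite mxE expr2.
rewrite !trE !trmx_mul trmxK !mulmxA mxtrace_mulC !mulmxA (mulmx1C QQ) mul1mx.
by rewrite -!mulmxA (mulmxA Q) (mulmx1C QQ) mul1mx.
Qed.

(** The coefficients are constant on each pair of blocks, so multiplying the
    entries by them commutes with the conjugation by Q, which preserves the sum
    of the squares of the entries. *)
Lemma flag_metric_invariant (mu : 'rV[R]_n) (Z Q : 'M[R]_n) :
  open_simplex K mu -> block_orthogonal I Q ->
  (forall i j, same_block I i j -> Z i j = 0) ->
  \sum_(i < n) \sum_(j < n | (i < j)%N)
    f (truncate mu i j) ^+ 2 * (Q^T *m Z *m Q) i j * (Q^T *m Z *m Q) i j =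
  \sum_(i < n) \sum_(j < n | (i < j)%N) f (truncate mu i j) ^+ 2 * Z i j ^+ 2.
Proof.
move=> muK [oQ bQ] zZ.
(* The coefficients, set to 0 unless the block of i precedes that of j: the sum
   becomes the squared Frobenius norm of a matrix. *)
pose phi i j := if (b i < b j)%N then f (truncate mu i j) else 0.
pose C : 'M[R]_n := \matrix_(i, j) (phi i j * Z i j).
have main (N : 'M[R]_n) : (forall i j, same_block I i j -> N i j = 0) ->
    \sum_(i < n) \sum_(j < n | (i < j)%N) f (truncate mu i j) ^+ 2 * N i j ^+ 2 =
    \sum_i \sum_j (phi i j * N i j) ^+ 2.
  move=> zN; apply: eq_bigr => i _; rewrite big_mkcond /=; apply: eq_bigr => j _.
  rewrite exprMn /phi; case: ifPn => [ij|].
    case: ifPn => // nb; rewrite zN ?expr0n ?mulr0//.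
    rewrite /same_block -/(b i) -/(b j) eqn_leq b_homo ?(ltnW ij)//=.
    by rewrite leqNgt.
  rewrite -leqNgt => /b_homo; rewrite leqNgt => /negbTE ->.
  by rewrite expr0n mul0r.
have zB i j : same_block I i j -> (Q^T *m Z *m Q) i j = 0.
  move=> /eqP ij; rewrite mxE big1// => k _; rewrite mxE big_distrl big1//= => l _.
  rewrite mxE.
  have [il|nil] := boolP (same_block I l i); last by rewrite bQ// !mul0r.
  have [kj|nkj] := boolP (same_block I k j); last by rewrite (bQ k j)// mulr0.
  rewrite zZ ?mulr0 ?mul0r//.
  by rewrite /same_block (eqP il) (eqP kj) ij.
transitivity (\sum_(i < n) \sum_(j < n | (i < j)%N)
    f (truncate mu i j) ^+ 2 * (Q^T *m Z *m Q) i j ^+ 2).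
  by apply: eq_bigr => i _; apply: eq_bigr => j _; rewrite -mulrA -expr2.
rewrite !main//.
have CE : \sum_i \sum_j (phi i j * Z i j) ^+ 2 = \sum_i \sum_j C i j ^+ 2.
  by apply: eq_bigr => i _; apply: eq_bigr => j _; rewrite mxE.
rewrite CE -(sum_sqr_orthogonal C oQ).
apply: eq_bigr => i _; apply: eq_bigr => j _; congr (_ ^+ 2).
rewrite !mxE big_distrr; apply: eq_bigr => k _ /=.
rewrite !mxE !big_distrl big_distrr; apply: eq_bigr => l _ /=.
rewrite !mxE.
have [il|nil] := boolP (same_block I l i); last by rewrite bQ// !(mul0r, mulr0).
have [kj|nkj] := boolP (same_block I k j); last by rewrite (bQ k j)// !mulr0.
have -> : phi i j = phi l k.
  rewrite /phi /b (eqP il) (eqP kj) (truncate_block muK il kj); by [].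
by ring.
Qed.

(** The norm of a tangent vector of the cell of K at (mu, pi(U)), where Z is
    U^T times the velocity of a lift to O(n). *)
Definition lifted_norm (mu mu' : 'rV[R]_n) (Z : 'M[R]_n) : R :=
  Num.sqrt (\sum_i mu' 0 i ^+ 2 +
    \sum_(i < n) \sum_(j < n | (i < j)%N)
      f (truncate mu i j) ^+ 2 * off_block K Z i j ^+ 2).

Lemma speedE (gam : R -> wflag R n) (mu : R -> 'rV[R]_n) (c : R -> Ogrp R n)
    (A : set R) t :
  open A -> A t -> Ck 1 A (fun s => val (c s) : 'M[R]_n) ->
  {near t, (fun s => weight (gam s)) =1 mu} ->
  {near t, (fun s => wf_flag I (gam s)) =1 (fun s => pi_ I (c s))} ->
  open_simplex K (mu t) ->
  speed f K gam t = lifted_norm (mu t) ('D_1 mu t)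
    ((val (c t))^T *m 'D_1 (fun s => val (c s) : 'M[R]_n) t).
Proof.
move=> oA At Cc wE fE muK; rewrite /speed /lifted_norm /metric /=.
have [Q bQ mE] := m_coord_path oA At Cc fE.
rewrite -/I [m_coord _ _]mE (nbhs_singleton wE : weight (gam t) = mu t).
apply: (congr2 (fun x y => Num.sqrt (x + y))).
  have wE' : {near t, @weight R n \o gam =1 mu} by [].
  by apply: eq_bigr => i _; rewrite derive1E (near_eq_D1 wE') expr2.
apply: flag_metric_invariant => //.
by move=> i j ij; rewrite mxE ij.
Qed.

End MetricInvariance.

(** * The topology of the space of weighted flags *)
Section WeightedFlags.
Context {R : realType} {n : nat}.
Hypothesis n_ge1 : (1 <= n)%N.
Implicit Types (mu : 'rV[R]_n) (U : Ogrp R n) (w : wflag R n).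

Definition barycenter : 'rV[R]_n := const_mx (n%:R^-1).

Lemma barycenter_gt0 i : 0 < barycenter 0 i.
Proof. by rewrite mxE invr_gt0 ltr0n. Qed.

Lemma simplexI mu : (forall i, 0 <= mu 0 i) -> \sum_i mu 0 i = 1 -> simplex mu.
Proof.
move=> mu0 mu1; split=> // i; rewrite mu0 -mu1 (bigD1 i)//= lerDl.
exact: sumr_ge0.
Qed.

Lemma simplex_barycenter : simplex barycenter.
Proof.
apply: simplexI => [i|]; first exact: ltW (barycenter_gt0 i).
under eq_bigr do rewrite mxE.
by rewrite sumr_const card_ord -[LHS]mulr_natl mulfV// pnatr_eq0 -lt0n.
Qed.

(** Defined for all vectors, so that points of WF(n) can be formed from paths of
    weights that are in the simplex for some times only. *)
Definition in_simplex mu : set_type (@simplex R n) :=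
  insubd (exist _ barycenter (mem_set simplex_barycenter) : set_type (@simplex R n)) mu.

Lemma in_simplexK mu : simplex mu -> val (in_simplex mu) = mu.
Proof. by move=> smu; rewrite /in_simplex insubdK//; exact: mem_set. Qed.

(** The weighted flag (mu, pi(U)). *)
Definition wfl mu U : wflag R n := \pi_(wflag R n) (in_simplex mu, U).

Lemma open_simplex_supp mu : simplex mu -> open_simplex (supp mu) mu.
Proof.
move=> smu; split=> // j; rewrite inE; split=> //; rewrite -leNgt => j0.
by apply/eqP; rewrite eq_le j0; have /andP[] := smu.1 j.
Qed.

Lemma supp_open_simplex (K : {set 'I_n}) mu : open_simplex K mu -> supp mu = K.
Proof.
move=> [_ muK]; apply/finset.setP => j; rewrite inE.
have [jK|jK] := boolP (j \in K); first exact: (muK j).1.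
by rewrite (muK j).2// ltxx.
Qed.

Lemma wflag_piE (p q : set_type (@simplex R n) * Ogrp R n) :
  \pi_(wflag R n) p = \pi_(wflag R n) q <->
  p.1 = q.1 /\ pi_ (tau (val p.1)) p.2 = pi_ (tau (val p.1)) q.2.
Proof.
split=> [/eqmodP/andP[/eqP ? /eqP ?]//|[e1 e2]].
have pq : wf_equiv R n p q by apply/andP; split; apply/eqP.
by move: pq => /eqmodP.
Qed.

Lemma repr_wfl mu U : simplex mu -> weight (wfl mu U) = mu /\
  pi_ (tau mu) (repr (wfl mu U)).2 = pi_ (tau mu) U.
Proof.
move=> smu; have /wflag_piE[] : \pi_(wflag R n) (repr (wfl mu U)) =
    \pi_(wflag R n) (in_simplex mu, U) by rewrite reprK.
rewrite /weight /= => -> .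
by rewrite in_simplexK.
Qed.

Lemma weight_wfl mu U : simplex mu -> weight (wfl mu U) = mu.
Proof. by move=> smu; have [] := repr_wfl U smu. Qed.

Lemma wf_flag_wfl (K : {set 'I_n}) mu U : open_simplex K mu ->
  wf_flag (cell_type K) (wfl mu U) = pi_ (cell_type K) U.
Proof.
move=> muK; have [_] := repr_wfl U muK.1.
by rewrite /tau (supp_open_simplex muK).
Qed.

Lemma simplex_weight w : simplex (weight w).
Proof. exact: set_mem (valP (repr w).1). Qed.

Lemma wflE w mu U : weight w = mu ->
  pi_ (tau mu) (repr w).2 = pi_ (tau mu) U -> w = wfl mu U.
Proof.
move=> wmu wU; rewrite -[LHS]reprK; apply/wflag_piE => /=.
have e : (repr w).1 = in_simplex mu.
  by apply/val_inj; rewrite in_simplexK -wmu//; exact: simplex_weight.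
by rewrite -/(weight w) wmu.
Qed.

Lemma wflE_cell (K : {set 'I_n}) w mu U : open_simplex K mu -> weight w = mu ->
  wf_flag (cell_type K) w = pi_ (cell_type K) U -> w = wfl mu U.
Proof.
by move=> muK wmu wU; apply: wflE => //; rewrite /tau (supp_open_simplex muK).
Qed.

Definition partial_sums mu : 'rV[R]_n := \row_k \sum_(l < n | (l < k)%N) mu 0 l.

(** Let lambda be the vector of the partial sums. An element of O(I) commutes with
    diag(lambda) because lambda is constant on the blocks of the type I of mu.
    Conversely, lambda takes distinct values on
    distinct blocks, so the matrix determines its eigenspaces, hence the flag. *)
Definition sep_mx mu U : 'M[R]_n := val U *m diag_mx (partial_sums mu) *m (val U)^T.

Lemma partial_sums_block mu i j : simplex mu -> same_block (tau mu) i j ->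
  partial_sums mu 0 i = partial_sums mu 0 j.
Proof.
move=> smu /same_blockP H; rewrite !mxE [LHS]big_mkcond [RHS]big_mkcond /=.
apply: eq_bigr => l _; have [lK|] := boolP (l \in supp mu); first by rewrite H.
by move=> /((open_simplex_supp smu).2 l).2 ->; rewrite !if_same.
Qed.

Lemma partial_sums_inj mu i j : simplex mu ->
  partial_sums mu 0 i = partial_sums mu 0 j -> same_block (tau mu) i j.
Proof.
move=> smu; wlog ij : i j / (i <= j)%N => [W e|].
  have [/W|/ltnW/W] := leqP i j; first exact.
  by rewrite /same_block eq_sym; apply.
rewrite !mxE => e; apply/same_blockP => k kK; apply/idP/idP => [/leq_trans|kj]; first exact.
rewrite ltnNge; apply/negP => ik; have : 0 < mu 0 k by move: kK; rewrite inE.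
suff : \sum_(l < n | (l < i)%N) mu 0 l + mu 0 k <= \sum_(l < n | (l < j)%N) mu 0 l by lra.
have mu0 l : 0 <= mu 0 l by have /andP[] := smu.1 l.
rewrite [leRHS](bigD1 k)//= addrC lerD2r [leLHS]big_mkcond [leRHS]big_mkcond /=.
apply: ler_sum => l _; case: ifPn => li.
  rewrite ifT// (leq_trans li ij)/=; apply: contraTneq li => ->.
  by rewrite -leqNgt.
by case: ifP.
Qed.

Lemma sep_mx_pi mu U V : simplex mu -> pi_ (tau mu) U = pi_ (tau mu) V ->
  sep_mx mu U = sep_mx mu V.
Proof.
move=> smu /pi_eqP[Q [oQ bQ] VE]; rewrite /sep_mx VE trmx_mul.
have QD : Q *m diag_mx (partial_sums mu) = diag_mx (partial_sums mu) *m Q.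
  apply/matrixP => i j; rewrite mul_mx_diag mul_diag_mx 2![in LHS]mxE 2![in RHS]mxE.
  have [ij|nij] := boolP (same_block (tau mu) i j); last by rewrite bQ// mul0r mulr0.
  have := partial_sums_block smu ij; rewrite !mxE => ->; exact: mulrC.
by rewrite -(mulmxA (val U) Q) QD !mulmxA -(mulmxA _ Q) (mulmx1C oQ) mulmx1.
Qed.

Lemma sep_mx_inj mu U V : simplex mu -> sep_mx mu U = sep_mx mu V ->
  pi_ (tau mu) U = pi_ (tau mu) V.
Proof.
move=> smu e; apply/pi_eqP; exists ((val U)^T *m val V); last first.
  by rewrite mulmxA ogrpP' mul1mx.
split=> [|i j].
  by rewrite /orthogonal_mx /= trmx_mul trmxK mulmxA -(mulmxA _ (val U)) ogrpP' mulmx1 ogrpP.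
set Q := _ *m _.
have DQ : diag_mx (partial_sums mu) *m Q = Q *m diag_mx (partial_sums mu).
  have := congr1 (fun M => (val U)^T *m M *m val V) e; rewrite /= /sep_mx.
  rewrite !mulmxA ogrpP mul1mx -(mulmxA _ (val U)^T (val V)) -/Q => ->.
  by rewrite -(mulmxA _ (val V)^T (val V)) ogrpP mulmx1.
move=> nij; apply/eqP; apply: contraNT nij => Qij.
apply: partial_sums_inj => //.
have /matrixP/(_ i j) := DQ; rewrite mul_mx_diag mul_diag_mx [LHS]mxE [RHS]mxE.
by rewrite mulrC => /(mulfI Qij).
Qed.

Definition sep i j w : R := sep_mx (weight w) (repr w).2 i j.

Lemma wflag_sepP w w' : weight w = weight w' ->
  (forall i j, sep i j w = sep i j w') -> w = w'.
Proof.
move=> ww ss; rewrite -[LHS]reprK -[RHS]reprK; apply/wflag_piE; split.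
  exact/val_inj.
apply: sep_mx_inj; first exact: simplex_weight.
by apply/matrixP => i j; have := ss i j; rewrite /sep -ww.
Qed.

Lemma cvg_mx_coord (T : topologicalType) (M : T -> 'rV[R]_n) x i :
  {for x, continuous M} -> {for x, continuous (fun y => M y 0 i)}.
Proof.
move=> cM; apply: (@continuous_comp _ _ _ M (fun N : 'rV[R]_n => N 0 i)) => //.
exact: coord_continuous.
Qed.

Lemma continuous_sumr (T : topologicalType) (J : Type) (r : seq J) (P : pred J)
    (F : J -> T -> R) (x : T) : (forall j, {for x, continuous (F j)}) ->
  {for x, continuous (fun y => \sum_(j <- r | P j) F j y)}.
Proof.
move=> cF; elim: r => [|j r IH].
  rewrite (_ : (fun _ => _) = cst 0); first exact: cvg_cst.
  by apply/funext => y; rewrite big_nil.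
have [Pj|nPj] := boolP (P j).
  rewrite (_ : (fun _ => _) = fun y => F j y + \sum_(j <- r | P j) F j y).
    by apply: cvgD; [exact: cF|exact: IH].
  by apply/funext => y; rewrite big_cons Pj.
rewrite (_ : (fun _ => _) = fun y => \sum_(j <- r | P j) F j y); first exact: IH.
by apply/funext => y; rewrite big_cons (negbTE nPj).
Qed.

Lemma continuous_weight i : continuous (fun w => weight w 0 i).
Proof.
apply/(@quotient_continuous _ _ _ (fun w => weight w 0 i)).
have E q : ((fun w => weight w 0 i) \o \pi_(wflag R n)) q = val q.1 0 i.
  rewrite /= /weight; have /wflag_piE[] : \pi_(wflag R n) (repr (\pi_(wflag R n) q)) =
    \pi_(wflag R n) q by rewrite reprK.
  by move=> ->.
have C : continuous (fun q : set_type (@simplex R n) * Ogrp R n => val q.1 0 i).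
  move=> p; apply: (@cvg_mx_coord _
    (fun q : set_type (@simplex R n) * Ogrp R n => val q.1) p i).
  apply: (@val_continuous _ _ (@simplex R n) fst).
  exact: cvg_fst.
by rewrite -(funext E) in C.
Qed.

(** On Delta(n) x O(n) the entries of the separating matrix are polynomials in
    those of mu and U, and they descend to the quotient. *)
Lemma continuous_sep i j : continuous (sep i j).
Proof.
apply/(@quotient_continuous _ _ _ (sep i j)).
have E q : (sep i j \o \pi_(wflag R n)) q = \sum_k
    val q.2 i k * (\sum_(l < n | (l < k)%N) val q.1 0 l) * val q.2 j k.
  have /wflag_piE[e1 e2] : \pi_(wflag R n) (repr (\pi_(wflag R n) q)) =
    \pi_(wflag R n) q by rewrite reprK.
  rewrite /= /sep (sep_mx_pi _ e2); last exact: simplex_weight.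
  rewrite /weight e1 mxE; apply: eq_bigr => k _.
  by rewrite mul_mx_diag !mxE.
suff C : continuous (fun q : set_type (@simplex R n) * Ogrp R n => \sum_k
    val q.2 i k * (\sum_(l < n | (l < k)%N) val q.1 0 l) * val q.2 j k).
  by rewrite -(funext E) in C.
move=> p.
have c2 i' k : {for p, continuous (fun q : set_type (@simplex R n) * Ogrp R n =>
    val q.2 i' k)}.
  apply: (@continuous_comp _ _ _ (fun q : set_type (@simplex R n) * Ogrp R n => val q.2)
    (fun N : 'M[R]_n => N i' k)); last exact: coord_continuous.
  by apply: (@val_continuous _ _ (@orthogonal_mx R n) snd); exact: cvg_snd.
have c1 l : {for p, continuous (fun q : set_type (@simplex R n) * Ogrp R n =>
    val q.1 0 l)}.
  apply: (@cvg_mx_coord _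
    (fun q : set_type (@simplex R n) * Ogrp R n => val q.1) p l).
  apply: (@val_continuous _ _ (@simplex R n) fst).
  exact: cvg_fst.
apply: continuous_sumr => k.
apply: cvgM; last exact: c2.
apply: cvgM; first exact: c2.
by apply: continuous_sumr => l; exact: c1.
Qed.

Lemma real_endpoints (g : R -> R) u v : u < v -> {within `[u, v], continuous g} ->
  (forall s, s \in `]u, v[ -> g s = 0) -> g u = 0 /\ g v = 0.
Proof.
move=> uv /(continuous_within_itvP _ uv)[_ gu gv] g0; split.
  apply: (cvg_unique (@Rhausdorff R) gu).
  have E : {near u^'+, (fun=> 0) =1 g}.
    have : \forall s \near u^'+, u < s /\ s < v.
      by apply: filterI; [exact: nbhs_right_gt|exact: nbhs_right_lt].
    by apply: filterS => s [us sv]; apply/esym/g0; rewrite in_itv/= us.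
  exact: cvg_trans (near_eq_cvg E) (cvg_cst _).
apply: (cvg_unique (@Rhausdorff R) gv).
have E : {near v^'-, (fun=> 0) =1 g}.
  have : \forall s \near v^'-, u < s /\ s < v.
    by apply: filterI; [exact: nbhs_left_gt|exact: nbhs_left_lt].
  by apply: filterS => s [us sv]; apply/esym/g0; rewrite in_itv/= us.
exact: cvg_trans (near_eq_cvg E) (cvg_cst _).
Qed.

(** The real-valued functions that separate the points of WF(n) are continuous
    and agree along both paths up to the endpoints. *)
Lemma wflag_endpoints (g h : R -> wflag R n) u v : u < v ->
  {within `[u, v], continuous g} -> {within `[u, v], continuous h} ->
  (forall s, s \in `]u, v[ -> g s = h s) -> g u = h u /\ g v = h v.
Proof.
move=> uv cg ch gh.
have key (k : wflag R n -> R) : continuous k -> k (g u) = k (h u) /\ k (g v) = k (h v).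
  move=> ck.
  have cgh : {within `[u, v], continuous (fun s => k (g s) - k (h s))}.
    move=> s; apply: cvgB.
      by apply: (@continuous_comp (subspace `[u, v]) _ _ g k); [exact: cg|exact: ck].
    by apply: (@continuous_comp (subspace `[u, v]) _ _ h k); [exact: ch|exact: ck].
  have [|e1 e2] := real_endpoints uv cgh.
    by move=> s /gh ->; rewrite subrr.
  by split; apply/subr0_eq.
split; apply: wflag_sepP.
- by apply/rowP => i; have [] := key _ (@continuous_weight i).
- by move=> i j; have [] := key _ (@continuous_sep i j).
- by apply/rowP => i; have [] := key _ (@continuous_weight i).
- by move=> i j; have [] := key _ (@continuous_sep i j).
Qed.

Lemma continuous_wfl (B : set R) (mu : R -> 'rV[R]_n) (U : R -> Ogrp R n) :
  {within B, continuous mu} ->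
  {within B, continuous (fun s => val (U s) : 'M[R]_n)} ->
  (forall s, B s -> simplex (mu s)) ->
  {within B, continuous (fun s => wfl (mu s) (U s))}.
Proof.
move=> cmu cU smu x.
apply: (@continuous_comp (subspace B) _ _ (fun s => (in_simplex (mu s), U s))
  (\pi_(wflag R n))); last exact: pi_continuous.
have cU' : continuous (U : subspace B -> Ogrp R n).
  by move=> y; apply: set_type_continuous; exact: cU.
have cm : continuous ((fun s => in_simplex (mu s)) : subspace B -> set_type (@simplex R n)).
  move=> y; apply: set_type_continuous.
  have H := @subspace_eq_continuous _ B _ mu (fun s => val (in_simplex (mu s))).
  apply: H; last exact: cmu.
  by move=> s /set_mem Bs /=; rewrite in_simplexK//; exact: smu.
exact: (cvg_pair (cm x) (cU' x)).
Qed.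

End WeightedFlags.

(** * Local lifts of paths *)
Section LocalLift.
Context {R : realType} {n : nat}.
Hypothesis n_ge1 : (1 <= n)%N.
Implicit Types (gam : R -> wflag R n) (K : {set 'I_n}).

Lemma Ck_within_continuous (W : normedModType R) (A B : set R) (h : R -> W) :
  B `<=` A -> Ck 0 A h -> {within B, continuous h}.
Proof.
move=> BA Ch; apply: continuous_in_subspaceT => x /set_mem Bx.
exact: (Ch x (BA x Bx)).
Qed.

(** A C^1 lift of gam near a time of [u, v]. It is compared with gam inside
    ]u, v[ only, since gam may leave the cell of K at u and v. *)
Record lift_on K (gam : R -> wflag R n) (u v : R) (A : set R)
    (mu : R -> 'rV[R]_n) (U : R -> Ogrp R n) : Prop := LiftOn {
  lift_open : open A ;
  lift_Ck_weight : Ck 1 A mu ;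
  lift_Ck_frame : Ck 1 A (fun s => val (U s) : 'M[R]_n) ;
  lift_face : forall s, A s -> s \in `[u, v] -> closed_face K (mu s) ;
  lift_cell : forall s, A s -> s \in `]u, v[ -> open_simplex K (mu s) ;
  lift_weight : forall s, A s -> s \in `]u, v[ -> weight (gam s) = mu s ;
  lift_flag : forall s, A s -> s \in `]u, v[ ->
    wf_flag (cell_type K) (gam s) = pi_ (cell_type K) (U s) }.

(** The velocity of a path in O(n) moved back to the identity. *)
Definition frame_velocity (U : R -> Ogrp R n) (s : R) : 'M[R]_n :=
  (val (U s))^T *m 'D_1 (fun s => val (U s) : 'M[R]_n) s.

(** Lift the path of flags by the section over the chart centered at a
    representative of its value at t0, where the section has no velocity inside
    the blocks. *)
Lemma exists_lift K gam u v t0 : t0 \in `[u, v] -> C1_piece K u v gam ->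
  exists (e : R) mu U, [/\ 0 < e, lift_on K gam u v (ball t0 e) mu U &
    forall i j, same_block (cell_type K) i j -> frame_velocity U t0 i j = 0].
Proof.
move=> t0uv [gcell [m [c [[mface mC1 [ccont cC1]] mcE]]]].
have [A1 [mu [oA1 A1t Cmu muE]]] := mC1 t0 t0uv.
pose U0 := repr (c t0).
have U0E : pi_ (cell_type K) U0 = c t0 by rewrite /U0 /pi_ reprK.
have Vc : chart_dom U0 (c t0).
  by rewrite -U0E; apply/chart_dom_pi; exact: mx_dom_center.
have [A2 [x [oA2 A2t Cx xE]]] := cC1 _ _ _ (chartP K U0) t0 (conj t0uv Vc).
have nV : \forall s \near t0, s \in `[u, v] -> chart_dom U0 (c s).
  have /subspace_continuousP/(_ t0 t0uv) := ccont.
  move=> /(_ (chart_dom U0)); apply.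
  by apply: open_nbhs_nbhs; split => //; exact: open_chart_dom.
have nA : \forall s \near t0, A1 s /\ A2 s /\ (s \in `[u, v] -> chart_dom U0 (c s)).
  apply: filterI; first exact: open_nbhs_nbhs.
  by apply: filterI => //; exact: open_nbhs_nbhs.
have [e /= e0 eA] := (nbhs_ballP _ _).1 nA.
have CU : Ck 1 A2 (fun s => val (sect U0 (x s)) : 'M[R]_n) by exact: Ck_sect.
have x0 : unilower_of (x t0) = 1%:M.
  have <- : chart_map U0 (c t0) = x t0 by apply: xE.
  by rewrite -U0E chart_map_center unilower_of1.
have UE s : ball t0 e s -> s \in `[u, v] ->
    pi_ (cell_type K) (sect U0 (x s)) = c s.
  move=> /eA[_ [A2s]] /[swap] suv /(_ suv) Vs.
  have <- : chart_map U0 (c s) = x s by apply: xE.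
  by rewrite sect_chart.
have muE' s : ball t0 e s -> s \in `[u, v] -> mu s = m s.
  by move=> /eA[A1s _] suv; rewrite -muE.
have oo s : s \in `]u, v[ -> s \in `[u, v] by exact: subset_itv_oo_cc.
exists e, mu, (fun s => sect U0 (x s)); split => //.
  split.
  - exact: ball_open.
  - by apply: Ck_sub Cmu => s /eA[].
  - by apply: Ck_sub CU => s /eA[_ []].
  - by move=> s Bs suv; rewrite muE'//; exact: mface.
  - move=> s Bs suv; rewrite muE' ?oo//.
    by have [-> _] := mcE s suv; exact: gcell.
  - by move=> s Bs suv; rewrite muE' ?oo//; have [-> _] := mcE s suv.
  - by move=> s Bs suv; rewrite UE ?oo//; have [_ ->] := mcE s suv.
move=> i j ij; have [[_ zD] _] := sect_horizontal U0 oA2 A2t Cx x0.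
have -> : frame_velocity (fun s => sect U0 (x s)) t0 = (val U0)^T *m
    'D_1 (fun s => val (sect U0 (x s)) : 'M[R]_n) t0.
  rewrite /frame_velocity; congr (_^T *m _).
  by rewrite /= x0 /orthonormalize trmx1 mulmx1 cholesky1 invmx1 !mulmx1.
exact: zD.
Qed.

(** Up to the endpoints of the piece, where the path and the path built from the
    lift agree as limits of equal points. The radius is halved so that the
    closed interval between the points lies in the domain of the lift. *)
Lemma lift_wfl K gam u v t0 e mu U : u < v -> t0 \in `[u, v] -> 0 < e ->
  {within `[u, v], continuous gam} ->
  lift_on K gam u v (ball t0 e) mu U ->
  forall s, ball t0 (e / 2) s -> s \in `[u, v] -> gam s = wfl n_ge1 (mu s) (U s).
Proof.
move=> uv /andP[]; rewrite !bnd_simp => ut tv e0 cg L.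
pose p := Num.max u (t0 - e / 2); pose q := Num.min v (t0 + e / 2).
have pq : p < q by rewrite /p /q gt_max !lt_min; apply/andP; split; apply/andP; split; lra.
have pqb s : s \in `[p, q] -> ball t0 e s /\ s \in `[u, v].
  rewrite !in_itv /= /p /q ge_max le_min => /andP[/andP[us ts] /andP[sv st]].
  split; last by rewrite us sv.
  by rewrite /ball /= ltr_norml; apply/andP; split; lra.
have pqo s : s \in `]p, q[ -> s \in `]u, v[.
  rewrite !in_itv /= /p /q gt_max lt_min => /andP[/andP[us ts] /andP[sv st]].
  by rewrite us sv.
have oo s : s \in `]p, q[ -> s \in `[p, q] by exact: subset_itv_oo_cc.
have inn s : s \in `]p, q[ -> gam s = wfl n_ge1 (mu s) (U s).
  move=> spq; have [Bs suv] := pqb s (oo s spq).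
  apply: (wflE_cell n_ge1 (lift_cell L Bs (pqo s spq))).
    exact: (lift_weight L Bs (pqo s spq)).
  exact: (lift_flag L Bs (pqo s spq)).
have cw : {within `[p, q], continuous (fun s => wfl n_ge1 (mu s) (U s))}.
  have sub : `[p, q]%classic `<=` ball t0 e by move=> s /= /pqb[].
  apply: continuous_wfl.
  - by apply: (Ck_within_continuous sub); exact: Ck_pred (lift_Ck_weight L).
  - by apply: (Ck_within_continuous sub); exact: Ck_pred (lift_Ck_frame L).
  - by move=> s /= /pqb[Bs suv]; exact: (lift_face L Bs suv).1.
have cg' : {within `[p, q], continuous gam}.
  by apply: continuous_subspaceW cg => s /= /pqb[].
have [gp gq] := wflag_endpoints pq cg' cw inn.
move=> s; rewrite /ball /= ltr_norml => /andP[h1 h2]; rewrite in_itv /= => /andP[us sv].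
have [sp|ps|->//] := ltgtP s p.
  by exfalso; move: sp; rewrite /p lt_max => /orP[]; lra.
have [sq|qs|->//] := ltgtP s q; first by apply: inn; rewrite in_itv /= ps sq.
by exfalso; move: qs; rewrite /q gt_min => /orP[]; lra.
Qed.

End LocalLift.

Section MetricBounds.
Context {R : realType} {n : nat}.
Variable f : 'rV[R]_n -> R.
Hypothesis f_adm : admissible f.
Implicit Types (mu nu : 'rV[R]_n).

Lemma simplex_cube mu : simplex mu -> cube mu.
Proof. by move=> [h _]. Qed.

Lemma truncate_cube mu i j : cube mu -> cube (truncate mu i j).
Proof. by move=> cmu l; rewrite mxE; case: ifP => _; [exact: cmu|rewrite lexx ler01]. Qed.

Lemma truncateB mu nu i j : `|truncate mu i j - truncate nu i j| <= `|mu - nu|.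
Proof.
rewrite [leLHS]/Num.Def.normr/= mx_normrE; apply: bigmax_le => // -[a l] _ /=.
rewrite !mxE; case: ifP => _; last by rewrite subrr normr0.
rewrite [leRHS]/Num.Def.normr/= mx_normrE.
apply: le_trans (le_bigmax _ _ (a, l)) => /=.
by rewrite !mxE !ord1.
Qed.

Lemma rV_norm_le mu (a : R) : 0 <= a -> (forall i, `|mu 0 i| <= a) -> `|mu| <= a.
Proof.
move=> a0 h; rewrite [leLHS]/Num.Def.normr/= mx_normrE; apply: bigmax_le => // -[k l] _ /=.
by rewrite ord1.
Qed.

(** Bounds on the coefficients f(mu_(i->j)) of the metric: f is Lipschitz and
    vanishes at 0, and truncation does not increase the norm. *)
Lemma metric_factor_bounds : exists2 k : R, 0 < k &
  (forall mu nu i j, simplex mu -> simplex nu ->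
     `|f (truncate mu i j) - f (truncate nu i j)| <= k * `|mu - nu|) /\
  (forall mu i j, simplex mu -> `|f (truncate mu i j)| <= k).
Proof.
have [k0 [_ /(_ (`|k0| + 1)) h]] := adm_lipschitz f_adm.
have kk : k0 < `|k0| + 1 by rewrite (le_lt_trans (ler_norm k0))// ltrDl.
have {}h := h kk.
exists (`|k0| + 1); first by rewrite ltr_pwDr.
have cl mu nu : cube mu -> cube nu -> `|f mu - f nu| <= (`|k0| + 1) * `|mu - nu|.
  by move=> cmu cnu; apply: (h (mu, nu)); split.
split=> [mu nu i j /simplex_cube cmu /simplex_cube cnu|mu i j /simplex_cube cmu].
  apply: le_trans (cl _ _ (truncate_cube i j cmu) (truncate_cube i j cnu)) _.
  by rewrite ler_pM2l ?ltr_pwDr// truncateB.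
have c0 : cube (0 : 'rV[R]_n) by move=> l; rewrite mxE lexx ler01.
have := cl _ _ (truncate_cube i j cmu) c0.
rewrite ((adm_eq0 f_adm c0).2 erefl) !subr0 => /le_trans; apply.
rewrite -[leRHS]mulr1 ler_pM2l ?ltr_pwDr//.
apply: rV_norm_le => // l; have /andP[h0 h1] := truncate_cube i j cmu l.
by rewrite ger0_norm.
Qed.

End MetricBounds.

(** * Perturbation of the norm of a velocity *)
Section Minkowski.
Context {R : rcfType}.

(** The triangle inequality of the Euclidean norm, together with the comparison
    of the Euclidean norm with the sum of the absolute values. *)
Lemma sqrt_sum_le_add (J : finType) (P : pred J) (a b : J -> R) :
  Num.sqrt (\sum_(i | P i) a i ^+ 2) <=
  Num.sqrt (\sum_(i | P i) b i ^+ 2) + \sum_(i | P i) `|a i - b i|.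
Proof.
set S := \sum_(i | P i) b i ^+ 2; set d := \sum_(i | P i) `|a i - b i|.
have S0 : 0 <= S by apply: sumr_ge0 => i _; exact: sqr_ge0.
have d0 : 0 <= d by apply: sumr_ge0 => i _.
have bS i : P i -> `|b i| <= Num.sqrt S.
  move=> Pi; rewrite -sqrtr_sqr ler_sqrt// /S (bigD1 i)//= lerDl.
  by apply: sumr_ge0 => j _; exact: sqr_ge0.
have cd i : P i -> `|a i - b i| <= d.
  by move=> Pi; rewrite /d (bigD1 i)//= lerDl; apply: sumr_ge0 => j _.
rewrite -[leRHS]ger0_norm ?addr_ge0 ?sqrtr_ge0// -sqrtr_sqr ler_sqrt ?sqr_ge0//.
rewrite sqrrD sqr_sqrtr//.
rewrite -addrA.
have -> : Num.sqrt S * d *+ 2 + d ^+ 2 =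
    \sum_(i | P i) (2 * Num.sqrt S * `|a i - b i| + d * `|a i - b i|).
  by rewrite big_split /= -!mulr_sumr -/d; ring.
rewrite /S -big_split /=; apply: ler_sum => i Pi.
have -> : a i ^+ 2 = b i ^+ 2 + (2 * b i * (a i - b i) + (a i - b i) ^+ 2) by ring.
rewrite lerD2l; apply: lerD.
  apply: le_trans (ler_norm _) _; rewrite !normrM [`|2|]ger0_norm//.
  by apply: ler_wpM2r => //; apply: ler_wpM2l => //; exact: bS.
rewrite -real_normK ?num_real// expr2; apply: ler_wpM2r => //; exact: cd.
Qed.

End Minkowski.

Section Perturbation.
Context {R : realType} {n : nat}.
Hypothesis n_ge1 : (1 <= n)%N.
Variable f : 'rV[R]_n -> R.
Implicit Types (K : {set 'I_n}) (mu : 'rV[R]_n).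

Definition metric_entry K mu (Z : 'M[R]_n) (i j : 'I_n) : R :=
  f (truncate mu i j) * off_block K Z i j.

(** For a fixed velocity of the lift, the norm is the Euclidean norm of the
    vector of the weight velocities and of the scaled entries of Z. *)
Lemma lifted_norm_le K K' mu nu mu' nu' (Z : 'M[R]_n) :
  lifted_norm K' f nu nu' Z <= lifted_norm K f mu mu' Z +
    (\sum_i `|nu' 0 i - mu' 0 i| + \sum_(i < n) \sum_(j < n | (i < j)%N)
      `|metric_entry K' nu Z i j - metric_entry K mu Z i j|).
Proof.
pose J := ('I_n + 'I_n * 'I_n)%type.
pose P (x : J) := if x is inr p then (p.1 < p.2)%N else true.
pose vec L (m m' : 'rV[R]_n) (x : J) : R :=
  match x with inl i => m' 0 i | inr p => metric_entry L m Z p.1 p.2 end.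
have sumE (F : J -> R) : \sum_(x | P x) F x =
    \sum_i F (inl i) + \sum_(i < n) \sum_(j < n | (i < j)%N) F (inr (i, j)).
  rewrite big_sumType /=; congr (_ + _).
  rewrite pair_big_dep /=; apply: eq_big => [[i j]//|[i j] _//].
have normE L m m' : lifted_norm L f m m' Z = Num.sqrt (\sum_(x | P x) vec L m m' x ^+ 2).
  rewrite sumE /lifted_norm; congr (Num.sqrt (_ + _)).
  by apply: eq_bigr => i _; apply: eq_bigr => j _; rewrite /= /metric_entry exprMn.
rewrite !normE; apply: le_trans (sqrt_sum_le_add P (vec K' nu nu') (vec K mu mu')) _.
by rewrite [X in _ + X <= _]sumE.
Qed.

(** The quadratic factor vanishes at x and y, so the endpoints are kept, and it is
    positive in between, where the barycenter makes all weights positive. *)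
Definition pushed_weight (eta x y : R) (mu : R -> 'rV[R]_n) (s : R) : 'rV[R]_n :=
  mu s + (eta * ((s - x) * (y - s))) *: (barycenter - mu s).

Lemma pushed_weight_coord eta x y (mu : R -> 'rV[R]_n) s i :
  pushed_weight eta x y mu s 0 i =
  mu s 0 i + eta * ((s - x) * (y - s)) * (barycenter 0 i - mu s 0 i).
Proof. by rewrite !mxE. Qed.

Lemma Ck_pushed_weight k (A : set R) eta x y (mu : R -> 'rV[R]_n) :
  open A -> Ck k A mu -> Ck k A (pushed_weight eta x y mu).
Proof.
move=> oA Cmu; apply: Ck_mx => // i j.
have Cid := Ck_id k A : Ck k A (id : R -> R).
have Ci := Ck_coord i j oA Cmu.
have C : Ck k A (fun s => mu s i j + eta * ((s - x) * (y - s)) *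
    ((barycenter : 'rV[R]_n) i j - mu s i j)).
  apply: (CkD oA Ci); apply: (CkM oA); last first.
    exact: (CkB oA (Ck_cst _ _ _) Ci).
  apply: (CkM oA (Ck_cst _ _ _)); apply: (CkM oA).
    exact: (CkB oA Cid (Ck_cst _ _ _)).
  exact: (CkB oA (Ck_cst _ _ _) Cid).
by apply: Ck_eq C => // s _; rewrite !mxE.
Qed.

Lemma derive_pushed_weight eta x y (mu : R -> 'rV[R]_n) (A : set R) s i :
  open A -> A s -> Ck 1 A mu ->
  'D_1 (pushed_weight eta x y mu) s 0 i = 'D_1 mu s 0 i +
    (eta * ((y - s) - (s - x)) * (barycenter 0 i - mu s 0 i) -
     eta * ((s - x) * (y - s)) * 'D_1 mu s 0 i).
Proof.
move=> oA As Cmu; have dmu : differentiable mu s by exact: Cmu.1.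
have dnu : differentiable (pushed_weight eta x y mu) s.
  by have [+ _] := Ck_pushed_weight eta x y oA Cmu; apply.
rewrite -!derive_coord//.
pose m (s : R) : R := mu s 0 i.
have dm : is_derive s 1 m ('D_1 m s).
  by apply: derivableP; apply: diff_derivable; exact: differentiable_mxcoord.
have -> : (fun s => pushed_weight eta x y mu s 0 i) =
    m + (cst eta * ((id - cst x) * (cst y - id))) * (cst (barycenter 0 i) - m).
  by apply/funext => r; rewrite pushed_weight_coord.
have c (a : R) : is_derive s 1 (cst a : R -> R) 0 := is_derive_cst a s 1.
have d1 := is_deriveM (is_deriveB (is_derive_id s 1) (c x)) (is_deriveB (c y) (is_derive_id s 1)).
have [_ ->] := is_deriveD dm (is_deriveM (is_deriveM (c eta) d1)
  (is_deriveB (c (barycenter 0 i)) dm)).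
rewrite /GRing.scale /= ?fctE /=; move: ('D_1 m s) => D; rewrite /m; ring.
Qed.

Lemma simplex_pushed_weight eta x y (mu : R -> 'rV[R]_n) s :
  0 < eta <= 1 -> y - x <= 1 -> x <= s <= y -> simplex (mu s) ->
  simplex (pushed_weight eta x y mu s).
Proof.
move=> /andP[e0 e1] yx1 /andP[xs sy] [m01 m1].
have [b01 b1] := simplex_barycenter (R := R) n_ge1.
set h := eta * ((s - x) * (y - s)).
have h0 : 0 <= h by rewrite /h !mulr_ge0 ?subr_ge0// ltW.
have h1 : h <= 1.
  rewrite /h -[leRHS]mulr1 ler_pM//; first exact: ltW.
    by rewrite mulr_ge0// subr_ge0.
  by rewrite -[leRHS]mulr1 ler_pM ?subr_ge0//; lra.
apply: simplexI => [i|].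
  rewrite pushed_weight_coord -/h.
  have /andP[m0 _] := m01 i; have /andP[b0 _] := b01 i.
  have -> : mu s 0 i + h * (barycenter 0 i - mu s 0 i) =
    (1 - h) * mu s 0 i + h * barycenter 0 i by ring.
  by rewrite addr_ge0// mulr_ge0// subr_ge0.
under eq_bigr do rewrite pushed_weight_coord -/h.
by rewrite big_split /= -mulr_sumr sumrB m1 b1; ring.
Qed.

Lemma open_simplex_pushed_weight eta x y (mu : R -> 'rV[R]_n) s :
  0 < eta <= 1 -> y - x <= 1 -> x < s < y -> simplex (mu s) ->
  open_simplex [set: 'I_n]%SET (pushed_weight eta x y mu s).
Proof.
move=> /andP[e0 e1] yx1 /andP[xs sy] smu; split.
  by apply: simplex_pushed_weight => //; rewrite ?e0 ?e1// !ltW.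
move=> j; rewrite finset.in_setT; split=> // _.
rewrite pushed_weight_coord; set h := eta * ((s - x) * (y - s)).
have h0 : 0 < h by rewrite /h !mulr_gt0 ?subr_gt0.
have h1 : h <= 1.
  rewrite /h -[leRHS]mulr1 ler_pM//; first exact: ltW.
    by rewrite mulr_ge0// subr_ge0 ltW.
  by rewrite -[leRHS]mulr1 ler_pM ?subr_ge0 ?ltW//; lra.
have -> : mu s 0 j + h * (barycenter 0 j - mu s 0 j) =
    (1 - h) * mu s 0 j + h * barycenter 0 j by ring.
rewrite ltr_wpDl//; last by rewrite mulr_gt0// barycenter_gt0.
have /andP[m0 _] := smu.1 j.
by rewrite mulr_ge0// subr_ge0.
Qed.

Lemma pushed_weight_endpoints eta x y (mu : R -> 'rV[R]_n) :
  pushed_weight eta x y mu x = mu x /\ pushed_weight eta x y mu y = mu y.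
Proof.
by split; rewrite /pushed_weight subrr ?(mul0r, mulr0) scale0r addr0.
Qed.

End Perturbation.

(** * Pushing a path into the open cell *)
Section PushedPath.
Context {R : realType} {n : nat}.
Hypothesis n_ge1 : (1 <= n)%N.
Variable f : 'rV[R]_n -> R.
Implicit Types (K : {set 'I_n}).

Lemma C1_flag_path_frame (I : seq nat) (A : set R) (x y : R) (U : R -> Ogrp R n) :
  open A -> `[x, y]%classic `<=` A -> Ck 1 A (fun s => val (U s) : 'M[R]_n) ->
  C1_flag_path x y (fun s => pi_ I (U s)).
Proof.
move=> oA BA CU; split.
  move=> s; apply: (@continuous_comp (subspace `[x, y]) _ _ U (pi_ I)).
    apply: set_type_continuous.
    have C0 := Ck_pred CU.
    exact: (@Ck_within_continuous R _ A _ _ BA C0 s).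
  exact: pi_continuous.
move=> d V phi cV s [sxy Vs].
have [A1 [k [oA1 A1s sk kE]]] := chart_smooth cV (Vs : (pi_ I @^-1` V) (U s)).
have oAA := open_setI_preimage oA oA1 (Ck_pred CU).
exists (A `&` (fun s => val (U s) : 'M[R]_n) @^-1` A1), (k \o (fun s => val (U s))).
split.
- exact: oAA.
- by split=> //; exact: BA.
- apply: (@Ck1_comp R R _ n n _ A1).
  + exact: oAA.
  + by apply: Ck_sub CU => r [].
  + exact: sk.
  + by move=> r [].
- by move=> r [rxy Vr] [_ A1r] /=; exact: kE.
Qed.

Section Push.
Variables (K : {set 'I_n}) (gam : R -> wflag R n) (u v x y eta : R) (A : set R).
Variables (mu : R -> 'rV[R]_n) (U : R -> Ogrp R n).
Hypothesis L : lift_on K gam u v A mu U.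
Hypothesis xy : x < y.
Hypothesis xyA : forall s, s \in `[x, y] -> A s /\ s \in `[u, v].
Hypothesis yx1 : y - x <= 1.
Hypothesis eta01 : 0 < eta <= 1.

Let nu := pushed_weight eta x y mu.

Definition pushed_path (s : R) : wflag R n := wfl n_ge1 (nu s) (U s).

Let xyoo s : s \in `]x, y[ -> s \in `[x, y].
Proof. exact: subset_itv_oo_cc. Qed.

Let smu s : s \in `[x, y] -> simplex (mu s).
Proof. by move=> /xyA[As suv]; have [] := lift_face L As suv. Qed.

Let snu s : s \in `[x, y] -> simplex (nu s).
Proof.
move=> sxy; apply: simplex_pushed_weight => //; exact: smu.
Qed.

Let onu s : s \in `]x, y[ -> open_simplex [set: 'I_n]%SET (nu s).
Proof.
move=> sxy; apply: open_simplex_pushed_weight => //; exact/smu/xyoo.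
Qed.

Let weight_pushed s : s \in `]x, y[ -> weight (pushed_path s) = nu s.
Proof. by move=> /xyoo sxy; rewrite weight_wfl//; exact: snu. Qed.

Let flag_pushed s : s \in `]x, y[ ->
  wf_flag (cell_type [set: 'I_n]%SET) (pushed_path s) = pi_ _ (U s).
Proof. by move=> sxy; apply: wf_flag_wfl; exact: onu. Qed.

Lemma pushed_closure_path : closure_path [set: 'I_n]%SET x y pushed_path [:: y].
Proof.
have BA : `[x, y]%classic `<=` A by move=> s /= /xyA[].
have oA := lift_open L.
have Cnu : Ck 1 A nu := Ck_pushed_weight eta x y oA (lift_Ck_weight L).
split.
- apply: continuous_wfl => //.
    exact: (Ck_within_continuous BA (Ck_pred Cnu)).
  exact: (Ck_within_continuous BA (Ck_pred (lift_Ck_frame L))).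
- exact: itv_partition1.
move=> uv; rewrite /= inE => /eqP -> /=; split.
  by move=> s sxy; rewrite /cell /= weight_pushed//; exact: onu.
exists nu, (fun s => pi_ _ (U s)); split; last first.
  by move=> s sxy; rewrite weight_pushed// flag_pushed.
split.
- by move=> s sxy; split; [exact: snu|move=> j; rewrite finset.in_setT].
- by move=> s sxy; exists A, nu; split => //; exact: BA.
- exact: (C1_flag_path_frame _ oA BA (lift_Ck_frame L)).
Qed.

Lemma near_itv_oo (a c s : R) : s \in `]a, c[ -> \forall r \near s, r \in `]a, c[.
Proof.
move=> sac; have : open `]a, c[%classic by exact: itv_open.
by move=> o; have := open_nbhs_nbhs (conj o (sac : `]a, c[%classic s)).
Qed.

Lemma speed_pushed_path s : s \in `]x, y[ ->
  speed f [set: 'I_n]%SET pushed_path s =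
  lifted_norm [set: 'I_n]%SET f (nu s) ('D_1 nu s) (frame_velocity U s).
Proof.
move=> sxy; have [As _] := xyA (xyoo sxy).
apply: (speedE _ (lift_open L) As (lift_Ck_frame L)).
- have := near_itv_oo sxy; apply: (@filterS _ _ (nbhs_filter s)) => r.
  exact: weight_pushed.
- have := near_itv_oo sxy; apply: (@filterS _ _ (nbhs_filter s)) => r.
  exact: flag_pushed.
- exact: onu.
Qed.

End Push.

Lemma speed_lift K (gam : R -> wflag R n) u v A mu U s :
  lift_on K gam u v A mu U -> A s -> s \in `]u, v[ ->
  speed f K gam s = lifted_norm K f (mu s) ('D_1 mu s) (frame_velocity U s).
Proof.
move=> L As suv; apply: (speedE _ (lift_open L) As (lift_Ck_frame L)).
- have := near_itv_oo suv; have nA : \forall r \near s, A r.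
    by apply: open_nbhs_nbhs; split => //; exact: lift_open L.
  apply: filterS2 nA => r Ar ruv; exact: (lift_weight L).
- have := near_itv_oo suv; have nA : \forall r \near s, A r.
    by apply: open_nbhs_nbhs; split => //; exact: lift_open L.
  apply: filterS2 nA => r Ar ruv; exact: (lift_flag L).
- exact: (lift_cell L).
Qed.

Lemma Ck_frame_velocity (A : set R) (U : R -> Ogrp R n) : open A ->
  Ck 1 A (fun s => val (U s) : 'M[R]_n) -> Ck 0 A (frame_velocity U).
Proof.
move=> oA CU; apply: (Ck_mulmx oA); last exact: CU.2.
by apply: (Ck_trmx oA); exact: Ck_pred CU.
Qed.

Lemma near_norm_le (A : set R) (h : R -> R) t0 : A t0 -> Ck 0 A h ->
  forall e, 0 < e -> \forall s \near t0, `|h s| <= `|h t0| + e.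
Proof.
move=> At Ch e e0; have /cvgrPdist_le/(_ e e0) := Ch t0 At.
apply: (@filterS _ _ (nbhs_filter t0)) => s hs.
have -> : h s = h t0 - (h t0 - h s) by ring.
apply: le_trans (ler_normB _ _) _.
by rewrite lerD2l.
Qed.

Hypothesis f_adm : admissible f.

Lemma norm_barycenterB (mu : 'rV[R]_n) i : simplex mu ->
  `|barycenter 0 i - mu 0 i| <= 1.
Proof.
move=> [m01 _]; have [b01 _] := simplex_barycenter (R := R) n_ge1.
have /andP[b0 b1] := b01 i; have /andP[m0 m1] := m01 i.
by rewrite ler_norml; apply/andP; split; lra.
Qed.

(** The weight velocities change by at most eta (1 + M). The coefficient of an
    entry outside the blocks of the cell of K changes by at most k eta, and an
    entry inside them, new in the norm, contributes at most k c. *)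
Lemma lifted_norm_pushed (k M c eta x y : R) K (mu : R -> 'rV[R]_n) (A : set R) s
    (Z : 'M[R]_n) :
  (forall mu nu i j, simplex mu -> simplex nu ->
     `|f (truncate mu i j) - f (truncate nu i j)| <= k * `|mu - nu|) ->
  (forall mu i j, simplex mu -> `|f (truncate mu i j)| <= k) ->
  0 < k -> 0 <= M -> 0 <= c -> 0 < eta <= 1 -> y - x <= 1 -> x < s < y ->
  open A -> A s -> Ck 1 A mu -> simplex (mu s) ->
  (forall i, `|'D_1 mu s 0 i| <= M) -> (forall i j, `|Z i j| <= M) ->
  (forall i j, same_block (cell_type K) i j -> `|Z i j| <= c) ->
  lifted_norm [set: 'I_n]%SET f (pushed_weight eta x y mu s)
    ('D_1 (pushed_weight eta x y mu) s) Z <=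
  lifted_norm K f (mu s) ('D_1 mu s) Z +
    (n%:R * (eta * (1 + M)) + n%:R * (n%:R * (k * eta * M + k * c))).
Proof.
move=> lip bnd k0 M0 c0 /andP[e0 e1] yx1 /andP[xs sy] oA As Cmu smu dM ZM Zc.
apply: le_trans (lifted_norm_le f K _ (mu s) _ ('D_1 mu s) _ _) _.
rewrite lerD2l; set nu := pushed_weight eta x y mu.
have snu : simplex (nu s).
  by apply: simplex_pushed_weight => //; rewrite ?e0 ?e1// !ltW.
have h0 : 0 <= (s - x) * (y - s) by rewrite mulr_ge0// subr_ge0 ltW.
have h1 : (s - x) * (y - s) <= 1.
  by rewrite -[leRHS]mulr1 ler_pM ?subr_ge0 ?ltW//; lra.
have sle (F : 'I_n -> R) C : (forall i, F i <= C) -> \sum_i F i <= n%:R * C.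
  move=> FC; apply: le_trans (ler_sum _ (fun i _ => FC i)) _.
  by rewrite sumr_const card_ord mulr_natl.
apply: lerD.
  apply: (sle) => i; rewrite (derive_pushed_weight _ _ _ _ oA As Cmu).
  rewrite addrAC subrr add0r.
  apply: le_trans (ler_normB _ _) _.
  rewrite -mulrA -mulrA !normrM (gtr0_norm e0) -mulrDr ler_pM2l//.
  apply: lerD.
    rewrite -[leRHS]mulr1 ler_pM//; last exact: norm_barycenterB.
    by rewrite ler_norml; apply/andP; split; lra.
  rewrite -[leRHS]mul1r ler_pM// ?mulr_ge0// -normrM.
  by rewrite ger0_norm.
have nud : `|nu s - mu s| <= eta.
  apply: rV_norm_le; first exact: ltW.
  move=> i; rewrite [nu s - mu s](_ : _ = (eta * ((s - x) * (y - s))) *: (barycenter - mu s)).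
    rewrite !mxE normrM -[leRHS]mulr1 ler_pM//; last first.
      by have := norm_barycenterB i smu; rewrite !mxE.
    rewrite normrM (gtr0_norm e0) -[leRHS]mulr1 ler_pM2l// ger0_norm//.
  by rewrite /nu /pushed_weight addrAC subrr add0r.
apply: (sle) => i; rewrite big_mkcond /=.
apply: (sle) => j.
have kk : 0 <= k * eta * M by rewrite !mulr_ge0// ltW.
have kc : 0 <= k * c by rewrite mulr_ge0// ltW.
case: ifPn => ij; last exact: addr_ge0.
rewrite /metric_entry !mxE same_block_setT (_ : (i == j) = false); last first.
  by apply/negbTE; rewrite -val_eqE ltn_eqF.
case: ifPn => bij.
  rewrite mulr0 subr0 normrM; apply: le_trans (_ : k * c <= _); last by rewrite lerDr.
  by apply: ler_pM => //; [exact: bnd|exact: Zc].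
rewrite -mulrBl normrM; apply: le_trans (_ : k * eta * M <= _); last by rewrite lerDl.
apply: ler_pM => //; apply: le_trans (lip _ _ _ _ snu smu) _.
by rewrite ler_pM2l.
Qed.

Lemma in_ball_itv (t d x y s : R) : ball t d x -> ball t d y -> s \in `[x, y] ->
  ball t d s.
Proof.
rewrite /ball /= !ltr_norml in_itv /= => /andP[? ?] /andP[? ?] /andP[? ?].
by apply/andP; split; lra.
Qed.

Lemma in_itv_cc (u v x y s : R) : x \in `[u, v] -> y \in `[u, v] ->
  s \in `[x, y] -> s \in `[u, v].
Proof.
rewrite !in_itv /= => /andP[ux _] /andP[_ yv] /andP[xs sy].
by rewrite (le_trans ux xs) (le_trans sy yv).
Qed.

Lemma in_itv_oo (u v x y s : R) : x \in `[u, v] -> y \in `[u, v] ->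
  s \in `]x, y[ -> s \in `]u, v[.
Proof.
rewrite !in_itv /= => /andP[ux _] /andP[_ yv] /andP[xs sy].
by rewrite (le_lt_trans ux xs) (lt_le_trans sy yv).
Qed.

Lemma norm_le_sum (J : finType) (F : J -> R) j : `|F j| <= \sum_i `|F i|.
Proof. by rewrite (bigD1 j)//= lerDl; apply: sumr_ge0. Qed.

(** All velocities of a C^1 lift are bounded near t0, and those that vanish at
    t0 are small near t0. *)
Lemma near_velocity_bounds K (gam : R -> wflag R n) u v t0 e c
    (mu : R -> 'rV[R]_n) (U : R -> Ogrp R n) :
  0 < e -> 0 < c -> lift_on K gam u v (ball t0 e) mu U ->
  (forall i j, same_block (cell_type K) i j -> frame_velocity U t0 i j = 0) ->
  exists2 M, 0 <= M & \forall s \near t0, [/\ forall i, `|'D_1 mu s 0 i| <= M,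
    forall p : 'I_n * 'I_n, `|frame_velocity U s p.1 p.2| <= M &
    forall p : 'I_n * 'I_n, same_block (cell_type K) p.1 p.2 ->
      `|frame_velocity U s p.1 p.2| <= c].
Proof.
move=> e0 c0 L z0; have oB := lift_open L.
have Bt : ball t0 e t0 by exact: ballxx.
have Cd i : Ck 0 (ball t0 e) (fun s => 'D_1 mu s 0 i).
  have CD : Ck 0 (ball t0 e) ('D_1 mu) := (lift_Ck_weight L).2 1.
  exact: (Ck_coord 0 i oB CD).
have CZ i j : Ck 0 (ball t0 e) (fun s => frame_velocity U s i j).
  exact: (Ck_coord i j oB (Ck_frame_velocity oB (lift_Ck_frame L))).
pose S1 : R := \sum_i `|'D_1 mu t0 0 i|.
pose S2 : R := \sum_(p : 'I_n * 'I_n) `|frame_velocity U t0 p.1 p.2|.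
have S10 : 0 <= S1 by apply: sumr_ge0.
have S20 : 0 <= S2 by apply: sumr_ge0.
exists (S1 + S2 + 1); first by rewrite !addr_ge0.
have n1 : \forall s \near t0, forall i, `|'D_1 mu s 0 i| <= S1 + S2 + 1.
  apply: (@filter_forall _ _ _ (nbhs t0) (nbhs_filter t0)) => i.
  have := near_norm_le Bt (Cd i) ltr01.
  apply: (@filterS _ _ (nbhs_filter t0)) => s /le_trans; apply; rewrite lerD2r.
  by apply: ler_wpDr => //; exact: (norm_le_sum (fun i => 'D_1 mu t0 0 i)).
have n2 : \forall s \near t0, forall p : 'I_n * 'I_n,
    `|frame_velocity U s p.1 p.2| <= S1 + S2 + 1.
  apply: (@filter_forall _ _ _ (nbhs t0) (nbhs_filter t0)) => p.
  have := near_norm_le Bt (CZ p.1 p.2) ltr01.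
  apply: (@filterS _ _ (nbhs_filter t0)) => s /le_trans; apply; rewrite lerD2r.
  apply: ler_wpDl => //.
  exact: (norm_le_sum (fun p : 'I_n * 'I_n => frame_velocity U t0 p.1 p.2)).
have n3 : \forall s \near t0, forall p : 'I_n * 'I_n,
    same_block (cell_type K) p.1 p.2 -> `|frame_velocity U s p.1 p.2| <= c.
  apply: (@filter_forall _ _ _ (nbhs t0) (nbhs_filter t0)) => -[i j] /=.
  have := near_norm_le Bt (CZ i j) c0.
  apply: (@filterS _ _ (nbhs_filter t0)) => s /le_trans h ij; apply: h.
  by rewrite z0// normr0 add0r.
by near=> s; split; near: s.
Unshelve. all: by end_near. Qed.

(** Both the push towards the barycenter and the velocity inside the blocks can be
    made small near t0, and they are the only sources of additional speed. *)
Lemma approx_short K (gam : R -> wflag R n) u v t0 eps : u < v -> 0 < eps ->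
  t0 \in `[u, v] -> {within `[u, v], continuous gam} -> C1_piece K u v gam ->
  exists2 delta, 0 < delta & forall x y, x < y ->
    ball t0 delta x -> ball t0 delta y -> x \in `[u, v] -> y \in `[u, v] ->
    exists g, [/\ closure_path [set: 'I_n]%SET x y g [:: y], g x = gam x, g y = gam y &
      forall s, s \in `]x, y[ ->
        speed f [set: 'I_n]%SET g s <= speed f K gam s + eps].
Proof.
move=> uv eps0 t0uv cg Cg.
have [e [mu [U [e0 L z0]]]] := exists_lift t0uv Cg.
have gE := lift_wfl n_ge1 uv t0uv e0 cg L.
have [k k0 [lip bnd]] := metric_factor_bounds f_adm.
pose N : R := n%:R.
have N0 : 0 < N by rewrite ltr0n.
(* A bound on the entries of the frame velocity inside the blocks, which the
   metric of the open cell sees and that of the cell of K does not: they cost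
   at most N ^ 2 k c = eps / 2. *)
pose c : R := eps / 2 / (N * (N * k)).
have c0 : 0 < c by rewrite /c !divr_gt0// !mulr_gt0.
have [M M0 nM] := near_velocity_bounds e0 c0 L z0.
pose q : R := N * (1 + M) + N * (N * (k * M)).
have q0 : 0 < q.
  rewrite /q ltr_pwDl//; first by rewrite mulr_gt0// ltr_pwDl.
  by rewrite !mulr_ge0// ltW.
(* The push costs at most eta q, which has to be at most eps / 2. *)
pose eta : R := Num.min 1 (eps / 2 / q).
have eta0 : 0 < eta by rewrite /eta lt_min ltr01 !divr_gt0.
have eta1 : eta <= 1 by rewrite /eta ge_min lexx.
have etaq : eta * q <= eps / 2.
  by rewrite -ler_pdivlMr// /eta ge_min lexx orbT.
have [d /= d0 dE] := (nbhs_ballP _ _).1 nM.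
pose delta := Num.min d (Num.min (e / 2) (1 / 2)).
have delta0 : 0 < delta by rewrite /delta !lt_min d0 !divr_gt0.
have dd r : ball t0 delta r -> [/\ ball t0 d r, ball t0 (e / 2) r & ball t0 (1 / 2) r].
  by rewrite /ball /= /delta !lt_min => /andP[-> /andP[-> ->]].
exists delta => // x y xy Bx By xuv yuv.
have xyA s : s \in `[x, y] -> ball t0 e s /\ s \in `[u, v].
  move=> sxy; split; last exact: in_itv_cc sxy.
  have [_ B _] := dd _ (in_ball_itv Bx By sxy); apply: le_ball B.
  by rewrite ler_pdivrMr// ler_pMr// ler1n.
have yx1 : y - x <= 1.
  have [_ _] := dd _ Bx; have [_ _] := dd _ By; clear.
  by rewrite /ball /= !ltr_norml => /andP[? ?] /andP[? ?]; lra.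
have e01 : 0 < eta <= 1 by rewrite eta0.
have [px py] := pushed_weight_endpoints eta x y mu.
exists (pushed_path x y eta mu U); split.
- exact: (pushed_closure_path L).
- rewrite /pushed_path px gE//; by have [_] := dd _ Bx.
- rewrite /pushed_path py gE//; by have [_] := dd _ By.
move=> s sxy.
have sxy' : s \in `[x, y] by exact: subset_itv_oo_cc.
have suv : s \in `]u, v[ by exact: in_itv_oo sxy.
have [Bs suv'] := xyA s sxy'.
have [Bd _ _] := dd _ (in_ball_itv Bx By sxy').
have [dM ZM Zc] := dE s Bd.
rewrite (speed_pushed_path L xyA yx1 e01 sxy) (speed_lift L Bs suv).
have xsy : x < s < y by move: sxy; rewrite in_itv.
have := @lifted_norm_pushed k M c eta x y K mu (ball t0 e) s (frame_velocity U s)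
  lip bnd k0 M0 (ltW c0) e01 yx1 xsy (lift_open L) Bs (lift_Ck_weight L)
  (lift_face L Bs suv').1 dM (fun i j => ZM (i, j)) (fun i j => Zc (i, j)).
move=> /le_trans; apply; rewrite lerD2l -/N.
have cE : N * (N * (k * c)) = eps / 2.
  by rewrite mulrA mulrA -(mulrA N) /c mulrC divfK// gt_eqF// !mulr_gt0.
have -> : N * (eta * (1 + M)) + N * (N * (k * eta * M + k * c)) =
    eta * q + N * (N * (k * c)) by rewrite /q; ring.
by rewrite cE [leRHS]splitr lerD2r.
Qed.

End PushedPath.

(** * Integrals over subdivided intervals *)
Section Integrals.
Context {R : realType}.
Implicit Types (h : R -> R) (u v w : R).

Definition itv_integral h u v : \bar R :=
  (\int[lebesgue_measure]_(t in `[u, v]) (h t)%:E)%E.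

(** A function with known measurability on the open interval only is enough: the
    endpoints are negligible. *)
Lemma itv_integral_oo h u v : measurable_fun `]u, v[ h ->
  itv_integral h u v = (\int[lebesgue_measure]_(t in `]u, v[) (h t)%:E)%E.
Proof.
move=> mh; rewrite /itv_integral (@integral_itv_bndoo R u v (EFin \o h) true false)//.
exact/measurable_EFinP.
Qed.

Lemma eq_itv_integral h1 h2 u v : measurable_fun `]u, v[ h1 ->
  measurable_fun `]u, v[ h2 -> {in `]u, v[, h1 =1 h2} ->
  itv_integral h1 u v = itv_integral h2 u v.
Proof.
by move=> m1 m2 e; exact: (@eq_integral_itv_bounded R u v h2 h1 true false).
Qed.

Lemma itv_integralD h u v w : (forall s, 0 <= h s) -> u <= v -> v <= w ->
  measurable_fun `]u, v[ h -> measurable_fun `]v, w[ h ->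
  measurable_fun `]u, w[ h /\
  itv_integral h u w = (itv_integral h u v + itv_integral h v w)%E.
Proof.
move=> h0 uv vw m1 m2.
have m1' : measurable_fun `[u, v] h := measurable_fun_itv_cc m1.
have m2' : measurable_fun `]v, w] h := measurable_fun_itv_oc m2.
have E : `[u, w]%classic = `[u, v] `|` `]v, w].
  by rewrite -itv_bndbnd_setU ?bnd_simp.
have m3 : measurable_fun `[u, w] h.
  by rewrite E; apply/measurable_funU => //; split.
split; first by apply: measurable_funS m3 => //; exact: subset_itv_oo_cc.
rewrite /itv_integral E ge0_integral_setU//=.
- congr (_ + _)%E.
  rewrite (@integral_itv_bndoo R v w (EFin \o h) false false); last exact/measurable_EFinP.
  rewrite (@integral_itv_bndoo R v w (EFin \o h) true false)//; exact/measurable_EFinP.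
- by rewrite -E; exact/measurable_EFinP.
- by move=> x _; rewrite lee_fin.
- apply/disj_setPS => x [] /=; rewrite !in_itv /= => /andP[_ xv] /andP[vx _].
  by move: vx; rewrite ltNge xv.
Qed.

Lemma le_itv_integral_add h1 h2 u v (e : R) : u <= v -> 0 <= e ->
  (forall s, 0 <= h1 s) -> (forall s, 0 <= h2 s) ->
  measurable_fun `]u, v[ h1 -> measurable_fun `]u, v[ h2 ->
  {in `]u, v[, forall s, h1 s <= h2 s + e} ->
  (itv_integral h1 u v <= itv_integral h2 u v + (e * (v - u))%:E)%E.
Proof.
move=> uv e0 h10 h20 m1 m2 h12; rewrite !itv_integral_oo//.
have mD : measurable (`]u, v[%classic : set R) by exact: measurable_itv.
have h1e x : (`]u, v[)%classic x -> (0 <= (h1 x)%:E)%E by rewrite lee_fin.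
have h2e x : (`]u, v[)%classic x -> (0 <= (h2 x)%:E)%E by rewrite lee_fin.
have ce x : (`]u, v[)%classic x -> (0 <= cst e%:E x)%E by rewrite lee_fin.
have mh1 : measurable_fun `]u, v[ (fun t => (h1 t)%:E) by exact/measurable_EFinP.
have mh2 : measurable_fun `]u, v[ (fun t => (h2 t)%:E) by exact/measurable_EFinP.
have mc : measurable_fun `]u, v[ (cst e%:E : R -> \bar R) by exact: measurable_cst.
have m3 : measurable_fun `]u, v[ (fun t => (h2 t)%:E + cst e%:E t)%E.
  exact: emeasurable_funD.
apply: (@le_trans _ _ (\int[lebesgue_measure]_(t in `]u, v[) ((h2 t)%:E + cst e%:E t))%E).
  refine (ge0_le_integral lebesgue_measure mD h1e mh1 m3 _) => x xuv.
  by rewrite -EFinD lee_fin; exact: h12.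
rewrite (ge0_integralD lebesgue_measure mD h2e mh2 ce)//.
rewrite leeD2l// integral_cst//= lebesgue_measure_itv /= lte_fin.
case: ltP => [_|vu]; first by rewrite -EFinB -EFinM.
by rewrite mule0 lee_fin mulr_ge0// subr_ge0.
Qed.

Lemma itv_integral_partition h (a b : R) (s : seq R) : (forall r, 0 <= h r) ->
  itv_partition a b s ->
  (forall uv, uv \in zip (a :: s) s -> measurable_fun `]uv.1, uv.2[ h) ->
  measurable_fun `]a, b[ h /\
  itv_integral h a b = (\sum_(uv <- zip (a :: s) s) itv_integral h uv.1 uv.2)%E.
Proof.
move=> h0; elim: s a => [|c s IH] a.
  move=> /itv_partition_nil -> _; split.
    by rewrite set_itvoo0; exact: measurable_fun_set0.
  by rewrite big_nil /itv_integral set_itv1 integral_set1.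
move=> p m; have [/= /andP[ac _] _] := p.
have pc := itv_partition_cons p.
have cb := itv_partition_le pc.
have [|mcb Ecb] := IH c pc.
  by move=> uv uvs; apply: m; rewrite /= inE uvs orbT.
have mac : measurable_fun `]a, c[ h by apply: (m (a, c)); rewrite /= mem_head.
have [mab Eab] := itv_integralD h0 (ltW ac) cb mac mcb.
by split=> //; rewrite Eab /= big_cons -Ecb.
Qed.

Lemma zip_partition_bounds (a b : R) (s : seq R) uv : itv_partition a b s ->
  uv \in zip (a :: s) s -> [/\ a <= uv.1, uv.1 < uv.2 & uv.2 <= b].
Proof.
elim: s a => [|c s IH] a //= p.
have [/= /andP[ac _] _] := p; have pc := itv_partition_cons p.
rewrite inE => /predU1P[->|/(IH c pc)[h1 h2 h3]] /=.
  by split=> //; exact: itv_partition_le pc.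
by split=> //; exact: le_trans (ltW ac) h1.
Qed.

Lemma zip_partition_cat (a b : R) (s t : seq R) : itv_partition a b s ->
  zip (a :: s ++ t) (s ++ t) = zip (a :: s) s ++ zip (b :: t) t.
Proof.
elim: s a => [|d s IH] a p /=; first by rewrite (itv_partition_nil p).
by congr (_ :: _); exact: IH (itv_partition_cons p).
Qed.

Lemma mem_zip_partition_cat (a b : R) (s t : seq R) uv : itv_partition a b s ->
  (uv \in zip (a :: s ++ t) (s ++ t)) =
  (uv \in zip (a :: s) s) || (uv \in zip (b :: t) t).
Proof.
move=> p; rewrite (zip_partition_cat t p).
elim: (zip (a :: s) s) => //= x l IH; rewrite !inE IH; exact: orbA.
Qed.

Lemma zip_partition_cover (a b : R) (s : seq R) r : itv_partition a b s ->
  r \in `]a, b[ -> r \notin s -> exists2 uv, uv \in zip (a :: s) s & r \in `]uv.1, uv.2[.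
Proof.
elim: s a => [|c s IH] a p.
  by rewrite (itv_partition_nil p) in_itv /= => /andP[/lt_trans h /h]; rewrite ltxx.
rewrite in_itv /= inE negb_or => /andP[ar rb] /andP[rc rs].
have pc := itv_partition_cons p.
have [rc'|cr|e] := ltgtP r c; last by rewrite e eqxx in rc.
  by exists (a, c); rewrite ?mem_head//= in_itv /= ar rc'.
have [|//|uv uvs ruv] := IH c pc _ _; first by rewrite in_itv /= cr.
by exists uv => //; rewrite inE uvs orbT.
Qed.

Lemma exists_notin_itv u v (s : seq R) : u < v ->
  exists2 r, r \in `]u, v[ & r \notin s.
Proof.
move=> uv; suff [u' [v' [uu uv' vv ns]]] : exists u' v', [/\ u <= u', u' < v', v' <= v &
    forall r, r \in `]u', v'[ -> r \notin s].
  exists ((u' + v') / 2); last by apply: ns; rewrite in_itv /=; apply/andP; split; lra.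
  by rewrite in_itv /=; apply/andP; split; lra.
elim: s => [|x s [u' [v' [uu uv' vv ns]]]]; first by exists u, v.
have [xin|xout] := boolP (x \in `]u', v'[).
  move: (xin); rewrite in_itv /= => /andP[ux xv].
  exists u', x; split=> //; first by apply: ltW; exact: lt_le_trans xv vv.
  move=> r; rewrite in_itv /= => /andP[ur rx].
  by rewrite inE negb_or (lt_eqF rx) ns// in_itv /= ur (lt_trans rx).
exists u', v'; split=> // r rin; rewrite inE negb_or ns// andbT.
by apply: contraNneq xout => <-.
Qed.

End Integrals.

(** * Measurability of the speed and additivity of the length *)
Section SpeedMeasurable.
Context {R : realType} {n : nat}.
Hypothesis n_ge1 : (1 <= n)%N.
Variable f : 'rV[R]_n -> R.
Hypothesis f_adm : admissible f.
Implicit Types (K : {set 'I_n}) (gam : R -> wflag R n).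

Lemma speed_ge0 K gam t : 0 <= speed f K gam t.
Proof. exact: sqrtr_ge0. Qed.

(** Near an inner time of a piece the speed is the norm computed from a C^1 lift,
    and the coefficients of the metric are continuous. *)
Lemma speed_continuous K gam u v : C1_piece K u v gam ->
  {in `]u, v[, continuous (speed f K gam)}.
Proof.
move=> Cg t0 t0uv.
have t0uv' : t0 \in `[u, v] by exact: subset_itv_oo_cc.
have [e [mu [U [e0 L _]]]] := exists_lift t0uv' Cg.
have [k k0 [lip _]] := metric_factor_bounds f_adm.
have oB := lift_open L; have Bt : ball t0 e t0 by exact: ballxx.
have nB : \forall s \near t0, ball t0 e s /\ s \in `]u, v[.
  apply: filterI; last exact: near_itv_oo.
  by apply: open_nbhs_nbhs; split.
have E : {near t0, (fun s => lifted_norm K f (mu s) ('D_1 mu s) (frame_velocity U s))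
    =1 speed f K gam}.
  apply: (@filterS _ _ (nbhs_filter t0) _ _ _ nB) => s [Bs suv].
  by rewrite (speed_lift f L Bs suv).
have CD : Ck 0 (ball t0 e) ('D_1 mu) := (lift_Ck_weight L).2 1.
have CZ := Ck_frame_velocity oB (lift_Ck_frame L).
have cft i j : {for t0, continuous (fun s => f (truncate (mu s) i j))}.
  apply/cvgrPdist_le => eps eps0.
  have cm : {for t0, continuous mu} := Ck_pred (lift_Ck_weight L) t0 Bt.
  have /cvgrPdist_le/(_ (eps / k)) := cm.
  rewrite divr_gt0// => /(_ isT) nm.
  have smu s : ball t0 e s -> s \in `]u, v[ -> simplex (mu s).
    by move=> Bs suv; exact: (lift_cell L Bs suv).1.
  apply: (@filterS2 _ _ (nbhs_filter t0) _ _ _ _ nB nm) => s [Bs suv] ms.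
  apply: le_trans (lip _ _ _ _ (smu _ Bt t0uv) (smu _ Bs suv)) _.
  by rewrite mulrC -ler_pdivlMr.
have cl : {for t0, continuous (fun s => lifted_norm K f (mu s) ('D_1 mu s)
    (frame_velocity U s))}.
  apply: (@continuous_comp _ _ _ (fun s => \sum_i 'D_1 mu s 0 i ^+ 2 +
    \sum_(i < n) \sum_(j < n | (i < j)%N) f (truncate (mu s) i j) ^+ 2 *
      off_block K (frame_velocity U s) i j ^+ 2) Num.sqrt); last exact: sqrt_continuous.
  apply: cvgD.
    apply: continuous_sumr => i.
    have c : {for t0, continuous (fun s => 'D_1 mu s 0 i)} := Ck_coord 0 i oB CD t0 Bt.
    by rewrite (_ : (fun _ => _) = fun s => 'D_1 mu s 0 i * 'D_1 mu s 0 i)//; exact: cvgM.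
  apply: continuous_sumr => i; apply: continuous_sumr => j.
  apply: cvgM.
    rewrite (_ : (fun _ => _) = fun s => f (truncate (mu s) i j) * f (truncate (mu s) i j))//.
    by apply: cvgM; exact: cft.
  have c : {for t0, continuous (fun s => frame_velocity U s i j)} := Ck_coord i j oB CZ t0 Bt.
  have c' : {for t0, continuous (fun s => off_block K (frame_velocity U s) i j)}.
    have -> : (fun s => off_block K (frame_velocity U s) i j) = fun s =>
        if same_block (cell_type K) i j then 0 else frame_velocity U s i j.
      by apply/funext => s; rewrite mxE.
    by case: (same_block _ i j); [exact: cvg_cst|exact: c].
  rewrite (_ : (fun _ => _) = fun s => off_block K (frame_velocity U s) i j *
    off_block K (frame_velocity U s) i j)//.
  by apply: cvgM; exact: c'.
rewrite /prop_for /continuous_at -(nbhs_singleton E).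
apply: cvg_trans cl; exact: near_eq_cvg.
Qed.

Lemma speed_measurable K gam u v : C1_piece K u v gam ->
  measurable_fun `]u, v[ (speed f K gam).
Proof.
move=> Cg; apply: open_continuous_measurable_fun; first exact: itv_open.
by move=> s; rewrite inE => suv; exact: (speed_continuous Cg).
Qed.

Lemma speed_ext K (g1 g2 : R -> wflag R n) u v t : {in `]u, v[, g1 =1 g2} -> t \in `]u, v[ ->
  speed f K g1 t = speed f K g2 t.
Proof.
move=> g12 tuv.
have ng : \forall s \near t, g1 s = g2 s.
  have := near_itv_oo tuv; apply: (@filterS _ _ (nbhs_filter t)) => s; exact: g12.
have e1 : derive1 (@weight R n \o g1) t = derive1 (@weight R n \o g2) t.
  rewrite !derive1E; apply: near_eq_D1.
  by apply: (@filterS _ _ (nbhs_filter t) _ _ _ ng) => s /= ->.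
have e2 : flag_velocity (@wf_flag R n (cell_type K) \o g1) t =
    flag_velocity (@wf_flag R n (cell_type K) \o g2) t.
  apply: functional_extensionality_dep => d; apply/funext => phi.
  rewrite /flag_velocity !derive1E; apply: near_eq_D1.
  by apply: (@filterS _ _ (nbhs_filter t) _ _ _ ng) => s /= ->.
by rewrite /speed e1 e2 (g12 t tuv).
Qed.

Lemma C1_piece_ext K (g1 g2 : R -> wflag R n) (u v : R) : {in `]u, v[, g1 =1 g2} ->
  C1_piece K u v g1 -> C1_piece K u v g2.
Proof.
move=> g12 [c1 [m [c [Cmc mc]]]]; split; first by move=> t tuv; rewrite -g12//; exact: c1.
by exists m, c; split=> // t tuv; rewrite -g12//; exact: mc.
Qed.

Lemma integral_speed_ext K (g1 g2 : R -> wflag R n) (u v : R) : {in `]u, v[, g1 =1 g2} ->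
  C1_piece K u v g1 -> integral_speed f K g1 u v = integral_speed f K g2 u v.
Proof.
move=> g12 C1; have C2 := C1_piece_ext g12 C1.
apply: eq_itv_integral; [exact: speed_measurable|exact: speed_measurable|].
by move=> s suv; exact: (speed_ext K g12 suv).
Qed.

(** Lengths computed with different partitions of one path can thus be compared. *)
Lemma closure_lengthE K a b gam s : closure_path K a b gam s ->
  measurable_fun `]a, b[ (speed f K gam) /\
  closure_length f K a gam s = integral_speed f K gam a b.
Proof.
move=> [_ p Cp].
have [m E] := itv_integral_partition (speed_ge0 K gam) p
  (fun uv uvs => speed_measurable (Cp uv uvs)).
by split=> //; exact: esym E.
Qed.

End SpeedMeasurable.

(** * Approximation by paths in the open cell *)
Section Approximation.
Context {R : realType} {n : nat}.
Hypothesis n_ge1 : (1 <= n)%N.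
Variable f : 'rV[R]_n -> R.
Hypothesis f_adm : admissible f.
Implicit Types (K : {set 'I_n}) (gam g : R -> wflag R n).

Lemma closure_path_cat K (g1 g2 : R -> wflag R n) a b c s1 s2 :
  closure_path K a b g1 s1 -> closure_path K b c g2 s2 -> g1 b = g2 b ->
  exists g, [/\ closure_path K a c g (s1 ++ s2), g a = g1 a, g c = g2 c &
    closure_length f K a g (s1 ++ s2) =
      (closure_length f K a g1 s1 + closure_length f K b g2 s2)%E].
Proof.
move=> [c1 p1 C1] [c2 p2 C2] gb.
have ab := itv_partition_le p1; have bc := itv_partition_le p2.
pose g t := if t <= b then g1 t else g2 t.
have gE1 t : t <= b -> g1 t = g t by rewrite /g => ->.
have gE2 t : b <= t -> g2 t = g t.
  rewrite /g le_eqVlt => /predU1P[<-|bt]; first by rewrite lexx.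
  by rewrite leNgt bt.
have e1 uv : uv \in zip (a :: s1) s1 -> {in `]uv.1, uv.2[, g1 =1 g}.
  move=> /(zip_partition_bounds p1)[_ _ ub] t; rewrite in_itv /= => /andP[_ tu].
  by apply: gE1; apply: ltW; exact: lt_le_trans tu ub.
have e2 uv : uv \in zip (b :: s2) s2 -> {in `]uv.1, uv.2[, g2 =1 g}.
  move=> /(zip_partition_bounds p2)[bu _ _] t; rewrite in_itv /= => /andP[ut _].
  by apply: gE2; apply: ltW; exact: le_lt_trans bu ut.
exists g; split.
- split.
  + have -> : `[a, c]%classic = `[a, b] `|` `[b, c].
      apply/seteqP; split => t /=; rewrite !in_itv /=.
        by move=> /andP[at_ tc]; have [tb|/ltW bt] := leP t b; [left|right]; rewrite ?at_ ?bt.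
      by move=> [/andP[-> tb]|/andP[bt ->]] /=;
        [exact: le_trans tb bc|rewrite (le_trans ab)].
    apply: withinU_continuous; [exact: itv_closed|exact: itv_closed| |].
      apply: subspace_eq_continuous c1 => t; rewrite inE /= in_itv /= => /andP[_ tb].
      exact: gE1.
    apply: subspace_eq_continuous c2 => t; rewrite inE /= in_itv /= => /andP[bt _].
    exact: gE2.
  + exact: itv_partition_cat p1 p2.
  + move=> uv; rewrite (mem_zip_partition_cat s2 _ p1) => /orP[uv1|uv2].
      exact: C1_piece_ext (e1 _ uv1) (C1 _ uv1).
    exact: C1_piece_ext (e2 _ uv2) (C2 _ uv2).
- by rewrite -gE1.
- by rewrite -gE2.
have E1 : closure_length f K a g1 s1 =
    (\sum_(uv <- zip (a :: s1) s1) integral_speed f K g uv.1 uv.2)%E.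
  apply: eq_big_seq => uv uv1.
  exact: (integral_speed_ext f_adm (e1 _ uv1) (C1 _ uv1)).
have E2 : closure_length f K b g2 s2 =
    (\sum_(uv <- zip (b :: s2) s2) integral_speed f K g uv.1 uv.2)%E.
  apply: eq_big_seq => uv uv2.
  exact: (integral_speed_ext f_adm (e2 _ uv2) (C2 _ uv2)).
by rewrite E1 E2 /closure_length (zip_partition_cat s2 p1) big_cat.
Qed.

Variable eps : R.
Hypothesis eps0 : 0 < eps.

(** An error that is proportional to y - x adds up under concatenation, so that
    the number of pieces is irrelevant. *)
Definition approximable gam (x y : R) (L : \bar R) : Prop :=
  exists g s, [/\ closure_path [set: 'I_n]%SET x y g s, g x = gam x, g y = gam y &
    (closure_length f [set: 'I_n]%SET x g s <= L + (eps * (y - x))%:E)%E].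

Lemma approximable_cat gam x y z L1 L2 : approximable gam x y L1 ->
  approximable gam y z L2 -> approximable gam x z (L1 + L2)%E.
Proof.
move=> [g1 [s1 [C1 g1x g1y l1]]] [g2 [s2 [C2 g2y g2z l2]]].
have [g [C gx gz l]] := closure_path_cat C1 C2 (etrans g1y (esym g2y)).
exists g, (s1 ++ s2); split => //; [by rewrite gx|by rewrite gz|].
rewrite l; apply: le_trans (leeD l1 l2) _.
rewrite addeACA leeD2l// -EFinD lee_fin.
by have -> : eps * (y - x) + eps * (z - y) = eps * (z - x) by ring.
Qed.

Lemma approximable_refl gam x : approximable gam x x 0.
Proof.
exists gam, [::]; split => //.
  split; [|by split|by []].
  by rewrite set_itv1; exact: continuous_subspace1.
by rewrite /closure_length big_nil subrr mulr0 addr0.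
Qed.

Lemma approximable_local K gam u v t0 : u < v -> {within `[u, v], continuous gam} ->
  C1_piece K u v gam -> t0 \in `[u, v] ->
  exists2 delta, 0 < delta & forall x y, x < y ->
    ball t0 delta x -> ball t0 delta y -> x \in `[u, v] -> y \in `[u, v] ->
    approximable gam x y (integral_speed f K gam x y).
Proof.
move=> uv cg Cg t0uv.
have [d d0 H] := approx_short n_ge1 f_adm uv eps0 t0uv cg Cg.
exists d => // x y xy Bx By xuv yuv.
have [g [Cxy gx gy gs]] := H x y xy Bx By xuv yuv.
exists g, [:: y]; split => //.
have [mg ->] := closure_lengthE f_adm Cxy.
have mk : measurable_fun `]x, y[ (speed f K gam).
  apply: measurable_funS (speed_measurable f_adm Cg) => //.
  by move=> t /=; exact: in_itv_oo.
exact: (le_itv_integral_add (ltW xy) (ltW eps0) (speed_ge0 f _ g)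
  (speed_ge0 f K gam) mg mk gs).
Qed.

(** The times y of [u, v] up to which the approximation is possible have a least
    upper bound. The local approximation around that bound extends a good
    approximation slightly beyond it, unless the bound is v. *)
Lemma approximable_piece K gam u v : u < v -> {within `[u, v], continuous gam} ->
  C1_piece K u v gam -> approximable gam u v (integral_speed f K gam u v).
Proof.
move=> uv cg Cg.
have ms x y : u <= x -> y <= v -> measurable_fun `]x, y[ (speed f K gam).
  move=> ux yv; apply: measurable_funS (speed_measurable f_adm Cg) => //.
  move=> t /=; rewrite !in_itv /= => /andP[xt ty].
  by rewrite (le_lt_trans ux)// (lt_le_trans ty).
pose S := [set y | y \in `[u, v] /\ approximable gam u y (integral_speed f K gam u y)].
have Su : S u.
  split; first by rewrite in_itv /= lexx ltW.
  rewrite /integral_speed set_itv1 integral_set1; exact: approximable_refl.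
have Sv : ubound S v by move=> y [+ _]; rewrite in_itv /= => /andP[].
have supS : has_sup S by split; [exists u|exists v].
have ub : u <= sup S by apply: ub_le_sup => //; exists v.
have sv : sup S <= v by apply: ge_sup => //; exists u.
have suv : sup S \in `[u, v] by rewrite in_itv /= ub sv.
have [d d0 H] := approximable_local uv cg Cg suv.
have [a [auv Aa] ad] := sup_adherent d0 supS.
have as_ : a <= sup S by apply: ub_le_sup => //; exists v.
pose y := Num.min v (sup S + d / 2).
have yv : y <= v by rewrite /y ge_min lexx.
have sy : sup S <= y by rewrite /y le_min sv lerDl divr_ge0// ltW.
move: (auv); rewrite in_itv /= => /andP[ua av].
have yuv : y \in `[u, v] by rewrite in_itv /= yv (le_trans ub).
have Sy : S y.
  have [ay|ya|<-//] := ltgtP a y; last by move: ya; rewrite ltNge (le_trans as_ sy).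
  split=> //.
  have [_ E] := itv_integralD (speed_ge0 f K gam) ua (ltW ay) (ms u a (lexx u) av)
    (ms a y ua yv).
  rewrite /integral_speed -/(itv_integral (speed f K gam) u y) E.
  apply: approximable_cat Aa _; apply: H => //.
    by rewrite /ball /= ltr_norml; apply/andP; split; lra.
  have yd : y <= sup S + d / 2 by rewrite /y ge_min lexx orbT.
  by rewrite /ball /= ltr_norml; apply/andP; split; lra.
have ysup : y <= sup S by apply: ub_le_sup => //; exists v.
suff <- : y = v by exact: Sy.2.
apply/eqP; rewrite eq_le yv /=.
move: ysup; rewrite /y ge_min => /orP[vs|]; last lra.
by rewrite le_min lexx /= (le_trans vs)// lerDl divr_ge0// ltW.
Qed.

Lemma approximable_closure_path K gam a b s : closure_path K a b gam s ->
  approximable gam a b (closure_length f K a gam s).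
Proof.
move=> [cg p C]; elim: s a cg p C => [|c s IH] a cg p C.
  rewrite (itv_partition_nil p) /closure_length big_nil; exact: approximable_refl.
have [/= /andP[ac _] _] := p; have pc := itv_partition_cons p.
have cb := itv_partition_le pc.
rewrite /closure_length /= big_cons /=; apply: (@approximable_cat _ _ c).
  apply: approximable_piece => //.
    apply: continuous_subspaceW cg => t /=; rewrite !in_itv /= => /andP[-> /le_trans]; exact.
  by apply: (C (a, c)); rewrite /= mem_head.
apply: IH => //.
  apply: continuous_subspaceW cg => t /=; rewrite !in_itv /= => /andP[ct ->].
  by rewrite (le_trans (ltW ac)).
by move=> uv uvs; apply: C; rewrite /= inE uvs orbT.
Qed.

Lemma approximable_path_II gam a b (D : decomp R n) :
  itv_partition a b (end_times D) ->
  (forall ud, ud \in zip (a :: end_times D) D ->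
     closure_path ud.2.1.2 ud.1 ud.2.1.1 gam ud.2.2) ->
  approximable gam a b (length_II f a gam D).
Proof.
elim: D a => [|[[c K] s] D IH] a p C.
  rewrite (itv_partition_nil p) /length_II big_nil; exact: approximable_refl.
have pc := itv_partition_cons p.
rewrite /length_II /= big_cons /=; apply: (@approximable_cat _ _ c).
  apply: approximable_closure_path.
  by apply: (C (a, (c, K, s))); rewrite /= mem_head.
by apply: IH => // ud udD; apply: C; rewrite /= inE udD orbT.
Qed.

End Approximation.

(** * Comparison of lengths and of distances *)
Section LengthOfPaths.
Context {R : realType} {n : nat}.
Variable f : 'rV[R]_n -> R.
Hypothesis f_adm : admissible f.
Implicit Types (K : {set 'I_n}) (gam : R -> wflag R n).

Lemma cell_inj K K' (w : wflag R n) : cell K w -> cell K' w -> K = K'.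
Proof. by move=> /supp_open_simplex <- /supp_open_simplex. Qed.

Lemma length_closure_paths K gam a b (D : decomp R n) :
  itv_partition a b (end_times D) ->
  (forall ud, ud \in zip (a :: end_times D) D -> ud.2.1.2 = K /\
     closure_path ud.2.1.2 ud.1 ud.2.1.1 gam ud.2.2) ->
  measurable_fun `]a, b[ (speed f K gam) /\
  length_II f a gam D = integral_speed f K gam a b.
Proof.
elim: D a => [|[[c K'] s] D IH] a p C.
  rewrite (itv_partition_nil p); split.
    by rewrite set_itvoo0; exact: measurable_fun_set0.
  by rewrite /length_II big_nil /integral_speed set_itv1 integral_set1.
have [/= /andP[ac _] _] := p; have pc := itv_partition_cons p.
have cb := itv_partition_le pc.
have [|m1 E1] := IH c pc.
  by move=> ud udD; apply: C; rewrite /= inE udD orbT.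
have [|/= KE Cac] := C (a, (c, K', s)); first by rewrite /= mem_head.
rewrite KE in Cac.
have [m0 E0] := closure_lengthE f_adm Cac.
have [m E] := itv_integralD (speed_ge0 f K gam) (ltW ac) cb m0 m1.
by split=> //; rewrite /length_II /= big_cons /= KE E0 -/(length_II f c gam D) E1 -E.
Qed.

(** The cell has to be nonempty, which holds because a simplex without vertices
    has no point. *)
Lemma path_II_of_I gam a b : path_I a b gam ->
  exists D : decomp R n, path_II a b gam D.
Proof.
move=> [ab [s C]]; exists [:: (b, [set: 'I_n]%SET, s)].
have [cg p Cp] := C.
split=> //; first exact: itv_partition1.
move=> ud; rewrite /= inE => /eqP -> /=; split=> //.
case: s p Cp {C} => [/itv_partition_nil e|c s p Cp]; first by rewrite e ltxx in ab.
have [/= /andP[ac _] _] := p.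
have [cell_ac _] : C1_piece [set: 'I_n]%SET a c gam by apply: (Cp (a, c)); rewrite /= mem_head.
have h : (a + c) / 2 \in `]a, c[ by rewrite in_itv /=; apply/andP; split; lra.
have [[_ w1] _] := cell_ac _ h.
apply/negP => /eqP T0.
have : \sum_i weight (gam ((a + c) / 2)) 0 i = 0.
  apply: big1 => i _; have := finset.in_setT i; rewrite T0.
  by rewrite finset.in_set0.
by rewrite w1 => /eqP; rewrite oner_eq0.
Qed.

(** Some time of the given piece is inner both to it and to a piece of the path
    in sense I, and cells are disjoint. *)
Lemma path_I_cells gam a b D : path_I a b gam -> path_II a b gam D ->
  forall ud, ud \in zip (a :: end_times D) D -> ud.2.1.2 = [set: 'I_n]%SET.
Proof.
move=> [ab [s [_ ps Cs]]] [_ _ pD CD] [r [[c K] s']] udD /=.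
have [_ /= [_ p' C']] := CD _ udD.
have [ar rc cb] : [/\ a <= r, r < c & c <= b].
  apply: (@zip_partition_bounds R a b (end_times D) (r, c)) => //.
  have : (r, (c, K, s')).2.1.1 = c by [].
  elim: D a {ab ps Cs pD CD} udD => [|d D IH] a //=; rewrite !inE.
  by move=> /predU1P[[-> <-]|/IH h] e; [rewrite eqxx|rewrite h// orbT].
case: s' p' C' {CD udD} => [/itv_partition_nil e|c' s' p' C']; first by rewrite e ltxx in rc.
have [/= /andP[rc' _] _] := p'.
have c'c := itv_partition_le (itv_partition_cons p').
have [t trc ts] := exists_notin_itv s rc'.
have tab : t \in `]a, b[.
  move: trc; rewrite !in_itv /= => /andP[rt tc].
  by rewrite (le_lt_trans ar rt) (lt_le_trans tc (le_trans c'c cb)).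
have [uv uvs tuv] := zip_partition_cover ps tab ts.
have [cK _] : C1_piece K r c' gam by apply: (C' (r, c')); rewrite /= mem_head.
exact: cell_inj (cK t trc) ((Cs uv uvs).1 t tuv).
Qed.

Lemma length_II_of_I gam a b D : path_I a b gam -> path_II a b gam D ->
  length_II f a gam D = length_I f a b gam.
Proof.
move=> pI pII; have KD := path_I_cells pI pII; have [_ _ p C] := pII.
have [|_ ->//] := @length_closure_paths [set: 'I_n]%SET gam a b D p.
by move=> ud udD; split; [exact: KD|exact: (C ud udD).2].
Qed.

Lemma dist_II_le_I (p q : wflag R n) : (dist_II f p q <= dist_I f p q)%E.
Proof.
apply: le_ereal_inf => L [a [b [gam [pI ga gb ->]]]].
have [D pII] := path_II_of_I pI.
by exists a, b, gam, D; split => //; rewrite (length_II_of_I pI pII).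
Qed.

(** For a path of time interval [a, b], the error per unit of time is e / (b - a). *)
Lemma dist_I_le_II (p q : wflag R n) : (1 <= n)%N ->
  (dist_I f p q <= dist_II f p q)%E.
Proof.
move=> n1; apply: le_ereal_inf_tmp => _ [a [b [gam [D [pII ga gb ->]]]]].
have [ab _ pD CD] := pII.
apply/lee_addgt0Pr => e e0.
have eab : 0 < e / (b - a) by rewrite divr_gt0// subr_gt0.
have [g [s [Cs gxa gxb l]]] := approximable_path_II n1 f_adm eab pD
  (fun ud udD => (CD ud udD).2).
apply: (@le_trans _ _ (closure_length f [set: 'I_n]%SET a g s)); last first.
  by move: l; rewrite divfK// gt_eqF// subr_gt0.
have [_ ->] := closure_lengthE f_adm Cs.
apply: ereal_inf_lbound; exists a, b, g; split => //.
- by split=> //; exists s.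
- by rewrite gxa.
- by rewrite gxb.
Qed.

End LengthOfPaths.

Theorem proposition4p10 (R : realType) (n : nat) (n_ge1 : (1 <= n)%N)
    (f : 'rV[R]_n -> R) (f_adm : admissible f) :
  (forall (a b : R) (gam : R -> wflag R n), path_I a b gam ->
     (exists D : decomp R n, path_II a b gam D) /\
     (forall D : decomp R n, path_II a b gam D ->
        length_II f a gam D = length_I f a b gam)) /\
  (forall p q : wflag R n, dist_II f p q = dist_I f p q).
Proof.
split=> [a b gam pI|p q].
  by split=> [|D pII]; [exact: path_II_of_I|exact: length_II_of_I].
by apply/eqP; rewrite eq_le dist_II_le_I// dist_I_le_II.
Qed.
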